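(* Let $\mathbb{C}$ be a category. Then $\mathbb{C}$ is a semi-abelian, action representable, algebraically coherent category with normalizers if and only if the category $\mathsf{Grpd}(\mathbb{C})$ of internal groupoids in $\mathbb{C}$ is a semi-abelian, action representable, algebraically coherent category with normalizers.
   Context: A category is semi-abelian if it is pointed, finitely complete, finitely cocomplete, Barr-exact and Bourn-protomodular. A split extension in a pointed category is a diagram $X \xrightarrow{\kappa} A \rightleftarrows B$ with $\alpha\colon A\to B$, $\beta\colon B\to A$, $\alpha\beta=1_B$ and $\kappa$ a kernel of $\alpha$; morphisms of split extensions are triples of morphisms commuting with all the structure maps. A category is action representable if for every object $X$ there is a split extension with kernel $X$ (the generic split extension with kernel $X$) such that every split extension with kernel $X$ admits a unique morphism to it which is the identity on the kernel $X$. A semi-abelian category is algebraically coherent if for every cospan of monomorphisms of split extensions $(u_i,v_i,1_B)\colon (X_i\to A_i\rightleftarrows B)\to (X\to A\rightleftarrows B)$, $i=1,2$ (identity on the common codomain $B$), whenever $v_1,v_2$ are jointly strongly epimorphic so are $u_1,u_2$. The category has normalizers if every monomorphism $f\colon A\to B$ has a normalizer: a terminal object among triples $(N,n,m)$ with $n\colon A\to N$ a normal monomorphism, $m\colon N\to B$ a monomorphism and $mn=f$. $\mathsf{Grpd}(\mathbb{C})$ is the category of internal groupoids in $\mathbb{C}$ and internal functors. *)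

(* Defs.v *)
From Stdlib Require Import ProofIrrelevance.
Set Implicit Arguments.

Record Category := {
  Ob :> Type;
  Hom : Ob -> Ob -> Type;
  idm : forall a : Ob, Hom a a;
  comp : forall a b c : Ob, Hom b c -> Hom a b -> Hom a c;
  comp_assoc : forall a b c d (f : Hom a b) (g : Hom b c) (h : Hom c d),
      comp h (comp g f) = comp (comp h g) f;
  comp_id_l : forall a b (f : Hom a b), comp (idm b) f = f;
  comp_id_r : forall a b (f : Hom a b), comp f (idm a) = f }.
Arguments Hom {_} _ _.
Arguments idm {_} _.
Arguments comp {_ _ _ _} _ _.
Arguments comp_assoc {_ _ _ _ _} _ _ _.
Arguments comp_id_l {_ _ _} _.
Arguments comp_id_r {_ _ _} _.

Notation "g ∘ f" := (comp g f) (at level 40, left associativity).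

Section General.
Context {C : Category}.

Definition mono {a b : C} (f : Hom a b) : Prop :=
  forall (T : C) (g h : Hom T a), f ∘ g = f ∘ h -> g = h.

Definition iso {a b : C} (f : Hom a b) : Prop :=
  exists g : Hom b a, g ∘ f = idm a /\ f ∘ g = idm b.

Definition is_terminal (t : C) : Prop :=
  forall a : C, exists f : Hom a t, forall g : Hom a t, g = f.
Definition is_initial (z : C) : Prop :=
  forall a : C, exists f : Hom z a, forall g : Hom z a, g = f.
Definition is_zero_obj (z : C) : Prop := is_initial z /\ is_terminal z.

Definition pointed : Prop := exists z : C, is_zero_obj z.

Definition is_zero_mor {a b : C} (f : Hom a b) : Prop :=
  exists (z : C) (u : Hom a z) (v : Hom z b), is_zero_obj z /\ f = v ∘ u.

Definition is_pullback {a b c P : C} (f : Hom a c) (g : Hom b c)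
  (p : Hom P a) (q : Hom P b) : Prop :=
  f ∘ p = g ∘ q /\
  forall (T : C) (x : Hom T a) (y : Hom T b), f ∘ x = g ∘ y ->
    exists h : Hom T P, (p ∘ h = x /\ q ∘ h = y) /\
      forall h' : Hom T P, p ∘ h' = x -> q ∘ h' = y -> h' = h.

Definition is_pushout {a b c Q : C} (f : Hom c a) (g : Hom c b)
  (p : Hom a Q) (q : Hom b Q) : Prop :=
  p ∘ f = q ∘ g /\
  forall (T : C) (x : Hom a T) (y : Hom b T), x ∘ f = y ∘ g ->
    exists h : Hom Q T, (h ∘ p = x /\ h ∘ q = y) /\
      forall h' : Hom Q T, h' ∘ p = x -> h' ∘ q = y -> h' = h.

Definition finitely_complete : Prop :=
  (exists t : C, is_terminal t) /\
  forall (a b c : C) (f : Hom a c) (g : Hom b c),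
    exists (P : C) (p : Hom P a) (q : Hom P b), is_pullback f g p q.

Definition finitely_cocomplete : Prop :=
  (exists z : C, is_initial z) /\
  forall (a b c : C) (f : Hom c a) (g : Hom c b),
    exists (Q : C) (p : Hom a Q) (q : Hom b Q), is_pushout f g p q.

Definition is_coequalizer {a b Q : C} (f g : Hom a b) (q : Hom b Q) : Prop :=
  q ∘ f = q ∘ g /\
  forall (T : C) (x : Hom b T), x ∘ f = x ∘ g ->
    exists h : Hom Q T, h ∘ q = x /\ forall h' : Hom Q T, h' ∘ q = x -> h' = h.

Definition regular_epi {b Q : C} (q : Hom b Q) : Prop :=
  exists (a : C) (f g : Hom a b), is_coequalizer f g q.

Definition is_kernel_pair {a b R : C} (f : Hom a b) (r1 r2 : Hom R a) : Prop :=
  is_pullback f f r1 r2.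

Definition regular : Prop :=
  finitely_complete /\
  (forall (a b R : C) (f : Hom a b) (r1 r2 : Hom R a), is_kernel_pair f r1 r2 ->
     exists (Q : C) (q : Hom a Q), is_coequalizer r1 r2 q) /\
  (forall (a b c P : C) (f : Hom a c) (g : Hom b c) (p : Hom P a) (q : Hom P b),
     is_pullback f g p q -> regular_epi f -> regular_epi q).

Definition equivalence_relation {a R : C} (r1 r2 : Hom R a) : Prop :=
  (forall (T : C) (x y : Hom T R), r1 ∘ x = r1 ∘ y -> r2 ∘ x = r2 ∘ y -> x = y) /\
  (exists s : Hom a R, r1 ∘ s = idm a /\ r2 ∘ s = idm a) /\
  (exists t : Hom R R, r1 ∘ t = r2 /\ r2 ∘ t = r1) /\
  (forall (P : C) (p q : Hom P R), is_pullback r2 r1 p q ->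
     exists m : Hom P R, r1 ∘ m = r1 ∘ p /\ r2 ∘ m = r2 ∘ q).

Definition effective {a R : C} (r1 r2 : Hom R a) : Prop :=
  exists (b : C) (f : Hom a b), is_kernel_pair f r1 r2.

Definition Barr_exact : Prop :=
  regular /\
  forall (a R : C) (r1 r2 : Hom R a), equivalence_relation r1 r2 -> effective r1 r2.

(** Bourn protomodularity: the change-of-base functors of the fibration of
    points (split epimorphisms with chosen splitting) reflect isomorphisms. *)
Definition protomodular : Prop :=
  forall (E B A A' P P' : C) (f : Hom E B)
    (p : Hom A B) (s : Hom B A) (p' : Hom A' B) (s' : Hom B A') (h : Hom A A')
    (pi1 : Hom P A) (pi2 : Hom P E) (pi1' : Hom P' A') (pi2' : Hom P' E)
    (k : Hom P P'),
    p ∘ s = idm B -> p' ∘ s' = idm B ->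
    p' ∘ h = p -> h ∘ s = s' ->
    is_pullback p f pi1 pi2 -> is_pullback p' f pi1' pi2' ->
    pi1' ∘ k = h ∘ pi1 -> pi2' ∘ k = pi2 ->
    iso k -> iso h.

Definition semi_abelian : Prop :=
  pointed /\ finitely_complete /\ finitely_cocomplete /\ Barr_exact /\ protomodular.

Definition is_kernel {x a b : C} (f : Hom a b) (k : Hom x a) : Prop :=
  is_zero_mor (f ∘ k) /\
  forall (T : C) (g : Hom T a), is_zero_mor (f ∘ g) ->
    exists h : Hom T x, k ∘ h = g /\ forall h' : Hom T x, k ∘ h' = g -> h' = h.

Definition normal_mono {x a : C} (k : Hom x a) : Prop :=
  exists (b : C) (f : Hom a b), is_kernel f k.

Record SplitExt (X B : C) := {
  se_A : C;
  se_k : Hom X se_A;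
  se_a : Hom se_A B;
  se_b : Hom B se_A;
  se_ab : se_a ∘ se_b = idm B;
  se_ker : is_kernel se_a se_k }.

Definition se_mor {X B X' B' : C} (E : SplitExt X B) (E' : SplitExt X' B')
  (x : Hom X X') (u : Hom (se_A E) (se_A E')) (v : Hom B B') : Prop :=
  u ∘ se_k E = se_k E' ∘ x /\ se_a E' ∘ u = v ∘ se_a E /\ u ∘ se_b E = se_b E' ∘ v.

Definition se_mono {X B X' B' : C} (E : SplitExt X B) (E' : SplitExt X' B')
  (x : Hom X X') (u : Hom (se_A E) (se_A E')) (v : Hom B B') : Prop :=
  se_mor E E' x u v /\
  forall (X0 B0 : C) (E0 : SplitExt X0 B0)
    (x1 : Hom X0 X) (u1 : Hom (se_A E0) (se_A E)) (v1 : Hom B0 B)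
    (x2 : Hom X0 X) (u2 : Hom (se_A E0) (se_A E)) (v2 : Hom B0 B),
    se_mor E0 E x1 u1 v1 -> se_mor E0 E x2 u2 v2 ->
    x ∘ x1 = x ∘ x2 -> u ∘ u1 = u ∘ u2 -> v ∘ v1 = v ∘ v2 ->
    x1 = x2 /\ u1 = u2 /\ v1 = v2.

Definition action_representable : Prop :=
  forall X : C, exists (B : C) (G : SplitExt X B),
    forall (B' : C) (E : SplitExt X B'),
      exists (u : Hom (se_A E) (se_A G)) (v : Hom B' B),
        se_mor E G (idm X) u v /\
        forall (u' : Hom (se_A E) (se_A G)) (v' : Hom B' B),
          se_mor E G (idm X) u' v' -> u' = u /\ v' = v.

Definition jointly_strongly_epic {a1 a2 a : C} (f1 : Hom a1 a) (f2 : Hom a2 a) : Prop :=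
  (forall (T : C) (g h : Hom a T), g ∘ f1 = h ∘ f1 -> g ∘ f2 = h ∘ f2 -> g = h) /\
  (forall (M N : C) (m : Hom M N) (g : Hom a N) (h1 : Hom a1 M) (h2 : Hom a2 M),
     mono m -> m ∘ h1 = g ∘ f1 -> m ∘ h2 = g ∘ f2 ->
     exists d : Hom a M, m ∘ d = g /\ d ∘ f1 = h1 /\ d ∘ f2 = h2).

Definition algebraically_coherent : Prop :=
  forall (X1 X2 X B : C) (E1 : SplitExt X1 B) (E2 : SplitExt X2 B) (E : SplitExt X B)
    (u1 : Hom X1 X) (v1 : Hom (se_A E1) (se_A E))
    (u2 : Hom X2 X) (v2 : Hom (se_A E2) (se_A E)),
    se_mono E1 E u1 v1 (idm B) -> se_mono E2 E u2 v2 (idm B) ->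
    jointly_strongly_epic v1 v2 -> jointly_strongly_epic u1 u2.

Definition has_normalizers : Prop :=
  forall (a b : C) (f : Hom a b), mono f ->
    exists (N : C) (n : Hom a N) (m : Hom N b),
      (normal_mono n /\ mono m /\ m ∘ n = f) /\
      forall (N' : C) (n' : Hom a N') (m' : Hom N' b),
        normal_mono n' -> mono m' -> m' ∘ n' = f ->
        exists t : Hom N' N, (t ∘ n' = n /\ m ∘ t = m') /\
          forall t' : Hom N' N, t' ∘ n' = n -> m ∘ t' = m' -> t' = t.

Lemma pullback_ext {a b c P T : C} (f : Hom a c) (g : Hom b c)
  (p : Hom P a) (q : Hom P b) (h h' : Hom T P) :
  is_pullback f g p q -> p ∘ h = p ∘ h' -> q ∘ h = q ∘ h' -> h = h'.
Proof.
  intros [Hc Hu] E1 E2.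
  destruct (Hu T (p ∘ h) (q ∘ h)) as [k [_ Hk]].
  { rewrite !comp_assoc, Hc; reflexivity. }
  rewrite (Hk h eq_refl eq_refl), (Hk h' (eq_sym E1) (eq_sym E2)); reflexivity.
Qed.

End General.

(** * Internal groupoids in C.
    Arrows C1 with domain d, codomain c, identities e, inverse i, a (given)
    pullback P of d and c (object of composable pairs (g,f) with d g = c f,
    p1 = g, p2 = f) and composition m : P -> C1 (m (g,f) = g f).
    Axioms are phrased with generalized elements. *)
Section Internal.
Context (C : Category).

Record IGrpd := {
  g0 : C; g1 : C;
  gd : Hom g1 g0; gc : Hom g1 g0; ge : Hom g0 g1; gi : Hom g1 g1;
  gP : C; gp1 : Hom gP g1; gp2 : Hom gP g1; gm : Hom gP g1;
  gpb : is_pullback gd gc gp1 gp2;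
  g_de : gd ∘ ge = idm g0;
  g_ce : gc ∘ ge = idm g0;
  g_dm : gd ∘ gm = gd ∘ gp2;
  g_cm : gc ∘ gm = gc ∘ gp1;
  g_unit_l : forall (T : C) (f : Hom T g1) (x : Hom T gP),
      gp1 ∘ x = ge ∘ (gc ∘ f) -> gp2 ∘ x = f -> gm ∘ x = f;
  g_unit_r : forall (T : C) (f : Hom T g1) (x : Hom T gP),
      gp1 ∘ x = f -> gp2 ∘ x = ge ∘ (gd ∘ f) -> gm ∘ x = f;
  g_assoc : forall (T : C) (x y x' y' : Hom T gP),
      gp2 ∘ x = gp1 ∘ y ->
      gp1 ∘ x' = gm ∘ x -> gp2 ∘ x' = gp2 ∘ y ->
      gp1 ∘ y' = gp1 ∘ x -> gp2 ∘ y' = gm ∘ y ->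
      gm ∘ x' = gm ∘ y';
  g_di : gd ∘ gi = gc;
  g_ci : gc ∘ gi = gd;
  g_inv_l : forall (T : C) (f : Hom T g1) (x : Hom T gP),
      gp1 ∘ x = gi ∘ f -> gp2 ∘ x = f -> gm ∘ x = ge ∘ (gd ∘ f);
  g_inv_r : forall (T : C) (f : Hom T g1) (x : Hom T gP),
      gp1 ∘ x = f -> gp2 ∘ x = gi ∘ f -> gm ∘ x = ge ∘ (gc ∘ f) }.

Record IFun (G H : IGrpd) := {
  f0 : Hom (g0 G) (g0 H);
  f1 : Hom (g1 G) (g1 H);
  f_d : gd H ∘ f1 = f0 ∘ gd G;
  f_c : gc H ∘ f1 = f0 ∘ gc G;
  f_e : f1 ∘ ge G = ge H ∘ f0;
  f_m : forall h : Hom (gP G) (gP H),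
      gp1 H ∘ h = f1 ∘ gp1 G -> gp2 H ∘ h = f1 ∘ gp2 G ->
      f1 ∘ gm G = gm H ∘ h }.

Lemma IFun_eq (G H : IGrpd) (F F' : IFun G H) :
  f0 F = f0 F' -> f1 F = f1 F' -> F = F'.
Proof.
  destruct F, F'; simpl; intros; subst; f_equal; apply proof_irrelevance.
Qed.

Definition IFun_id (G : IGrpd) : IFun G G.
Proof.
  refine {| f0 := idm (g0 G); f1 := idm (g1 G) |};
    try (now rewrite comp_id_l, comp_id_r).
  intros h H1 H2. rewrite comp_id_l in H1, H2.
  assert (E : h = idm (gP G)).
  { eapply pullback_ext; [exact (gpb G) | rewrite comp_id_r; exact H1 | rewrite comp_id_r; exact H2]. }
  subst h. now rewrite comp_id_l, comp_id_r.
Defined.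

Lemma induced_pair (G H : IGrpd) (F : IFun G H) :
  exists h : Hom (gP G) (gP H),
    gp1 H ∘ h = f1 F ∘ gp1 G /\ gp2 H ∘ h = f1 F ∘ gp2 G.
Proof.
  destruct (gpb H) as [_ Hu].
  destruct (Hu (gP G) (f1 F ∘ gp1 G) (f1 F ∘ gp2 G)) as [h [[E1 E2] _]].
  - rewrite !comp_assoc, (f_d F), (f_c F), <- !comp_assoc.
    destruct (gpb G) as [Hc _]. now rewrite Hc.
  - exists h; auto.
Qed.

Definition IFun_comp (G H K : IGrpd) (F' : IFun H K) (F : IFun G H) : IFun G K.
Proof.
  refine {| f0 := f0 F' ∘ f0 F; f1 := f1 F' ∘ f1 F |}.
  - now rewrite comp_assoc, (f_d F'), <- comp_assoc, (f_d F), comp_assoc.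
  - now rewrite comp_assoc, (f_c F'), <- comp_assoc, (f_c F), comp_assoc.
  - now rewrite <- comp_assoc, (f_e F), comp_assoc, (f_e F'), <- comp_assoc.
  - intros h H0 H1.
    destruct (induced_pair F) as [h1 [A1 A2]].
    destruct (induced_pair F') as [h2 [B1 B2]].
    rewrite <- comp_assoc, (f_m F h1 A1 A2), comp_assoc, (f_m F' h2 B1 B2), <- comp_assoc.
    f_equal. eapply pullback_ext; [exact (gpb K) | |].
    + rewrite H0, comp_assoc, B1, <- comp_assoc, A1, comp_assoc; reflexivity.
    + rewrite H1, comp_assoc, B2, <- comp_assoc, A2, comp_assoc; reflexivity.
Defined.

Definition Grpd : Category.
Proof.
  refine {| Ob := IGrpd; Hom := IFun; idm := IFun_id; comp := IFun_comp |}.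
  - intros; apply IFun_eq; simpl; apply comp_assoc.
  - intros; apply IFun_eq; simpl; apply comp_id_l.
  - intros; apply IFun_eq; simpl; apply comp_id_r.
Defined.

End Internal.

(* Main.v *)
(** If [Grpd C] has the properties, so does [C]: [C] is the full coreflective subcategory of
    discrete groupoids, and both the inclusion and the coreflector [g0] preserve whatever
    occurs in them.

    Conversely, let [C] have the properties.  By protomodularity the pairs (x, y) of arrows
    with a common domain are generated by the pairs (x, 1) and (x, x), so a reflexive graph
    carries at most one division (x, y) |-> x y^-1; it is a groupoid exactly when it carries
    one, and then graph morphisms are functors.  Hence groupoids are stable under subgraphs
    and quotients, limits, images, kernels and joins are computed levelwise, and the
    semi-abelian structure, algebraic coherence and normalizers lift from [C].

    For action representability, normalizers represent the condition that a morphism be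
    equivariant for two given actions, so there are a universal object [G0] of actions on a
    groupoid [X] and a universal object [G1] of arrows between such actions.  The division of
    two arrows of [G1] with the same source acts on pairs of arrows of [X] and passes to the
    quotient along the division of [X], whose kernel is the diagonal of ker c.  That an arrow
    divided by itself is an identity holds because both actions agree on ker d and on the
    identities of [X]: these generate the arrows of [X], and by algebraic coherence an action
    is determined by its restrictions to generating subobjects. *)

Require Import Defs.
Set Implicit Arguments.

(** * Limits, kernels and strong epimorphisms *)

(** A division is used instead of a composition because its two laws concern only the generating
    pairs: each is a single equation, and associativity and inverses follow from them through (x
    z^-1)(y z^-1)^-1 = x y^-1. Hence a division passes to subgraphs and quotients without any law on
    triples being transported.

    The obstacle for the actor is that its arrows must be cut out by conditions that normalizers can
    represent, that is, by equivariance of single morphisms, whereas functoriality of a split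
    extension relates the actions of several arrows at once. It is replaced by two consequences that
    concern one arrow with its source and target: on ker c it acts as its source does, on ker d as
    its target does. They are strong enough to make division possible, and are the reason why an
    object of the actor records actions on ker c and ker d.

    The definitions assert existence propositionally, so universal constructions are eliminated
    inside proofs, and actions are handled as predicates on generalized elements. *)

Section Reassociation.
Context {C : Category}.

Lemma reassoc2 {T a b c : C} {f : Hom b c} {g : Hom a b} {h} (x : Hom T a) :
  f ∘ g = h -> f ∘ (g ∘ x) = h ∘ x.
Proof. intros <-; apply comp_assoc. Qed.

Lemma reassoc3 {T a b c d : C} {f : Hom c d} {g : Hom b c} {k : Hom a b} {h}
  (x : Hom T a) : f ∘ (g ∘ k) = h -> f ∘ (g ∘ (k ∘ x)) = h ∘ x.
Proof. intros <-; now rewrite !comp_assoc. Qed.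

Lemma reassoc4 {T a b c d e : C} {f : Hom d e} {g : Hom c d} {k : Hom b c}
  {l : Hom a b} {h} (x : Hom T a) :
  f ∘ (g ∘ (k ∘ l)) = h -> f ∘ (g ∘ (k ∘ (l ∘ x))) = h ∘ x.
Proof. intros <-; now rewrite !comp_assoc. Qed.

End Reassociation.

Ltac cn := repeat first [rewrite comp_id_l | rewrite comp_id_r | rewrite <- comp_assoc].
Ltac cn_in H :=
  repeat first [rewrite comp_id_l in H | rewrite comp_id_r in H
               | rewrite <- comp_assoc in H].
(* Rewrites with [H] modulo associativity and units. *)
Ltac rw_one H :=
  let H' := fresh in
  pose proof H as H'; cn_in H'; cn;
  first [ rewrite H' | rewrite (reassoc2 _ H') | rewrite (reassoc3 _ H')
        | rewrite (reassoc4 _ H')];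
  cn; clear H'.
Tactic Notation "rw" constr(a) := rw_one a.
Tactic Notation "rw" constr(a) "," constr(b) := rw a; rw b.
Tactic Notation "rw" constr(a) "," constr(b) "," constr(c) := rw a; rw b; rw c.
Tactic Notation "rw" constr(a) "," constr(b) "," constr(c) "," constr(d) :=
  rw a, b; rw c, d.
Tactic Notation "rw" constr(a) "," constr(b) "," constr(c) "," constr(d) "," constr(e) :=
  rw a, b; rw c, d, e.
Tactic Notation "rw" constr(a) "," constr(b) "," constr(c) "," constr(d) "," constr(e)
  "," constr(f) := rw a, b, c; rw d, e, f.

Section Basic.
Context {C : Category}.

Lemma comp_l {a b c : C} (h : Hom b c) {f g : Hom a b} : f = g -> h ∘ f = h ∘ g.
Proof. now intros ->. Qed.

Lemma comp_r {a b c : C} (h : Hom a b) {f g : Hom b c} : f = g -> f ∘ h = g ∘ h.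
Proof. now intros ->. Qed.

Lemma iso_id (a : C) : iso (idm a).
Proof. exists (idm a); now cn. Qed.

Lemma mono_comp {a b c : C} {g : Hom b c} {f : Hom a b} : mono g -> mono f -> mono (g ∘ f).
Proof.
  intros Hg Hf T x y H; apply Hf, Hg; cn_in H; exact H.
Qed.

Lemma mono_cancel {a b c : C} (g : Hom b c) {f : Hom a b} : mono (g ∘ f) -> mono f.
Proof. intros H T x y E; apply H; cn; now rw E. Qed.

Lemma split_mono {a b : C} {f : Hom a b} {g : Hom b a} : g ∘ f = idm a -> mono f.
Proof.
  intros H T x y E; apply (comp_l g) in E; cn_in E; revert E; now rw H, H.
Qed.

Lemma iso_mono {a b : C} {f : Hom a b} : iso f -> mono f.
Proof. intros (g & H & _); exact (split_mono H). Qed.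

Lemma mono_split_iso {a b : C} {m : Hom a b} (d : Hom b a) :
  mono m -> m ∘ d = idm b -> iso m.
Proof. intros Hm H; exists d; split; [apply Hm; now rw H | exact H]. Qed.

Lemma terminal_eq {t a : C} (f g : Hom a t) : is_terminal t -> f = g.
Proof. intros H; destruct (H a) as [h Hh]; now rewrite (Hh f), (Hh g). Qed.

Lemma initial_eq {t a : C} (f g : Hom t a) : is_initial t -> f = g.
Proof. intros H; destruct (H a) as [h Hh]; now rewrite (Hh f), (Hh g). Qed.

Lemma zero_mor_l {a b c : C} (g : Hom b c) {f : Hom a b} :
  is_zero_mor f -> is_zero_mor (g ∘ f).
Proof. intros (z & u & v & Z & ->); exists z, u, (g ∘ v); split; [exact Z | now cn]. Qed.

Lemma zero_mor_r {a b c : C} {g : Hom b c} (f : Hom a b) :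
  is_zero_mor g -> is_zero_mor (g ∘ f).
Proof. intros (z & u & v & Z & ->); exists z, (u ∘ f), v; split; [exact Z | now cn]. Qed.

Lemma zero_mor_eq {a b : C} {f g : Hom a b} : is_zero_mor f -> is_zero_mor g -> f = g.
Proof.
  intros (z & u & v & Z & ->) (z' & u' & v' & Z' & ->).
  destruct (proj1 Z z') as [w _].
  rewrite (initial_eq v (v' ∘ w) (proj1 Z)); cn.
  apply comp_l, terminal_eq, Z'.
Qed.

Lemma zero_mor_mono {a b c : C} {m : Hom b c} {f : Hom a b} :
  mono m -> is_zero_mor (m ∘ f) -> is_zero_mor f.
Proof.
  intros Hm (z & u & v & Z & E).
  destruct (proj1 Z b) as [w _]; exists z, u, w; split; [exact Z|].
  rewrite <- (initial_eq (m ∘ w) v (proj1 Z)) in E; cn_in E; exact (Hm _ _ _ E).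
Qed.

Lemma pb_sym {a b c P : C} {f : Hom a c} {g : Hom b c} {p : Hom P a} {q : Hom P b} :
  is_pullback f g p q -> is_pullback g f q p.
Proof.
  intros [H U]; split; [now rewrite H|].
  intros T x y E; destruct (U T y x (eq_sym E)) as (h & [A B] & V).
  exists h; split; [now split|]; intros h' A' B'; now apply V.
Qed.

Lemma pb_comm {a b c P : C} {f : Hom a c} {g : Hom b c} {p : Hom P a} {q : Hom P b} :
  is_pullback f g p q -> f ∘ p = g ∘ q.
Proof. now intros []. Qed.

Lemma pb_lift {a b c P : C} {f : Hom a c} {g : Hom b c} {p : Hom P a} {q : Hom P b}
  {T : C} (x : Hom T a) (y : Hom T b) :
  is_pullback f g p q -> f ∘ x = g ∘ y -> exists h, p ∘ h = x /\ q ∘ h = y.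
Proof. intros [_ U] E; destruct (U T x y E) as (h & H & _); now exists h. Qed.

Lemma pb_intro {a b c P : C} (f : Hom a c) (g : Hom b c) (p : Hom P a) (q : Hom P b) :
  f ∘ p = g ∘ q ->
  (forall T (x y : Hom T P), p ∘ x = p ∘ y -> q ∘ x = q ∘ y -> x = y) ->
  (forall T (x : Hom T a) (y : Hom T b), f ∘ x = g ∘ y ->
     exists h, p ∘ h = x /\ q ∘ h = y) ->
  is_pullback f g p q.
Proof.
  intros H J U; split; [exact H|]; intros T x y E.
  destruct (U T x y E) as (h & A & B); exists h; split; [now split|].
  intros h' A' B'; apply J; congruence.
Qed.

Lemma pb_mono {a b c P : C} {f : Hom a c} {g : Hom b c} {p : Hom P a} {q : Hom P b} :
  is_pullback f g p q -> mono f -> mono q.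
Proof.
  intros H Hf T x y E; apply (pullback_ext _ _ H); [|exact E].
  apply Hf; rw (pb_comm H), E; now rw (pb_comm H).
Qed.

Lemma pb_iso {a b c P Q : C} {f : Hom a c} {g : Hom b c} {p : Hom P a} {q : Hom P b}
  {p' : Hom Q a} {q' : Hom Q b} {h : Hom Q P} :
  is_pullback f g p q -> p ∘ h = p' -> q ∘ h = q' -> iso h -> is_pullback f g p' q'.
Proof.
  intros H A B (k & K1 & K2); subst p' q'; apply pb_intro.
  - rw (pb_comm H); reflexivity.
  - intros T x y E1 E2; cn_in E1; cn_in E2.
    assert (h ∘ x = h ∘ y) by (apply (pullback_ext _ _ H); assumption).
    apply (comp_l k) in H0; revert H0; rw K1, K1; auto.
  - intros T x y E; destruct (pb_lift x y H E) as (w & A & B).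
    exists (k ∘ w); split; cn; rw K2; assumption.
Qed.

Lemma pb_unique_iso {a b c P Q : C} {f : Hom a c} {g : Hom b c} {p : Hom P a} {q : Hom P b}
  {p' : Hom Q a} {q' : Hom Q b} {h : Hom Q P} :
  is_pullback f g p q -> is_pullback f g p' q' -> p ∘ h = p' -> q ∘ h = q' -> iso h.
Proof.
  intros H H' A B; destruct (pb_lift p q H' (pb_comm H)) as (k & K1 & K2).
  exists k; split.
  - apply (pullback_ext _ _ H'); cn; [rw K1 | rw K2]; assumption.
  - apply (pullback_ext _ _ H); cn; [rw A | rw B]; assumption.
Qed.

Lemma ker_zero {x a b : C} {f : Hom a b} {k : Hom x a} : is_kernel f k -> is_zero_mor (f ∘ k).
Proof. now intros []. Qed.

Lemma ker_mono {x a b : C} {f : Hom a b} {k : Hom x a} : is_kernel f k -> mono k.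
Proof.
  intros [Z U] T g h E.
  destruct (U T (k ∘ g)) as (w & _ & V).
  { rewrite comp_assoc; now apply zero_mor_r. }
  rewrite (V g eq_refl); symmetry; apply V; now rewrite E.
Qed.

Lemma ker_lift {x a b T : C} {f : Hom a b} {k : Hom x a} (g : Hom T a) :
  is_kernel f k -> is_zero_mor (f ∘ g) -> exists h, k ∘ h = g.
Proof. intros [_ U] Z; destruct (U T g Z) as (h & H & _); now exists h. Qed.

Lemma ker_intro {x a b : C} (f : Hom a b) (k : Hom x a) :
  is_zero_mor (f ∘ k) -> mono k ->
  (forall T (g : Hom T a), is_zero_mor (f ∘ g) -> exists h, k ∘ h = g) -> is_kernel f k.
Proof.
  intros Z M U; split; [exact Z|]; intros T g Hg; destruct (U T g Hg) as (h & E).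
  exists h; split; [exact E|]; intros h' E'; apply M; congruence.
Qed.

Lemma ker_pb {x a b z : C} {f : Hom a b} {k : Hom x a} (o : Hom z b) (o' : Hom x z) :
  is_zero_obj z -> is_kernel f k -> is_pullback f o k o'.
Proof.
  intros Z K; apply pb_intro.
  - apply zero_mor_eq; [now apply ker_zero | now exists z, o', o].
  - intros T u v E _; exact (ker_mono K _ _ _ E).
  - intros T u v E; destruct (ker_lift u K) as (h & H).
    + rewrite E; now exists z, v, o.
    + exists h; split; [exact H | apply terminal_eq, Z].
Qed.

Lemma pb_ker {x a b z : C} {f : Hom a b} {k : Hom x a} {o : Hom z b} {o' : Hom x z} :
  is_zero_obj z -> is_pullback f o k o' -> is_kernel f k.
Proof.
  intros Z H; apply ker_intro.
  - rewrite (pb_comm H); now exists z, o', o.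
  - intros T u v E; apply (pullback_ext _ _ H E); apply terminal_eq, Z.
  - intros T g Hg; destruct (proj2 Z T) as [t _].
    destruct (pb_lift g t H) as (h & E & _); [|now exists h].
    apply zero_mor_eq; [exact Hg | now exists z, t, o].
Qed.

Lemma ker_of_comp_mono {x a b c : C} {m : Hom b c} {f : Hom a b} {k : Hom x a} :
  mono m -> is_kernel (m ∘ f) k -> is_kernel f k.
Proof.
  intros M K; apply ker_intro.
  - apply (zero_mor_mono M); rewrite comp_assoc; now apply ker_zero.
  - exact (ker_mono K).
  - intros T g Hg; apply (ker_lift g K); cn; now apply zero_mor_l.
Qed.

Lemma ker_through {x a b c : C} {m : Hom b a} {f : Hom a c} {k : Hom x a} {h : Hom x b} :
  mono m -> is_kernel f k -> m ∘ h = k -> is_kernel (f ∘ m) h.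
Proof.
  intros M K E; apply ker_intro.
  - cn; rw E; now apply ker_zero.
  - apply (mono_cancel m); rewrite E; exact (ker_mono K).
  - intros T g Hg; destruct (ker_lift (m ∘ g) K) as (w & W).
    + cn; now cn_in Hg.
    + exists w; apply M; now rw E.
Qed.

Lemma normal_mono_through {x a b : C} {m : Hom b a} {k : Hom x a} {h : Hom x b} :
  mono m -> normal_mono k -> m ∘ h = k -> normal_mono h.
Proof. intros M (c & f & K) E; exists c, (f ∘ m); exact (ker_through M K E). Qed.

Lemma normal_mono_pb {x a b y : C} {f : Hom b a} {k : Hom x a} {h : Hom y b} {g : Hom y x} :
  normal_mono k -> is_pullback f k h g -> normal_mono h.
Proof.
  intros (c & p & K) H; exists c, (p ∘ f); apply ker_intro.
  - cn; rw (pb_comm H); rewrite comp_assoc; apply zero_mor_r, ker_zero, K.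
  - exact (pb_mono (pb_sym H) (ker_mono K)).
  - intros T w Hw; destruct (ker_lift (f ∘ w) K) as (v & V); [now cn_in Hw|].
    destruct (pb_lift w v H (eq_sym V)) as (u & U & _); now exists u.
Qed.

Lemma normal_mono_iso {x a b : C} {k : Hom x a} {i : Hom a b} :
  normal_mono k -> iso i -> normal_mono (i ∘ k).
Proof.
  intros (c & f & K) (j & J1 & J2); exists c, (f ∘ j); apply ker_intro.
  - cn; rw J1; now apply ker_zero.
  - apply mono_comp; [exact (split_mono J1) | exact (ker_mono K)].
  - intros T g Hg; destruct (ker_lift (j ∘ g) K) as (h & H); [now cn_in Hg|].
    exists h; cn; rw H, J2; reflexivity.
Qed.

(** Extremality is the form that is easiest to verify. Lifting and cancellation follow from it in
    the presence of finite limits, and being a coequalizer in the semi-abelian case. *)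
Definition sepi {a b : C} (f : Hom a b) : Prop :=
  forall (M : C) (m : Hom M b) (h : Hom a M), mono m -> m ∘ h = f -> iso m.

Definition cover {a1 a2 a : C} (f1 : Hom a1 a) (f2 : Hom a2 a) : Prop :=
  forall (M : C) (m : Hom M a) (h1 : Hom a1 M) (h2 : Hom a2 M),
    mono m -> m ∘ h1 = f1 -> m ∘ h2 = f2 -> iso m.

Lemma regular_epi_sepi {a b : C} {f : Hom a b} : regular_epi f -> sepi f.
Proof.
  intros (r & u & v & E & U) M m h Hm <-.
  destruct (U M h) as (d & D & _); [apply Hm; cn_in E; exact E|].
  apply (mono_split_iso d Hm).
  destruct (U b (m ∘ h)) as (w & W & V); [now rewrite E|].
  rewrite (V (idm b)), (V (m ∘ d)); now cn; try rw D.
Qed.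

Lemma sepi_cancel {a b c : C} {g : Hom b c} {f : Hom a b} : sepi (g ∘ f) -> sepi g.
Proof. intros H M m h Hm E; apply (H M m (h ∘ f) Hm); now rw E. Qed.

Lemma iso_sepi {a b : C} {f : Hom a b} : iso f -> sepi f.
Proof.
  intros (g & _ & G) M m h Hm E; apply (mono_split_iso (h ∘ g) Hm); now rw E.
Qed.

Lemma split_sepi {a b : C} {f : Hom a b} {g : Hom b a} : f ∘ g = idm b -> sepi f.
Proof. intros G M m h Hm E; apply (mono_split_iso (h ∘ g) Hm); now rw E. Qed.

Lemma sepi_mono_iso {a b : C} {f : Hom a b} : sepi f -> mono f -> iso f.
Proof. intros H M; apply (H _ f (idm a) M); now cn. Qed.

Lemma jse_cover {a1 a2 a : C} {f1 : Hom a1 a} {f2 : Hom a2 a} :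
  jointly_strongly_epic f1 f2 -> cover f1 f2.
Proof.
  intros [_ H] M m h1 h2 Hm E1 E2.
  destruct (H M a m (idm a) h1 h2 Hm) as (d & D & _); try (now cn).
  exact (mono_split_iso d Hm D).
Qed.

End Basic.

Existing Class finitely_complete.

Section FiniteLimits.
Context {C : Category} {HC : @finitely_complete C}.

Lemma pb_ex {a b c : C} (f : Hom a c) (g : Hom b c) :
  exists P (p : Hom P a) (q : Hom P b), is_pullback f g p q.
Proof. exact (proj2 HC _ _ _ f g). Qed.

Lemma prod_ex (a b : C) : exists P (p : Hom P a) (q : Hom P b),
  (forall T (x y : Hom T P), p ∘ x = p ∘ y -> q ∘ x = q ∘ y -> x = y) /\
  (forall T (x : Hom T a) (y : Hom T b), exists h, p ∘ h = x /\ q ∘ h = y).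
Proof.
  destruct HC as [[t Ht] PB]; destruct (Ht a) as [u _], (Ht b) as [v _].
  destruct (PB _ _ _ u v) as (P & p & q & H); exists P, p, q; split.
  - intros T x y; exact (pullback_ext _ _ H).
  - intros T x y; apply (pb_lift _ _ H); apply (terminal_eq _ _ Ht).
Qed.

(** The equalizer is the pullback of the graphs <1, f> and <1, g> into the product. *)
Lemma eq_ex {a b : C} (f g : Hom a b) : exists E (e : Hom E a),
  mono e /\ f ∘ e = g ∘ e /\
  (forall T (x : Hom T a), f ∘ x = g ∘ x -> exists h, e ∘ h = x).
Proof.
  destruct (prod_ex a b) as (P & p & q & J & U).
  destruct (U a (idm a) f) as (F & F1 & F2), (U a (idm a) g) as (G & G1 & G2).
  destruct (pb_ex F G) as (E & e & e' & H).
  assert (K : e = e').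
  { pose proof (comp_l p (pb_comm H)) as K; revert K; rw F1, G1; auto. }
  subst e'; exists E, e; split; [|split].
  - intros T x y Exy; exact (pullback_ext _ _ H Exy Exy).
  - pose proof (comp_l q (pb_comm H)) as K; revert K; rw F2, G2; auto.
  - intros T x Ex; destruct (pb_lift x x H) as (h & Hh & _); [|now exists h].
    apply J; [rw F1, G1 | rw F2, G2]; auto.
Qed.

Lemma cover_epi {a1 a2 a T : C} {f1 : Hom a1 a} {f2 : Hom a2 a} (g h : Hom a T) :
  cover f1 f2 -> g ∘ f1 = h ∘ f1 -> g ∘ f2 = h ∘ f2 -> g = h.
Proof.
  intros H E1 E2; destruct (eq_ex g h) as (E & e & M & Ee & U).
  destruct (U _ _ E1) as (h1 & H1), (U _ _ E2) as (h2 & H2).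
  destruct (H E e h1 h2 M H1 H2) as (i & _ & I).
  pose proof (comp_r i Ee) as K; revert K; rw I; auto.
Qed.

(** Both maps factor through the pullback of [m] along [g], which is therefore invertible. *)
Lemma cover_lift {a1 a2 a M N : C} {f1 : Hom a1 a} {f2 : Hom a2 a} {m : Hom M N}
  (g : Hom a N) {h1 : Hom a1 M} {h2 : Hom a2 M} :
  cover f1 f2 -> mono m -> m ∘ h1 = g ∘ f1 -> m ∘ h2 = g ∘ f2 ->
  exists d : Hom a M, m ∘ d = g /\ d ∘ f1 = h1 /\ d ∘ f2 = h2.
Proof.
  intros H Hm E1 E2; destruct (pb_ex g m) as (P & p & q & PB).
  destruct (pb_lift f1 h1 PB (eq_sym E1)) as (w1 & A1 & _).
  destruct (pb_lift f2 h2 PB (eq_sym E2)) as (w2 & A2 & _).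
  destruct (H P p w1 w2 (pb_mono (pb_sym PB) Hm) A1 A2) as (i & _ & I).
  assert (D : m ∘ (q ∘ i) = g) by (rw (eq_sym (pb_comm PB)), I; reflexivity).
  exists (q ∘ i); split; [exact D|]; split; apply Hm; rewrite comp_assoc, D; auto.
Qed.

Lemma cover_jse {a1 a2 a : C} {f1 : Hom a1 a} {f2 : Hom a2 a} :
  cover f1 f2 -> jointly_strongly_epic f1 f2.
Proof.
  intros H; split.
  - intros T g h; exact (cover_epi g h H).
  - intros M N m g h1 h2 Hm; exact (cover_lift g H Hm).
Qed.

Lemma sepi_cover {a b : C} {f : Hom a b} : sepi f -> cover f f.
Proof. intros H M m h1 _ Hm E _; exact (H M m h1 Hm E). Qed.

Lemma sepi_epi {a b T : C} {f : Hom a b} (g h : Hom b T) :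
  sepi f -> g ∘ f = h ∘ f -> g = h.
Proof. intros H E; exact (cover_epi g h (sepi_cover H) E E). Qed.

Lemma sepi_lift {a b M N : C} {f : Hom a b} {m : Hom M N} (g : Hom b N) {h : Hom a M} :
  sepi f -> mono m -> m ∘ h = g ∘ f -> exists d, m ∘ d = g /\ d ∘ f = h.
Proof.
  intros H Hm E; destruct (cover_lift g (sepi_cover H) Hm E E) as (d & D & D' & _).
  now exists d.
Qed.

Lemma sepi_compose {a b c : C} {g : Hom b c} {f : Hom a b} :
  sepi g -> sepi f -> sepi (g ∘ f).
Proof.
  intros Hg Hf M m h Hm E; destruct (pb_ex g m) as (P & p & q & H).
  destruct (pb_lift f h H (eq_sym E)) as (w & W & _).
  destruct (Hf P p w (pb_mono (pb_sym H) Hm) W) as (i & I1 & I2).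
  apply (Hg M m (q ∘ i) Hm); rewrite comp_assoc, <- (pb_comm H); now cn; rw I2.
Qed.

Lemma cover_sepi {a1 a2 a b1 b2 : C} {f1 : Hom a1 a} {f2 : Hom a2 a} {g1 : Hom b1 a1}
  {g2 : Hom b2 a2} : sepi g1 -> sepi g2 -> cover f1 f2 -> cover (f1 ∘ g1) (f2 ∘ g2).
Proof.
  intros G1 G2 H M m h1 h2 Hm E1 E2.
  destruct (sepi_lift _ G1 Hm E1) as (d1 & D1 & _).
  destruct (sepi_lift _ G2 Hm E2) as (d2 & D2 & _).
  exact (H M m d1 d2 Hm D1 D2).
Qed.

End FiniteLimits.

(** * Semi-abelian categories *)

Existing Class semi_abelian.

#[export] Instance semi_abelian_complete {C : Category} {HS : @semi_abelian C} :
  @finitely_complete C.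
Proof. apply HS. Qed.

Section SemiAbelian.
Context {C : Category} {HS : @semi_abelian C}.

Lemma zero_obj_ex : exists z : C, is_zero_obj z.
Proof. apply HS. Qed.

Lemma zero_mor_ex (a b : C) : exists o : Hom a b, is_zero_mor o.
Proof.
  destruct zero_obj_ex as [z Z].
  destruct (proj2 Z a) as [u _], (proj1 Z b) as [v _].
  exists (v ∘ u), z, u, v; auto.
Qed.

Lemma ker_ex {a b : C} (f : Hom a b) : exists x (k : Hom x a), is_kernel f k.
Proof.
  destruct zero_obj_ex as [z Z]; destruct (proj1 Z b) as [v _].
  destruct (pb_ex f v) as (x & k & o & H); exists x, k; exact (pb_ker Z H).
Qed.

Lemma coprod_ex (a b : C) : exists P (i : Hom a P) (j : Hom b P),
  cover i j /\
  (forall T (x : Hom a T) (y : Hom b T), exists h, h ∘ i = x /\ h ∘ j = y).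
Proof.
  destruct (proj1 (proj2 (proj2 HS))) as [[z Hz] PO].
  destruct (Hz a) as [u _], (Hz b) as [v _].
  destruct (PO _ _ _ u v) as (P & i & j & _ & U); exists P, i, j; split.
  - intros M m h1 h2 Hm E1 E2.
    destruct (U M h1 h2) as (d & [D1 D2] & _); [apply (initial_eq _ _ Hz)|].
    apply (mono_split_iso d Hm).
    destruct (U P i j) as (w & _ & V); [apply (initial_eq _ _ Hz)|].
    rewrite (V (m ∘ d)), (V (idm P)); cn; auto; [rw D1 | rw D2]; auto.
  - intros T x y; destruct (U T x y) as (h & H & _); [apply (initial_eq _ _ Hz)|].
    now exists h.
Qed.

(** The form in which protomodularity is mostly used: a subobject of A containing [q1] and [s] is a
    point with the same pullback along [f] as A, so its inclusion becomes invertible after change of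
    base. *)
Lemma point_pb_cover {A B E P : C} {p : Hom A B} {s : Hom B A} {f : Hom E B}
  {q1 : Hom P A} {q2 : Hom P E} :
  p ∘ s = idm B -> is_pullback p f q1 q2 -> cover q1 s.
Proof.
  intros Hs PB M m x y Hm E1 E2.
  destruct HS as (_ & _ & _ & _ & HP).
  assert (PB' : is_pullback (p ∘ m) f x q2).
  { apply pb_intro.
    - rw E1; exact (pb_comm PB).
    - intros T u v Eu Ev; apply (pullback_ext _ _ PB); [|exact Ev].
      rewrite <- E1; rw Eu; reflexivity.
    - intros T u v E0; cn_in E0; destruct (pb_lift (m ∘ u) v PB E0) as (h & H1 & H2).
      exists h; split; [|exact H2]; apply Hm; rw E1; exact H1. }
  apply (HP E B M A P P f (p ∘ m) y p s m x q2 q1 q2 (idm P)); cn; auto.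
  - rw E2; exact Hs.
  - apply iso_id.
Qed.

Lemma point_cover {A B X : C} {p : Hom A B} {s : Hom B A} {k : Hom X A} :
  p ∘ s = idm B -> is_kernel p k -> cover k s.
Proof.
  intros Hs K; destruct zero_obj_ex as [z Z].
  destruct (proj1 Z B) as [o _], (proj2 Z X) as [o' _].
  exact (point_pb_cover Hs (ker_pb o o' Z K)).
Qed.

(** Change of base along 0 -> B turns a point into its kernel. *)
Lemma split_five {A A' B X X' : C} {p : Hom A B} {s : Hom B A} {p' : Hom A' B}
  {s' : Hom B A'} {h : Hom A A'} {k : Hom X A} {k' : Hom X' A'} {u : Hom X X'} :
  p ∘ s = idm B -> p' ∘ s' = idm B -> p' ∘ h = p -> h ∘ s = s' ->
  is_kernel p k -> is_kernel p' k' -> h ∘ k = k' ∘ u -> iso u -> iso h.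
Proof.
  intros H1 H2 H3 H4 K K' E I; destruct zero_obj_ex as [z Z].
  destruct HS as (_ & _ & _ & _ & HP).
  destruct (proj1 Z B) as [o _], (proj2 Z X) as [t _], (proj2 Z X') as [t' _].
  apply (HP z B A A' X X' o p s p' s' h k t k' t' u); auto.
  - exact (ker_pb o t Z K).
  - exact (ker_pb o t' Z K').
  - apply terminal_eq, Z.
Qed.

(** The kernel of the first projection of the kernel pair vanishes, so the diagonal alone covers the
    kernel pair and the two projections agree. *)
Lemma zero_ker_mono {a b : C} {f : Hom a b} :
  (forall T (x : Hom T a), is_zero_mor (f ∘ x) -> is_zero_mor x) -> mono f.
Proof.
  intros H; destruct (pb_ex f f) as (R & r1 & r2 & PB).
  destruct (pb_lift (idm a) (idm a) PB eq_refl) as (d & D1 & D2).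
  destruct (ker_ex r1) as (x & k & K).
  assert (Zk : is_zero_mor k).
  { assert (is_zero_mor (r2 ∘ k)).
    { apply H; rw (eq_sym (pb_comm PB)); apply zero_mor_l, (ker_zero K). }
    destruct (zero_mor_ex x R) as [o O]; replace k with o; auto.
    apply (pullback_ext _ _ PB); apply zero_mor_eq; auto using zero_mor_l, ker_zero. }
  assert (E : r1 = r2).
  { apply (cover_epi r1 r2 (point_cover D1 K)).
    - apply zero_mor_eq; apply zero_mor_l; exact Zk.
    - congruence. }
  intros T u v Euv; destruct (pb_lift u v PB Euv) as (h & <- & <-); now rewrite E.
Qed.

Lemma regular_epi_pb {a b c P : C} {f : Hom a c} {g : Hom b c} {p : Hom P a} {q : Hom P b} :
  is_pullback f g p q -> regular_epi f -> regular_epi q.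
Proof. destruct HS as (_ & _ & _ & ((_ & _ & H) & _) & _); apply H. Qed.

Lemma image_regular {a b : C} (f : Hom a b) :
  exists I (q : Hom a I) (m : Hom I b), regular_epi q /\ mono m /\ m ∘ q = f.
Proof.
  destruct (pb_ex f f) as (R & r1 & r2 & PB).
  assert (exists Q (q : Hom a Q), is_coequalizer r1 r2 q) as (I & q & HQ).
  { destruct HS as (_ & _ & _ & ((_ & H & _) & _) & _); exact (H _ _ _ _ _ _ PB). }
  destruct (proj2 HQ b f (pb_comm PB)) as (m & M & _).
  assert (Q : regular_epi q) by (exists R, r1, r2; exact HQ).
  exists I, q, m; split; [exact Q|]; split; [|exact M].
  apply zero_ker_mono; intros T x Hx.
  destruct (pb_ex q x) as (P & y & e & PB').
  pose proof (regular_epi_sepi (regular_epi_pb PB' Q)) as Se.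
  (* An [x] killed by [m] lifts along the cover [e] to [y] with [f ∘ y] zero, so the kernel pair
     relates [y] to 0. *)
  assert (Z : is_zero_mor (x ∘ e)).
  { rewrite <- (pb_comm PB').
    destruct (zero_mor_ex P a) as [o O].
    destruct (pb_lift y o PB) as (w & <- & W).
    - rewrite <- M; rw (pb_comm PB').
      apply zero_mor_eq; [rewrite comp_assoc; now apply zero_mor_r | now apply zero_mor_l, zero_mor_l].
    - rw (proj1 HQ); rewrite W; now apply zero_mor_l. }
  destruct (zero_mor_ex T I) as [o O]; replace x with o; auto.
  apply (sepi_epi _ _ Se), zero_mor_eq; auto using zero_mor_r.
Qed.

Lemma sepi_regular {a b : C} {f : Hom a b} : sepi f -> regular_epi f.
Proof.
  intros H; destruct (image_regular f) as (I & q & m & (R & r1 & r2 & Q) & M & E).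
  destruct (H I m q M E) as (i & I1 & I2); exists R, r1, r2; rewrite <- E; split.
  - cn; now rw (proj1 Q).
  - intros T x Ex; destruct (proj2 Q T x Ex) as (h & Hh & U).
    exists (h ∘ i); split; [cn; now rw I1|].
    intros h' Hh'; rewrite <- (U (h' ∘ m)); cn; [now rw I2|now cn_in Hh'].
Qed.

Lemma image_ex {a b : C} (f : Hom a b) :
  exists I (q : Hom a I) (m : Hom I b), sepi q /\ mono m /\ m ∘ q = f.
Proof.
  destruct (image_regular f) as (I & q & m & Q & H); exists I, q, m.
  split; [exact (regular_epi_sepi Q) | exact H].
Qed.

Lemma sepi_pb {a b c P : C} {f : Hom a c} {g : Hom b c} {p : Hom P a} {q : Hom P b} :
  is_pullback f g p q -> sepi f -> sepi q.
Proof. intros PB H; exact (regular_epi_sepi (regular_epi_pb PB (sepi_regular H))). Qed.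

Lemma sepi_local {a b T : C} {f : Hom a b} (x : Hom T b) : sepi f ->
  exists S (e : Hom S T) (y : Hom S a), sepi e /\ f ∘ y = x ∘ e.
Proof.
  intros H; destruct (pb_ex f x) as (P & y & e & PB); exists P, e, y.
  split; [exact (sepi_pb PB H) | exact (pb_comm PB)].
Qed.

Lemma zero_mor_sepi {a b c : C} {q : Hom a b} {f : Hom b c} :
  sepi q -> is_zero_mor (f ∘ q) -> is_zero_mor f.
Proof.
  intros H Z; destruct (zero_mor_ex b c) as [o O]; replace f with o; auto.
  apply (sepi_epi _ _ H), zero_mor_eq; auto using zero_mor_r.
Qed.

Lemma sepi_desc_rel {a b T : C} {f : Hom a b} (g : Hom a T) : sepi f ->
  (forall S (x y : Hom S a), f ∘ x = f ∘ y -> g ∘ x = g ∘ y) ->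
  exists h, h ∘ f = g.
Proof.
  intros H E; destruct (sepi_regular H) as (R & r1 & r2 & Q).
  destruct (proj2 Q T g) as (h & Hh & _); [apply E, Q|]; now exists h.
Qed.

Lemma sepi_coeq {a b R : C} {f : Hom a b} {r1 r2 : Hom R a} :
  sepi f -> is_kernel_pair f r1 r2 -> is_coequalizer r1 r2 f.
Proof.
  intros H K; split; [exact (pb_comm K)|]; intros T g E.
  destruct (@sepi_desc_rel _ _ _ f g H) as (h & Hh).
  - intros S x y Exy; destruct (pb_lift x y K Exy) as (w & <- & <-); now rw E.
  - exists h; split; [exact Hh|]; intros h' Hh'; apply (sepi_epi _ _ H); congruence.
Qed.

(** A strong epimorphism is the cokernel of its kernel: the kernel pair is generated by the diagonal
    and the pairs (0, t) with t in the kernel. *)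
Lemma sepi_desc {a b x T : C} {f : Hom a b} {k : Hom x a} (g : Hom a T) :
  sepi f -> is_kernel f k -> is_zero_mor (g ∘ k) -> exists h, h ∘ f = g.
Proof.
  intros H K Z; apply (sepi_desc_rel _ H); intros S u v E.
  destruct (pb_ex f f) as (R & r1 & r2 & PB).
  destruct (pb_lift (idm a) (idm a) PB eq_refl) as (d & D1 & D2).
  destruct (pb_lift u v PB E) as (w & <- & <-); rewrite !comp_assoc; apply comp_r.
  destruct (ker_ex r1) as (y & l & L).
  apply (cover_epi _ _ (point_cover D1 L)); cn; [|now rewrite D1, D2].
  destruct (ker_lift (r2 ∘ l) K) as (t & Ht).
  { rw (eq_sym (pb_comm PB)); apply zero_mor_l, (ker_zero L). }
  apply zero_mor_eq; [apply zero_mor_l, (ker_zero L)|].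
  rewrite <- Ht, comp_assoc; now apply zero_mor_r.
Qed.

Lemma coker_ex {x a : C} {k : Hom x a} : normal_mono k ->
  exists Q (q : Hom a Q), sepi q /\ is_kernel q k.
Proof.
  intros (b & f & K); destruct (image_ex f) as (I & q & m & Q & M & E).
  exists I, q; split; [exact Q|]; rewrite <- E in K; exact (ker_of_comp_mono M K).
Qed.

(** A subobject that contains the kernel of [v] and maps onto S is everything. The points R x_S R
    and R x_S V over R have the same kernel, hence are isomorphic; so the projection of the latter
    to V, a pullback of [v ∘ m], factors through [m]. *)
Lemma mono_of_sepi_ext {R V S X : C} {m : Hom R V} {v : Hom V S} {k : Hom X V} {h : Hom X R} :
  mono m -> sepi (v ∘ m) -> is_kernel v k -> m ∘ h = k -> iso m.
Proof.
  intros Hm Hv K E; apply sepi_mono_iso; [|exact Hm].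
  destruct (pb_ex (v ∘ m) v) as (P & p & q & PB).
  pose proof (sepi_pb PB Hv) as Sq.
  destruct (pb_ex (v ∘ m) (v ∘ m)) as (P' & p' & q' & PB').
  destruct (pb_lift p' (m ∘ q') PB) as (w & W1 & W2); [now rw (pb_comm PB')|].
  destruct (pb_lift (idm R) (idm R) PB' eq_refl) as (d & D1 & D2).
  destruct (ker_ex p') as (Y' & l' & L'); destruct (ker_ex p) as (Y & l & L).
  destruct (ker_lift (w ∘ l') L) as (u & U).
  { rw W1; exact (ker_zero L'). }
  assert (Iw : iso w).
  { apply (@split_five P' P R Y' Y p' d p (w ∘ d) w l' l u); auto.
    - rw W1; exact D1.
    - destruct (ker_lift (q ∘ l) K) as (n & N).
      { rw (eq_sym (pb_comm PB)); rewrite comp_assoc; apply zero_mor_l, (ker_zero L). }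
      destruct (zero_mor_ex Y R) as [o O].
      destruct (pb_lift o (h ∘ n) PB') as (t & T1 & T2).
      { apply zero_mor_eq; [now apply zero_mor_l|]; cn; rw E; rewrite comp_assoc.
        apply zero_mor_r, (ker_zero K). }
      destruct (ker_lift t L') as (u' & U'); [now rewrite T1|].
      apply (mono_split_iso u').
      + apply (mono_cancel l); rewrite U; apply mono_comp; [|exact (ker_mono L')].
        intros T x y Exy; apply (pullback_ext _ _ PB').
        * rewrite <- W1; now rw Exy.
        * apply Hm; rewrite !comp_assoc, <- W2; now rw Exy.
      + apply (ker_mono L); cn; rw U, U'; apply (pullback_ext _ _ PB).
        * rw W1, T1; apply zero_mor_eq; [exact O | exact (ker_zero L)].
        * rw W2, T2, E, N; reflexivity. }
  destruct Iw as (i & I1 & I2).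
  assert (Eq : q = m ∘ (q' ∘ i)) by (rw (eq_sym W2), I2; reflexivity).
  rewrite Eq in Sq; exact (sepi_cancel Sq).
Qed.

(** * Reflexive relations and images of normal subobjects *)

Lemma mono_pair {a1 a2 P : C} (r1 : Hom P a1) (r2 : Hom P a2) :
  exists V (v1 : Hom V a1) (v2 : Hom V a2) (r : Hom P V),
    v1 ∘ r = r1 /\ v2 ∘ r = r2 /\
    (forall T (x y : Hom T V), v1 ∘ x = v1 ∘ y -> v2 ∘ x = v2 ∘ y -> x = y) /\
    (forall T (x : Hom T a1) (y : Hom T a2), exists h, v1 ∘ h = x /\ v2 ∘ h = y).
Proof.
  destruct (prod_ex a1 a2) as (V & v1 & v2 & J & U).
  destruct (U P r1 r2) as (r & A & B); exists V, v1, v2, r; auto.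
Qed.

Lemma cover_lift_pair {a1 a2 a b1 b2 M : C} {f1 : Hom a1 a} {f2 : Hom a2 a}
  {r1 : Hom M b1} {r2 : Hom M b2} (g1 : Hom a b1) (g2 : Hom a b2) (h1 : Hom a1 M)
  (h2 : Hom a2 M) :
  cover f1 f2 ->
  (forall T (x y : Hom T M), r1 ∘ x = r1 ∘ y -> r2 ∘ x = r2 ∘ y -> x = y) ->
  r1 ∘ h1 = g1 ∘ f1 -> r2 ∘ h1 = g2 ∘ f1 -> r1 ∘ h2 = g1 ∘ f2 -> r2 ∘ h2 = g2 ∘ f2 ->
  exists d, r1 ∘ d = g1 /\ r2 ∘ d = g2.
Proof.
  intros H J A1 A2 B1 B2.
  destruct (mono_pair r1 r2) as (V & v1 & v2 & r & R1 & R2 & JV & U).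
  destruct (U a g1 g2) as (g & G1 & G2).
  assert (Mr : mono r).
  { intros T x y E; apply J; [rewrite <- R1 | rewrite <- R2]; now rw E. }
  destruct (@cover_lift _ _ _ _ _ _ _ f1 f2 r g h1 h2 H Mr) as (d & D & _).
  - apply JV; [rw R1, G1 | rw R2, G2]; auto.
  - apply JV; [rw R1, G1 | rw R2, G2]; auto.
  - exists d; split; [rewrite <- R1, <- G1 | rewrite <- R2, <- G2]; now rw D.
Qed.

(** Protomodular categories are Mal'tsev: pairs of related pairs with a common first entry, and
    composable ones, are generated by the degenerate pairs, where the relation sought is given or is
    reflexivity. *)
Lemma reflexive_equivalence {a R : C} {r1 r2 : Hom R a} {s : Hom a R} :
  (forall T (x y : Hom T R), r1 ∘ x = r1 ∘ y -> r2 ∘ x = r2 ∘ y -> x = y) ->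
  r1 ∘ s = idm a -> r2 ∘ s = idm a -> equivalence_relation r1 r2.
Proof.
  intros J S1 S2; split; [exact J|]; split; [now exists s|]; split.
  - destruct (pb_ex r1 r1) as (P & p & q & PB).
    destruct (pb_lift (idm R) (idm R) PB eq_refl) as (d & D1 & D2).
    destruct (pb_lift (idm R) (s ∘ r1) PB) as (t & T1 & T2); [now rw S1|].
    assert (PB' : is_pullback q s t r1).
    { apply pb_intro; [exact T2| |].
      - intros T x y E _; apply (comp_l p) in E; revert E; rw T1, T1; auto.
      - intros T x y E; exists (p ∘ x); split.
        + apply (pullback_ext _ _ PB); [now rw T1|]; rw T2, (pb_comm PB), E, S1; reflexivity.
        + rw (pb_comm PB), E, S1; reflexivity. }
    (* [w] states that (x, y) and (x, z) in R give (z, y); for y = x this is symmetry. *)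
    destruct (cover_lift_pair (r1 := r1) (r2 := r2) (r2 ∘ q) (r2 ∘ p) (idm R) (s ∘ r2) (point_pb_cover D2 PB') J)
      as (w & W1 & W2); cn.
    + rw T2, S2; reflexivity.
    + rw T1; reflexivity.
    + rw S1, D2; reflexivity.
    + rw S2, D1; reflexivity.
    + destruct (pb_lift (s ∘ r1) (idm R) PB) as (v & V1 & V2); [now rw S1|].
      exists (w ∘ v); split; [rw W1, V2 | rw W2, V1, S2]; reflexivity.
  - intros P p q PB.
    destruct (pb_lift (s ∘ r1) (idm R) PB) as (d & D1 & D2); [now rw S2|].
    destruct (pb_lift (idm R) (s ∘ r2) PB) as (t & T1 & T2); [now rw S1|].
    assert (PB' : is_pullback q s t r2).
    { apply pb_intro; [exact T2| |].
      - intros T x y E _; apply (comp_l p) in E; revert E; rw T1, T1; auto.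
      - intros T x y E; exists (p ∘ x); split.
        + apply (pullback_ext _ _ PB); [now rw T1|]; rw T2, (pb_comm PB), E, S1; reflexivity.
        + rw (pb_comm PB), E, S1; reflexivity. }
    apply (cover_lift_pair (r1 := r1) (r2 := r2) (r1 ∘ p) (r2 ∘ q) (idm R) (idm R) (point_pb_cover D2 PB') J); cn.
    + rw T1; reflexivity.
    + rw T2, S2; reflexivity.
    + rw D1, S1; reflexivity.
    + rw D2; reflexivity.
Qed.

Lemma reflexive_effective {a R : C} {r1 r2 : Hom R a} {s : Hom a R} :
  (forall T (x y : Hom T R), r1 ∘ x = r1 ∘ y -> r2 ∘ x = r2 ∘ y -> x = y) ->
  r1 ∘ s = idm a -> r2 ∘ s = idm a ->
  exists b (f : Hom a b), sepi f /\ is_kernel_pair f r1 r2.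
Proof.
  intros J S1 S2; destruct HS as (_ & _ & _ & (_ & H) & _).
  destruct (H a R r1 r2 (reflexive_equivalence J S1 S2)) as (b & f & K).
  destruct (image_ex f) as (I & q & m & Q & M & E); exists I, q; split; [exact Q|].
  apply pb_intro.
  - apply M; rewrite !comp_assoc, E; exact (pb_comm K).
  - exact J.
  - intros T x y Exy; apply (pb_lift x y K); rewrite <- E; now rw Exy.
Qed.

(** [h] is a pullback of the comparison R -> A x_I S. The image of the comparison maps onto S and
    contains the kernel of the projection to S, which [s] lifts to R, so by [mono_of_sepi_ext] the
    comparison is a strong epimorphism. *)
Lemma sepi_points_kernels {R A S I X Y : C} {r : Hom R A} {s : Hom A R} {r' : Hom S I}
  {s' : Hom I S} {p : Hom R S} {q : Hom A I} {k : Hom X R} {k' : Hom Y S} {h : Hom X Y} :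
  r ∘ s = idm A -> r' ∘ s' = idm I -> r' ∘ p = q ∘ r -> p ∘ s = s' ∘ q ->
  sepi p -> sepi q -> is_kernel r k -> is_kernel r' k' -> k' ∘ h = p ∘ k -> sepi h.
Proof.
  intros E1 E2 E3 E4 P Q K K' Eh.
  destruct (pb_ex q r') as (V & va & vs & PB).
  destruct (pb_lift r p PB (eq_sym E3)) as (n & N1 & N2).
  destruct (image_ex n) as (J & e & m & He & Hm & Em).
  assert (Im : iso m).
  { destruct (ker_ex vs) as (H & i & Hi).
    apply (@mono_of_sepi_ext J V S H m vs i (e ∘ (s ∘ (va ∘ i)))); auto.
    - apply (@sepi_cancel _ _ _ _ _ e); rw Em; rewrite N2; exact P.
    - rw Em; apply (pullback_ext _ _ PB).
      + rw N1, E1; reflexivity.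
      + rw N2, E4, (pb_comm PB); apply zero_mor_eq; [|exact (ker_zero Hi)].
        apply zero_mor_l, zero_mor_l, (ker_zero Hi). }
  assert (Sn : sepi n).
  { rewrite <- Em; apply sepi_compose; [exact (iso_sepi Im) | exact He]. }
  destruct (zero_mor_ex Y A) as [o O].
  destruct (pb_lift o k' PB) as (w & W1 & W2).
  { apply zero_mor_eq; [now apply zero_mor_l | exact (ker_zero K')]. }
  apply (@sepi_pb _ _ _ _ n w k h); [|exact Sn].
  apply pb_intro.
  - apply (pullback_ext _ _ PB).
    + rw N1, W1; apply zero_mor_eq; [exact (ker_zero K) | now apply zero_mor_r].
    + rw N2, W2; auto.
  - intros T x y E _; exact (ker_mono K _ _ _ E).
  - intros T x y E; destruct (ker_lift x K) as (t & Ht).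
    { rewrite <- N1; rw E, W1; now apply zero_mor_r. }
    exists t; split; [exact Ht|]; apply (ker_mono K').
    rw Eh, Ht; rewrite <- N2; rw E, W2; reflexivity.
Qed.

(** The direct image S in I of the kernel pair R of [f] is a reflexive relation, hence effective. By
    [sepi_points_kernels] the kernel attached to S is the image of K, which is [q ∘ k] itself
    because this is mono. *)
Lemma normal_mono_image {K A I : C} {k : Hom K A} {q : Hom A I} :
  normal_mono k -> sepi q -> mono (q ∘ k) -> normal_mono (q ∘ k).
Proof.
  intros (Q & f & Kf) Sq Mk.
  destruct (pb_ex f f) as (R & r1 & r2 & PB).
  destruct (pb_lift (idm A) (idm A) PB eq_refl) as (s & D1 & D2).
  destruct (mono_pair (q ∘ r1) (q ∘ r2)) as (V & v1 & v2 & r & V1 & V2 & JV & UV).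
  destruct (image_ex r) as (S & e & m & He & Hm & Em).
  assert (JS : forall T (x y : Hom T S),
             (v1 ∘ m) ∘ x = (v1 ∘ m) ∘ y -> (v2 ∘ m) ∘ x = (v2 ∘ m) ∘ y -> x = y).
  { intros T x y X Y; apply Hm, JV; now cn_in X; cn_in Y; cn. }
  destruct (UV I (idm I) (idm I)) as (dg & G1 & G2).
  destruct (@sepi_lift _ _ _ _ _ _ q m dg (e ∘ s) Sq Hm) as (s' & S1 & S2).
  { apply JV; rw Em; [rw V1, D1, G1 | rw V2, D2, G2]; auto. }
  assert (F1 : (v1 ∘ m) ∘ s' = idm I) by (rw S1, G1; reflexivity).
  assert (F2 : (v2 ∘ m) ∘ s' = idm I) by (rw S1, G2; reflexivity).
  destruct (reflexive_effective JS F1 F2) as (D & g & _ & KP).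
  destruct (zero_mor_ex K A) as [o O].
  destruct (pb_lift k o PB) as (k1 & A1 & A2).
  { apply zero_mor_eq; [exact (ker_zero Kf) | now apply zero_mor_l]. }
  assert (Kk : is_kernel r2 k1).
  { apply ker_intro.
    - rewrite A2; exact O.
    - apply (mono_cancel r1); rewrite A1; exact (ker_mono Kf).
    - intros T x Zx; destruct (ker_lift (r1 ∘ x) Kf) as (h & Hh).
      { rw (pb_comm PB); now apply zero_mor_l. }
      exists h; apply (pullback_ext _ _ PB); [now rw A1|].
      rw A2; apply zero_mor_eq; [now apply zero_mor_r | exact Zx]. }
  destruct (ker_ex (v2 ∘ m)) as (Y & k' & K').
  destruct (ker_lift (e ∘ k1) K') as (h & Hh).
  { rw Em, V2, A2; now apply zero_mor_l. }
  assert (Sh : sepi h).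
  { apply (@sepi_points_kernels R A S I K Y r2 s (v2 ∘ m) s' e q k1 k' h); auto.
    rw Em; exact V2. }
  assert (Eh : v1 ∘ (m ∘ (k' ∘ h)) = q ∘ k).
  { rw Hh, Em, V1, A1; reflexivity. }
  assert (Ih : iso h).
  { apply sepi_mono_iso; [exact Sh|]; apply (mono_cancel (v1 ∘ (m ∘ k'))).
    cn; rewrite Eh; exact Mk. }
  destruct Ih as (i & I1 & I2).
  exists D, g; apply ker_intro; [|exact Mk|].
  - rewrite <- Eh; pose proof (pb_comm KP) as E; cn_in E; rw E.
    rewrite !comp_assoc; apply zero_mor_r; cn; apply zero_mor_l.
    pose proof (ker_zero K') as Z; now cn_in Z.
  - intros T x Zx; destruct (zero_mor_ex T I) as [o' O'].
    destruct (pb_lift x o' KP) as (w & W1 & W2).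
    { apply zero_mor_eq; [exact Zx | now apply zero_mor_l]. }
    destruct (ker_lift w K') as (w' & W'); [now rewrite W2|].
    exists (i ∘ w'); rewrite <- Eh; cn; rw I2, W'; now cn_in W1.
Qed.

End SemiAbelian.

(** * Division in reflexive graphs *)

Record rgraph (C : Category) := {
  r0 : C; r1 : C;
  rd : Hom r1 r0; rc : Hom r1 r0; re : Hom r0 r1;
  r_de : rd ∘ re = idm r0;
  r_ce : rc ∘ re = idm r0 }.
Arguments Build_rgraph {C r0 r1} rd rc re _ _.

Definition graph_of {C : Category} (G : IGrpd C) : rgraph C :=
  Build_rgraph (gd G) (gc G) (ge G) (g_de G) (g_ce G).

Definition gmor {C : Category} (A B : rgraph C) (h0 : Hom (r0 A) (r0 B))
  (h1 : Hom (r1 A) (r1 B)) : Prop :=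
  rd B ∘ h1 = h0 ∘ rd A /\ rc B ∘ h1 = h0 ∘ rc A /\ h1 ∘ re A = re B ∘ h0.

(* [dv] stands for (x, y) |-> x y^-1 on the pairs of arrows with the same domain.  Over a
   semi-abelian category, the reflexive graphs with a division are the internal groupoids. *)
Record division {C : Category} (A : rgraph C) {R : C} (p1 p2 dv : Hom R (r1 A)) : Prop := {
  div_pb : is_pullback (rd A) (rd A) p1 p2;
  div_unit : forall T (x : Hom T R), p2 ∘ x = re A ∘ (rd A ∘ (p1 ∘ x)) -> dv ∘ x = p1 ∘ x;
  div_self : forall T (x : Hom T R), p1 ∘ x = p2 ∘ x -> dv ∘ x = re A ∘ (rc A ∘ (p1 ∘ x)) }.

Definition divisible {C : Category} (A : rgraph C) : Prop :=
  exists R (p1 p2 dv : Hom R (r1 A)), division A p1 p2 dv.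

Section Division.
Context {C : Category} {HS : @semi_abelian C}.

(** Pulling the point ([p2], [s]) back along [re A] gives [r1 A], embedded by x |-> (x, 1). *)
Lemma cospan_cover (A : rgraph C) {R : C} {p1 p2 : Hom R (r1 A)} :
  is_pullback (rd A) (rd A) p1 p2 ->
  exists a s : Hom (r1 A) R,
    p1 ∘ a = idm _ /\ p2 ∘ a = re A ∘ rd A /\ p1 ∘ s = idm _ /\ p2 ∘ s = idm _ /\ cover a s.
Proof.
  intros PB; pose proof (r_de A) as E.
  destruct (pb_lift (idm (r1 A)) (re A ∘ rd A) PB) as (a & A1 & A2); [now rw E|].
  destruct (pb_lift (idm (r1 A)) (idm (r1 A)) PB eq_refl) as (s & S1 & S2).
  exists a, s; repeat (split; [assumption|]).
  apply (@point_pb_cover _ _ _ _ _ _ p2 s (re A) a (rd A) S2).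
  apply pb_intro; [exact A2| |].
  - intros T x y H _; apply (comp_l p1) in H; revert H; rw A1, A1; auto.
  - intros T x y H; exists (p1 ∘ x); split.
    + apply (pullback_ext _ _ PB); [now rw A1|]; rw A2, (pb_comm PB), H, E; reflexivity.
    + rw (pb_comm PB), H, E; reflexivity.
Qed.

(** The same pullback, for the point with section y |-> (1, y). *)
Lemma composable_cover (A : rgraph C) {P : C} {p1 p2 : Hom P (r1 A)} :
  is_pullback (rd A) (rc A) p1 p2 ->
  exists a s : Hom (r1 A) P,
    p1 ∘ a = idm _ /\ p2 ∘ a = re A ∘ rd A /\ p1 ∘ s = re A ∘ rc A /\ p2 ∘ s = idm _ /\
    cover a s.
Proof.
  intros PB; pose proof (r_de A) as E; pose proof (r_ce A) as E'.
  destruct (pb_lift (idm (r1 A)) (re A ∘ rd A) PB) as (a & A1 & A2); [now rw E'|].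
  destruct (pb_lift (re A ∘ rc A) (idm (r1 A)) PB) as (s & S1 & S2); [now rw E|].
  exists a, s; repeat (split; [assumption|]).
  apply (@point_pb_cover _ _ _ _ _ _ p2 s (re A) a (rd A) S2).
  apply pb_intro; [exact A2| |].
  - intros T x y H _; apply (comp_l p1) in H; revert H; rw A1, A1; auto.
  - intros T x y H; exists (p1 ∘ x); split.
    + apply (pullback_ext _ _ PB); [now rw A1|]; rw A2, (pb_comm PB), H, E'; reflexivity.
    + rw (pb_comm PB), H, E'; reflexivity.
Qed.

(** Every pair to which a law applies factors through [a] or through [s]. *)
Lemma division_intro (A : rgraph C) {R : C} {p1 p2 dv : Hom R (r1 A)} {a s : Hom (r1 A) R} :
  is_pullback (rd A) (rd A) p1 p2 ->
  p1 ∘ a = idm _ -> p2 ∘ a = re A ∘ rd A -> p1 ∘ s = idm _ -> p2 ∘ s = idm _ ->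
  dv ∘ a = idm _ -> dv ∘ s = re A ∘ rc A -> division A p1 p2 dv.
Proof.
  intros PB A1 A2 S1 S2 Da Ds; split; [exact PB| |]; intros T x Hx.
  - assert (x = a ∘ (p1 ∘ x)) as E.
    { apply (pullback_ext _ _ PB); [rw A1 | rw A2, Hx]; reflexivity. }
    pose proof (comp_l dv E) as K; revert K; rw Da; auto.
  - assert (x = s ∘ (p1 ∘ x)) as E.
    { apply (pullback_ext _ _ PB); [rw S1 | rw S2]; auto. }
    pose proof (comp_l dv E) as K; revert K; rw Ds; auto.
Qed.

Lemma division_cover {A : rgraph C} {R : C} {p1 p2 dv : Hom R (r1 A)} :
  division A p1 p2 dv ->
  exists a s : Hom (r1 A) R,
    p1 ∘ a = idm _ /\ p2 ∘ a = re A ∘ rd A /\ p1 ∘ s = idm _ /\ p2 ∘ s = idm _ /\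
    dv ∘ a = idm _ /\ dv ∘ s = re A ∘ rc A /\ cover a s.
Proof.
  intros D; destruct (cospan_cover A (div_pb D)) as (a & s & A1 & A2 & S1 & S2 & Cv).
  exists a, s; repeat (split; [assumption|]); split; [|split; [|exact Cv]].
  - rewrite (div_unit D), A1; [reflexivity|]; rewrite A2, A1; now cn.
  - rewrite (div_self D), S1; [now cn|congruence].
Qed.

Lemma div_dom {A : rgraph C} {R : C} {p1 p2 dv : Hom R (r1 A)} :
  division A p1 p2 dv -> rd A ∘ dv = rc A ∘ p2.
Proof.
  intros D; destruct (division_cover D) as (a & s & A1 & A2 & S1 & S2 & Da & Ds & Cv).
  apply (cover_epi _ _ Cv); cn.
  - rw Da, A2, (r_ce A); reflexivity.
  - rw Ds, S2, (r_de A); reflexivity.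
Qed.

Lemma div_cod {A : rgraph C} {R : C} {p1 p2 dv : Hom R (r1 A)} :
  division A p1 p2 dv -> rc A ∘ dv = rc A ∘ p1.
Proof.
  intros D; destruct (division_cover D) as (a & s & A1 & A2 & S1 & S2 & Da & Ds & Cv).
  apply (cover_epi _ _ Cv); cn.
  - rw Da, A1; reflexivity.
  - rw Ds, S1, (r_ce A); reflexivity.
Qed.

(** The relation z = x y^-1, so that identities can be chained without naming the lifts into R. *)
Definition divides {A : rgraph C} {R : C} (p1 p2 dv : Hom R (r1 A)) {T : C}
  (x y z : Hom T (r1 A)) : Prop :=
  exists r : Hom T R, p1 ∘ r = x /\ p2 ∘ r = y /\ dv ∘ r = z.

(** * The groupoid carried by a division *)

Section Groupoid.
Context (A : rgraph C) {R : C} {p1 p2 dv : Hom R (r1 A)} (D : division A p1 p2 dv).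

Let dvd {T} := @divides A R p1 p2 dv T.

Lemma dvd_total {T} (x y : Hom T (r1 A)) : rd A ∘ x = rd A ∘ y -> exists z, dvd x y z.
Proof.
  intros E; destruct (pb_lift x y (div_pb D) E) as (r & R1 & R2).
  exists (dv ∘ r), r; auto.
Qed.

Lemma dvd_fun {T} (x y z z' : Hom T (r1 A)) : dvd x y z -> dvd x y z' -> z = z'.
Proof.
  intros (r & <- & <- & <-) (r' & E1 & E2 & <-); apply comp_l, eq_sym.
  exact (pullback_ext _ _ (div_pb D) E1 E2).
Qed.

Lemma dvd_unit {T} (x : Hom T (r1 A)) : dvd x (re A ∘ (rd A ∘ x)) x.
Proof.
  destruct (pb_lift x (re A ∘ (rd A ∘ x)) (div_pb D)) as (r & R1 & R2).
  { now rw (r_de A). }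
  exists r; repeat (split; [assumption|]); rewrite (div_unit D), R1; auto.
  now rewrite R2, R1.
Qed.

Lemma dvd_self {T} (x : Hom T (r1 A)) : dvd x x (re A ∘ (rc A ∘ x)).
Proof.
  destruct (pb_lift x x (div_pb D) eq_refl) as (r & R1 & R2).
  exists r; repeat (split; [assumption|]); rewrite (div_self D), R1; [reflexivity|congruence].
Qed.

(** The identity (x z^-1)(y z^-1)^-1 = x y^-1, checked on generating triples; the groupoid axioms
    are derived from it. *)
Lemma dvd_cancel {T} (x y z u v w : Hom T (r1 A)) :
  dvd x z u -> dvd y z v -> dvd x y w -> dvd u v w.
Proof.
  pose proof (r_de A) as DE; pose proof (r_ce A) as CE.
  destruct (division_cover D) as (a & s & A1 & A2 & S1 & S2 & Da & Ds & Cv).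
  pose proof (div_pb D) as PB; pose proof (div_dom D) as Dd.
  (* R3 is the object of triples (x, y, z) with a common domain: [q] is (x, y) and [t] is (y, z). *)
  destruct (pb_ex p2 p1) as (R3 & q & t & PB3).
  destruct (pb_lift (p1 ∘ q) (p2 ∘ t) PB) as (xz & X1 & X2).
  { rw (pb_comm PB), (pb_comm PB3), (pb_comm PB); reflexivity. }
  destruct (pb_lift (dv ∘ xz) (dv ∘ t) PB) as (n & N1 & N2).
  { rw Dd, Dd, X2; reflexivity. }
  (* Triples are generated by (x, 1, 1) and (y, y, z), and the latter by (y, y, 1) and (y, y, y). *)
  assert (Main : dv ∘ n = dv ∘ q).
  { destruct (pb_lift (re A) (re A) PB eq_refl) as (ee & E1 & E2).
    destruct (pb_lift a (ee ∘ rd A) PB3) as (tau & T1 & T2).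
    { rw A2, E1; reflexivity. }
    destruct (pb_lift (s ∘ p1) (idm R) PB3) as (sg & G1 & G2).
    { rw S2; reflexivity. }
    assert (Cv3 : cover tau sg).
    { apply (@point_pb_cover _ _ _ _ _ _ t sg ee tau (rd A) G2).
      apply pb_intro; [exact T2| |].
      - intros T' g h H _; apply (comp_l (p1 ∘ q)) in H; revert H; cn; rw T1, A1, T1, A1; auto.
      - intros T' g h H.
        assert (Hd : rd A ∘ (p1 ∘ (q ∘ g)) = h).
        { rw (pb_comm PB), (pb_comm PB3), H, E1, DE; reflexivity. }
        exists (p1 ∘ (q ∘ g)); split; [|exact Hd].
        apply (pullback_ext _ _ PB3); [rw T1 | rw T2, Hd; auto].
        apply (pullback_ext _ _ PB); [rw A1; reflexivity|].
        rw A2, Hd, (pb_comm PB3), H, E1; reflexivity. }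
    assert (X : forall T' (g : Hom T' R3) f1 f2, p1 ∘ (q ∘ g) = f1 -> p2 ∘ (t ∘ g) = f2 ->
                  f2 = re A ∘ (rd A ∘ f1) -> dv ∘ (xz ∘ g) = f1).
    { intros T' g f1 f2 F1 F2 F3; rewrite (div_unit D).
      - rw X1; exact F1.
      - cn; rw X2, X1; congruence. }
    assert (X' : forall T' (g : Hom T' R3) f1, p1 ∘ (q ∘ g) = f1 -> p2 ∘ (t ∘ g) = f1 ->
                  dv ∘ (xz ∘ g) = re A ∘ (rc A ∘ f1)).
    { intros T' g f1 F1 F2; rewrite (div_self D).
      - cn; rw X1, F1; reflexivity.
      - cn; rw X2, X1; congruence. }
    apply (cover_epi _ _ Cv3); [|apply (cover_epi _ _ Cv)]; cn.
    - rw T1, Da; rewrite (div_unit D); cn; rw N1.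
      + apply (X _ tau _ (re A ∘ rd A)); [rw T1; exact A1 | rw T2, E2; reflexivity | now cn].
      + rw N2, T2.
        rewrite (X _ tau (idm _) (re A ∘ rd A)); [|rw T1; exact A1 | rw T2, E2; reflexivity | now cn].
        assert (De : dv ∘ (ee ∘ rd A) = re A ∘ rd A).
        { rewrite (div_self D); [cn; rw E1, CE; reflexivity | rw E1, E2; reflexivity]. }
        rw De; reflexivity.
    - assert (W : dv ∘ (xz ∘ (sg ∘ a)) = idm _).
      { apply (X _ (sg ∘ a) _ (re A ∘ rd A)); [rw G1, S1, A1; reflexivity | rw G2, A2; reflexivity | now cn]. }
      rw G1, A1, Ds; rewrite (div_self D); cn; rw N1, W; [reflexivity|].
      rw N2, G2, Da; reflexivity.
    - assert (W : dv ∘ (xz ∘ (sg ∘ s)) = re A ∘ rc A).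
      { rewrite (X' _ (sg ∘ s) (idm _)); [now cn | rw G1, S1, S1; reflexivity | rw G2, S2; reflexivity]. }
      rw G1, S1, Ds; rewrite (div_self D); cn; rw N1, W; [rw CE; reflexivity|].
      rw N2, G2, Ds; reflexivity. }
  intros (rxz & B1 & B2 & <-) (ryz & B3 & B4 & <-) (rxy & B5 & B6 & <-).
  destruct (pb_lift rxy ryz PB3) as (g & G1 & G2); [congruence|].
  assert (Exz : xz ∘ g = rxz).
  { apply (pullback_ext _ _ PB); [rw X1, G1 | rw X2, G2]; congruence. }
  exists (n ∘ g); split; [|split].
  - rw N1, Exz; reflexivity.
  - rw N2, G2; reflexivity.
  - rw Main, G1; reflexivity.
Qed.

Lemma dvd_dom {T} (x y z : Hom T (r1 A)) : dvd x y z -> rd A ∘ z = rc A ∘ y.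
Proof. intros (r & _ & <- & <-); rw (div_dom D); reflexivity. Qed.

(** The inverse of y is 1 divided by y, and x y is x divided by the inverse of y. The underlying
    graph is recovered up to equality, so that a divisible graph can be replaced by a groupoid
    through substitution. *)
Lemma division_groupoid : exists G : IGrpd C, graph_of G = A.
Proof.
  pose proof (r_de A) as DE; pose proof (r_ce A) as CE.
  destruct (pb_ex (rd A) (rc A)) as (P & g1 & g2 & PP).
  destruct (pb_lift (re A ∘ rd A) (idm _) (div_pb D)) as (io & I1 & I2); [now rw DE|].
  pose (i := dv ∘ io).
  assert (Hi : forall T (y : Hom T (r1 A)), dvd (re A ∘ (rd A ∘ y)) y (i ∘ y)).
  { intros T y; exists (io ∘ y); split; [rw I1|split; [rw I2|unfold i]]; now cn. }
  assert (Di : rd A ∘ i = rc A).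
  { unfold i; rw (div_dom D), I2; reflexivity. }
  assert (Ci : rc A ∘ i = rd A).
  { unfold i; rw (div_cod D), I1, CE; reflexivity. }
  destruct (pb_lift g1 (i ∘ g2) (div_pb D)) as (mu & M1 & M2).
  { rw Di; exact (pb_comm PP). }
  pose (m := dv ∘ mu).
  assert (Hm : forall T (x : Hom T P), dvd (g1 ∘ x) (i ∘ (g2 ∘ x)) (m ∘ x)).
  { intros T x; exists (mu ∘ x); split; [rw M1|split; [rw M2|unfold m]]; now cn. }
  (* (y w^-1)^-1 = w y^-1, from [dvd_cancel] with w w^-1 = 1 as numerator. *)
  assert (Swap : forall T (y w z z' : Hom T (r1 A)), dvd y w z -> dvd w y z' -> i ∘ z = z').
  { intros T y w z z' H H'.
    pose proof (dvd_cancel (dvd_self w) H H') as K; pose proof (Hi T z) as K'.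
    rewrite (dvd_dom H) in K'; exact (dvd_fun K' K). }
  assert (Invol : forall T (y : Hom T (r1 A)), i ∘ (i ∘ y) = y).
  { intros T y; exact (Swap _ _ _ _ _ (Hi T y) (dvd_unit y)). }
  assert (Gcm : rc A ∘ m = rc A ∘ g1) by (unfold m; rw (div_cod D), M1; reflexivity).
  assert (Gdm : rd A ∘ m = rd A ∘ g2).
  { unfold m; rw (div_dom D), M2, Ci; reflexivity. }
  assert (Ul : forall T (f : Hom T (r1 A)) (x : Hom T P),
             g1 ∘ x = re A ∘ (rc A ∘ f) -> g2 ∘ x = f -> m ∘ x = f).
  { intros T f x E1 E2; pose proof (Hm T x) as K; rewrite E1, E2 in K.
    exact (dvd_fun K (dvd_cancel (dvd_self f) (Hi T f) (dvd_unit f))). }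
  assert (Ur : forall T (f : Hom T (r1 A)) (x : Hom T P),
             g1 ∘ x = f -> g2 ∘ x = re A ∘ (rd A ∘ f) -> m ∘ x = f).
  { intros T f x E1 E2; pose proof (Hm T x) as K; rewrite E1, E2 in K.
    assert (Ei : i ∘ (re A ∘ (rd A ∘ f)) = re A ∘ (rd A ∘ f)).
    { pose proof (dvd_self (re A ∘ (rd A ∘ f))) as H; apply (Swap _ _ _ _ _ H) in H.
      revert H; rw CE; auto. }
    rewrite Ei in K; exact (dvd_fun K (dvd_unit f)). }
  assert (As : forall T (x y x' y' : Hom T P), g2 ∘ x = g1 ∘ y ->
      g1 ∘ x' = m ∘ x -> g2 ∘ x' = g2 ∘ y -> g1 ∘ y' = g1 ∘ x -> g2 ∘ y' = m ∘ y ->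
      m ∘ x' = m ∘ y').
  { intros T x y x' y' E1 E2 E3 E4 E5.
    pose proof (Hm T x) as Kx; pose proof (Hm T y) as Ky.
    pose proof (Hm T x') as Kx'; pose proof (Hm T y') as Ky'.
    rewrite E2, E3 in Kx'; rewrite E4, E5 in Ky'; rewrite E1 in Kx.
    (* For [x] = (f, g) and [y] = (g, h) the element [z] is h^-1 g^-1 = (g h)^-1; both composites
       equal f z^-1, by cancelling g^-1. *)
    assert (Ed : rd A ∘ (i ∘ (g2 ∘ y)) = rd A ∘ (g1 ∘ y)).
    { rw Di, (pb_comm PP); reflexivity. }
    destruct (dvd_total _ _ Ed) as (z & Hz).
    rewrite (Swap _ _ _ _ _ Ky Hz) in Ky'.
    assert (Kz : dvd z (i ∘ (g1 ∘ y)) (i ∘ (g2 ∘ y))).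
    { apply (dvd_cancel Hz (Hi T (g1 ∘ y))); rewrite <- Ed; apply dvd_unit. }
    exact (dvd_fun Kx' (dvd_cancel Kx Kz Ky')). }
  assert (Il : forall T (f : Hom T (r1 A)) (x : Hom T P),
             g1 ∘ x = i ∘ f -> g2 ∘ x = f -> m ∘ x = re A ∘ (rd A ∘ f)).
  { intros T f x E1 E2; pose proof (Hm T x) as K; rewrite E1, E2 in K.
    rewrite (dvd_fun K (dvd_self _)); now rw Ci. }
  assert (Ir : forall T (f : Hom T (r1 A)) (x : Hom T P),
             g1 ∘ x = f -> g2 ∘ x = i ∘ f -> m ∘ x = re A ∘ (rc A ∘ f)).
  { intros T f x E1 E2; pose proof (Hm T x) as K; rewrite E1, E2, Invol in K.
    exact (dvd_fun K (dvd_self _)). }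
  exists (Build_IGrpd (re A) i m PP (r_de A) (r_ce A) Gdm Gcm Ul Ur As Di Ci Il Ir).
  destruct A; reflexivity.
Qed.

End Groupoid.

(** * Groupoids as divisible graphs; stability of divisibility *)

Lemma divisible_groupoid (A : rgraph C) : divisible A -> exists G : IGrpd C, graph_of G = A.
Proof. intros (R & p1 & p2 & dv & D); exact (division_groupoid D). Qed.

Lemma inv_identity (G : IGrpd C) : gi G ∘ ge G = ge G.
Proof.
  destruct (pb_lift (ge G) (gi G ∘ ge G) (gpb G)) as (x & X1 & X2).
  { rw (g_ci G); reflexivity. }
  pose proof (@g_inv_r C G _ (ge G) x X1 X2) as K; rewrite (g_ce G) in K; cn_in K.
  transitivity (gm G ∘ x); [symmetry; apply g_unit_l; [|exact X2] | exact K].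
  rw (g_ci G), (g_de G); exact X1.
Qed.

Lemma groupoid_division (G : IGrpd C) {R : C} {p1 p2 : Hom R (g1 G)} :
  is_pullback (gd G) (gd G) p1 p2 ->
  exists dv, division (graph_of G) p1 p2 dv.
Proof.
  intros PB; destruct (pb_lift p1 (gi G ∘ p2) (gpb G)) as (n & N1 & N2).
  { rw (g_ci G); exact (pb_comm PB). }
  exists (gm G ∘ n); split; [exact PB| |]; intros T x Hx; cn; simpl in *.
  - apply g_unit_r; [now rw N1|].
    rw N2, Hx, (inv_identity G); reflexivity.
  - apply g_inv_r; [now rw N1|]; rw N2; now rewrite Hx.
Qed.

Lemma groupoid_divisible (G : IGrpd C) : divisible (graph_of G).
Proof.
  destruct (pb_ex (gd G) (gd G)) as (R & p1 & p2 & PB).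
  destruct (groupoid_division G PB) as (dv & D); now exists R, p1, p2, dv.
Qed.

(** Preservation of composition is tested on the pairs (x, 1) and (1, y), where it is a unit law. *)
Lemma functor_ex (G H : IGrpd C) (h0 : Hom (g0 G) (g0 H)) (h1 : Hom (g1 G) (g1 H)) :
  gmor (graph_of G) (graph_of H) h0 h1 ->
  exists F : @Hom (Grpd C) G H, f0 F = h0 /\ f1 F = h1.
Proof.
  intros (Hd & Hc & He); simpl in *.
  assert (Hm : forall h : Hom (gP G) (gP H),
      gp1 H ∘ h = h1 ∘ gp1 G -> gp2 H ∘ h = h1 ∘ gp2 G -> h1 ∘ gm G = gm H ∘ h).
  { intros h E1 E2.
    destruct (composable_cover (graph_of G) (gpb G)) as (a & s & A1 & A2 & S1 & S2 & Cv).
    simpl in *; apply (cover_epi _ _ Cv); cn.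
    - rewrite (@g_unit_r C G _ (idm _) a A1) by (now rewrite A2; cn).
      cn; symmetry; apply g_unit_r; [rw E1, A1 | rw E2, A2, He, Hd]; reflexivity.
    - rewrite (@g_unit_l C G _ (idm _) s) by (now rewrite ?S1, ?S2; cn).
      cn; symmetry; apply g_unit_l; [rw E1, S1, He, Hc | rw E2, S2]; reflexivity. }
  now exists {| f0 := h0; f1 := h1; f_d := Hd; f_c := Hc; f_e := He; f_m := Hm |}.
Qed.

Lemma functor_gmor (G H : IGrpd C) (F : @Hom (Grpd C) G H) :
  gmor (graph_of G) (graph_of H) (f0 F) (f1 F).
Proof. split; [apply F|split; apply F]. Qed.

Lemma gmor_comp {A B E : rgraph C} {h0 h1} {k0 k1} :
  gmor A B h0 h1 -> gmor B E k0 k1 -> gmor A E (k0 ∘ h0) (k1 ∘ h1).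
Proof.
  intros (X1 & X2 & X3) (Y1 & Y2 & Y3); split; [|split]; cn.
  - rw Y1, X1; reflexivity.
  - rw Y2, X2; reflexivity.
  - rw X3, Y3; reflexivity.
Qed.

Lemma gmor_division {A B : rgraph C} {h0 h1} {R S : C} {p1 p2 dv : Hom R (r1 A)}
  {q1 q2 dv' : Hom S (r1 B)} {h : Hom R S} :
  gmor A B h0 h1 -> division A p1 p2 dv -> division B q1 q2 dv' ->
  q1 ∘ h = h1 ∘ p1 -> q2 ∘ h = h1 ∘ p2 -> dv' ∘ h = h1 ∘ dv.
Proof.
  intros (Hd & Hc & He) D D' E1 E2.
  destruct (division_cover D) as (a & s & A1 & A2 & S1 & S2 & Da & Ds & Cv).
  apply (cover_epi _ _ Cv); cn.
  - rw Da; rewrite (div_unit D'); cn; rw E1, A1; [reflexivity|].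
    rw E2, A2, He, Hd; reflexivity.
  - rw Ds; rewrite (div_self D'); cn; rw E1, S1; [rw Hc, He; reflexivity|].
    rw E2, S2; reflexivity.
Qed.

Lemma gmor_pair {A B : rgraph C} {h0 h1} {R S : C} {p1 p2 : Hom R (r1 A)}
  {q1 q2 : Hom S (r1 B)} :
  gmor A B h0 h1 -> is_pullback (rd A) (rd A) p1 p2 -> is_pullback (rd B) (rd B) q1 q2 ->
  exists h : Hom R S, q1 ∘ h = h1 ∘ p1 /\ q2 ∘ h = h1 ∘ p2.
Proof.
  intros (Hd & _) PB PB'; apply (pb_lift _ _ PB').
  rw Hd, (pb_comm PB), Hd; reflexivity.
Qed.

(** On generators the divisions of B and B' take the values x and 1, which come from A; by joint
    monicity they factor through A everywhere. Pullbacks and subobjects are instances. *)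
Lemma divisible_jointly_monic {A B B' : rgraph C} {h0 h1} {k0 k1} :
  gmor A B h0 h1 -> gmor A B' k0 k1 -> divisible B -> divisible B' ->
  (forall T (x y : Hom T (r1 A)), h1 ∘ x = h1 ∘ y -> k1 ∘ x = k1 ∘ y -> x = y) ->
  divisible A.
Proof.
  intros Hh Hk (S & q1 & q2 & dv & D) (S' & q1' & q2' & dv' & D') J.
  destruct (pb_ex (rd A) (rd A)) as (R & p1 & p2 & PB).
  destruct (gmor_pair Hh PB (div_pb D)) as (h & H1 & H2).
  destruct (gmor_pair Hk PB (div_pb D')) as (k & K1 & K2).
  destruct (cospan_cover A PB) as (a & s & A1 & A2 & S1 & S2 & Cv).
  destruct Hh as (Hd & Hc & He), Hk as (Kd & Kc & Ke).
  assert (Xa : h1 ∘ idm _ = dv ∘ h ∘ a).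
  { cn; rewrite (div_unit D); cn; rw H1, A1; [reflexivity|]; rw H2, A2, He, Hd; reflexivity. }
  assert (Ya : k1 ∘ idm _ = dv' ∘ k ∘ a).
  { cn; rewrite (div_unit D'); cn; rw K1, A1; [reflexivity|]; rw K2, A2, Ke, Kd; reflexivity. }
  assert (Xs : h1 ∘ (re A ∘ rc A) = dv ∘ h ∘ s).
  { cn; rewrite (div_self D); cn; rw H1, S1; [rw Hc, He; reflexivity|]; rw H2, S2; reflexivity. }
  assert (Ys : k1 ∘ (re A ∘ rc A) = dv' ∘ k ∘ s).
  { cn; rewrite (div_self D'); cn; rw K1, S1; [rw Kc, Ke; reflexivity|]; rw K2, S2; reflexivity. }
  destruct (cover_lift_pair (r1 := h1) (r2 := k1) (dv ∘ h) (dv' ∘ k) _ _ Cv J Xa Ya Xs Ys)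
    as (d & D1 & D2).
  exists R, p1, p2, d; apply (@division_intro A R p1 p2 d a s); auto; apply J; rewrite comp_assoc.
  - now rewrite D1, Xa.
  - now rewrite D2, Ya.
  - now rewrite D1, Xs.
  - now rewrite D2, Ys.
Qed.

Lemma divisible_mono {A B : rgraph C} {h0 h1} :
  gmor A B h0 h1 -> divisible B -> mono h1 -> divisible A.
Proof.
  intros H D M; apply (divisible_jointly_monic H H D D); intros T x y E _; exact (M _ _ _ E).
Qed.

(** The map [phi] has the values on generators that a division followed by [h1] would have; this
    covers both quotients of divisible graphs and the pushout in the groupoid reflection. It
    descends along the map [h] of pair objects, a strong epimorphism because the generators of S
    lift. *)
Lemma divisible_quotient_by {A B : rgraph C} {h0 h1} {R : C} {p1 p2 : Hom R (r1 A)}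
  {a s : Hom (r1 A) R} {phi : Hom R (r1 B)} :
  gmor A B h0 h1 -> sepi h1 -> is_pullback (rd A) (rd A) p1 p2 ->
  p1 ∘ a = idm _ -> p2 ∘ a = re A ∘ rd A -> p1 ∘ s = idm _ -> p2 ∘ s = idm _ ->
  phi ∘ a = h1 -> phi ∘ s = h1 ∘ (re A ∘ rc A) -> divisible B.
Proof.
  intros Hh Sh PB A1 A2 S1 S2 Pa Ps.
  destruct (pb_ex (rd B) (rd B)) as (S & q1 & q2 & PB').
  destruct (gmor_pair Hh PB PB') as (h & H1 & H2).
  destruct (cospan_cover B PB') as (a' & s' & A1' & A2' & S1' & S2' & Cv').
  destruct Hh as (Hd & Hc & He).
  assert (Ea : h ∘ a = a' ∘ h1).
  { apply (pullback_ext _ _ PB').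
    - rw H1, A1, A1'; reflexivity.
    - rw H2, A2, A2', He, Hd; reflexivity. }
  assert (Es : h ∘ s = s' ∘ h1).
  { apply (pullback_ext _ _ PB'); [rw H1, S1, S1' | rw H2, S2, S2']; reflexivity. }
  assert (Shh : sepi h).
  { intros M m g Hm Eg; apply (cover_sepi Sh Sh Cv') with (h1 := g ∘ a) (h2 := g ∘ s);
      auto; rw Eg; [exact Ea | exact Es]. }
  (* What [h] identifies is a pair in the kernel pair of ([h0], [h1]), itself a reflexive graph, so
     it suffices to compare on the generators of its pairs. *)
  assert (Desc : forall T (x y : Hom T R), h ∘ x = h ∘ y -> phi ∘ x = phi ∘ y).
  { destruct (pb_ex h0 h0) as (K0 & u0 & v0 & P0).
    destruct (pb_ex h1 h1) as (K1 & u1 & v1 & P1).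
    destruct (pb_lift (rd A ∘ u1) (rd A ∘ v1) P0) as (kd & Kd1 & Kd2).
    { rw (eq_sym Hd), (pb_comm P1), Hd; reflexivity. }
    destruct (pb_lift (rc A ∘ u1) (rc A ∘ v1) P0) as (kc & Kc1 & Kc2).
    { rw (eq_sym Hc), (pb_comm P1), Hc; reflexivity. }
    destruct (pb_lift (re A ∘ u0) (re A ∘ v0) P1) as (ke & Ke1 & Ke2).
    { rw He, (pb_comm P0), He; reflexivity. }
    assert (Kde : kd ∘ ke = idm _).
    { apply (pullback_ext _ _ P0); [rw Kd1, Ke1, (r_de A) | rw Kd2, Ke2, (r_de A)]; reflexivity. }
    assert (Kce : kc ∘ ke = idm _).
    { apply (pullback_ext _ _ P0); [rw Kc1, Ke1, (r_ce A) | rw Kc2, Ke2, (r_ce A)]; reflexivity. }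
    pose (K := Build_rgraph kd kc ke Kde Kce).
    destruct (pb_ex kd kd) as (Q & w1 & w2 & PQ).
    destruct (cospan_cover K PQ) as (b & t & B1 & B2 & T1 & T2 & CvK); simpl in *.
    destruct (pb_lift (u1 ∘ w1) (u1 ∘ w2) PB) as (U & U1 & U2).
    { rw (eq_sym Kd1), (pb_comm PQ), Kd1; reflexivity. }
    destruct (pb_lift (v1 ∘ w1) (v1 ∘ w2) PB) as (V & V1 & V2).
    { rw (eq_sym Kd2), (pb_comm PQ), Kd2; reflexivity. }
    assert (UV : phi ∘ U = phi ∘ V).
    { apply (cover_epi _ _ CvK); cn.
      - assert (U ∘ b = a ∘ u1) as ->.
        { apply (pullback_ext _ _ PB); [rw U1, B1, A1 | rw U2, B2, A2, Ke1, Kd1]; reflexivity. }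
        assert (V ∘ b = a ∘ v1) as ->.
        { apply (pullback_ext _ _ PB); [rw V1, B1, A1 | rw V2, B2, A2, Ke2, Kd2]; reflexivity. }
        rw Pa, Pa; exact (pb_comm P1).
      - assert (U ∘ t = s ∘ u1) as ->.
        { apply (pullback_ext _ _ PB); [rw U1, T1, S1 | rw U2, T2, S2]; reflexivity. }
        assert (V ∘ t = s ∘ v1) as ->.
        { apply (pullback_ext _ _ PB); [rw V1, T1, S1 | rw V2, T2, S2]; reflexivity. }
        rw Ps, Ps; rw He, He, (eq_sym Hc), (eq_sym Hc), (pb_comm P1); reflexivity. }
    intros T x y E.
    destruct (pb_lift (p1 ∘ x) (p1 ∘ y) P1) as (g & G1 & G2).
    { rw (eq_sym H1), E, H1; reflexivity. }
    destruct (pb_lift (p2 ∘ x) (p2 ∘ y) P1) as (g' & G1' & G2').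
    { rw (eq_sym H2), E, H2; reflexivity. }
    destruct (pb_lift g g' PQ) as (w & W1 & W2).
    { apply (pullback_ext _ _ P0).
      - rw Kd1, G1, Kd1, G1', (pb_comm PB); reflexivity.
      - rw Kd2, G2, Kd2, G2', (pb_comm PB); reflexivity. }
    assert (x = U ∘ w) as ->.
    { apply (pullback_ext _ _ PB); [rw U1, W1 | rw U2, W2]; auto. }
    assert (y = V ∘ w) as ->.
    { apply (pullback_ext _ _ PB); [rw V1, W1 | rw V2, W2]; auto. }
    rw UV; reflexivity. }
  destruct (sepi_desc_rel phi Shh Desc) as (dv & Dv).
  exists S, q1, q2, dv; apply (@division_intro B S q1 q2 dv a' s'); auto.
  - apply (sepi_epi _ _ Sh); cn; rw (eq_sym Ea), Dv; exact Pa.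
  - apply (sepi_epi _ _ Sh); cn; rw (eq_sym Es), Dv, Ps, He, Hc; reflexivity.
Qed.

Lemma divisible_quotient {A B : rgraph C} {h0 h1} :
  gmor A B h0 h1 -> sepi h1 -> divisible A -> divisible B.
Proof.
  intros H Sh (R & p1 & p2 & dv & D).
  destruct (division_cover D) as (a & s & A1 & A2 & S1 & S2 & Da & Ds & _).
  apply (divisible_quotient_by H Sh (div_pb D) A1 A2 S1 S2 (phi := h1 ∘ dv)); cn.
  - rw Da; reflexivity.
  - rw Ds; reflexivity.
Qed.

(* The groupoid reflection freely adjoins a division: [r1 B] is the pushout of
   [a, s] : r1 A + r1 A -> R along [id, e c] : r1 A + r1 A -> r1 A. *)
Lemma groupoid_reflection (A : rgraph C) :
  exists (B : rgraph C) (q0 : Hom (r0 A) (r0 B)) (q1 : Hom (r1 A) (r1 B)),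
    divisible B /\ gmor A B q0 q1 /\
    (forall (H : rgraph C) h0 h1, divisible H -> gmor A H h0 h1 ->
       exists k0 k1, gmor B H k0 k1 /\ k0 ∘ q0 = h0 /\ k1 ∘ q1 = h1) /\
    (forall T (x y : Hom (r0 B) T), x ∘ q0 = y ∘ q0 -> x = y) /\
    (forall T (x y : Hom (r1 B) T), x ∘ q1 = y ∘ q1 -> x = y).
Proof.
  pose proof (r_de A) as DE; pose proof (r_ce A) as CE.
  destruct (pb_ex (rd A) (rd A)) as (R & p1 & p2 & PB).
  destruct (cospan_cover A PB) as (a & s & A1 & A2 & S1 & S2 & Cv).
  destruct (coprod_ex (r1 A) (r1 A)) as (P & i & j & Cij & Uij).
  destruct (Uij _ a s) as (f & F1 & F2).
  destruct (Uij _ (idm _) (re A ∘ rc A)) as (g & G1 & G2).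
  assert (Sf : sepi f).
  { intros M m h Hm E; apply (Cv M m (h ∘ i) (h ∘ j) Hm); rw E; assumption. }
  assert (exists Q (q : Hom (r1 A) Q) (phi : Hom R Q), is_pushout f g phi q)
    as (Q & q & phi & Epq & Upq).
  { destruct HS as (_ & _ & (_ & H) & _); destruct (H _ _ _ f g) as (Q & phi & q & PO).
    now exists Q, q, phi. }
  assert (Pa : phi ∘ a = q).
  { rewrite <- F1; rw Epq, G1; reflexivity. }
  assert (Ps : phi ∘ s = q ∘ (re A ∘ rc A)).
  { rewrite <- F2; rw Epq, G2; reflexivity. }
  assert (Factor : forall T (x : Hom R T) (y : Hom (r1 A) T),
             x ∘ a = y -> x ∘ s = y ∘ (re A ∘ rc A) -> exists w, w ∘ phi = x /\ w ∘ q = y).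
  { intros T x y X Y; destruct (Upq T x y) as (w & W & _); [|now exists w].
    apply (cover_epi _ _ Cij); cn; [rw F1, G1 | rw F2, G2]; auto. }
  assert (Sq : sepi q).
  { intros M m h Hm E.
    destruct (@sepi_lift _ _ _ _ _ _ f m phi (h ∘ g) Sf Hm) as (d & D & Df).
    { rw E; auto. }
    destruct (Upq M d h Df) as (w & [W1 W2] & _).
    apply (mono_split_iso w Hm).
    destruct (Upq Q phi q Epq) as (v & _ & V).
    rewrite (V (m ∘ w)), (V (idm Q)); cn; auto; [rw W1; auto | rw W2; auto]. }
  (* The quotient x y^-1 must have domain c y and codomain c x, which dictates [bd] and [bc] on
     R. *)
  destruct (Factor (r0 A) (rc A ∘ p2) (rd A)) as (bd & Bd1 & Bd2).
  { rw A2, CE; reflexivity. }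
  { rw S2, DE; reflexivity. }
  destruct (Factor (r0 A) (rc A ∘ p1) (rc A)) as (bc & Bc1 & Bc2).
  { rw A1; reflexivity. }
  { rw S1, CE; reflexivity. }
  assert (Bde : bd ∘ (q ∘ re A) = idm _) by (rw Bd2; exact DE).
  assert (Bce : bc ∘ (q ∘ re A) = idm _) by (rw Bc2; exact CE).
  pose (B := Build_rgraph bd bc (q ∘ re A) Bde Bce).
  assert (Hq : gmor A B (idm _) q).
  { split; [|split]; simpl; cn; auto. }
  exists B, (idm _), q; split; [|split; [exact Hq|split; [|split]]].
  - exact (divisible_quotient_by Hq Sq PB A1 A2 S1 S2 Pa Ps).
  - intros H h0 h1 (S & t1 & t2 & dv & D) Hh.
    destruct (gmor_pair Hh PB (div_pb D)) as (h & H1 & H2); destruct Hh as (Hd & Hc & He).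
    destruct (Factor _ (dv ∘ h) h1) as (w & W1 & W2).
    { cn; rewrite (div_unit D); cn; rw H1, A1; [reflexivity|]; rw H2, A2, He, Hd; reflexivity. }
    { cn; rewrite (div_self D); cn; rw H1, S1; [rw He, Hc; reflexivity|]; rw H2, S2; reflexivity. }
    exists h0, w; split; [|now cn]; split; [|split]; simpl.
    + apply (sepi_epi _ _ Sq); cn; rw W2, Bd2; exact Hd.
    + apply (sepi_epi _ _ Sq); cn; rw W2, Bc2; exact Hc.
    + rw W2; exact He.
  - intros T x y E; now cn_in E.
  - intros T x y E; exact (sepi_epi _ _ Sq E).
Qed.

End Division.

(** * The category of groupoids is semi-abelian *)

Section GroupoidLevels.
Context {C : Category} {HS : @semi_abelian C}.

Lemma lv0 {A B : Grpd C} {F F' : Hom A B} : F = F' -> f0 F = f0 F'.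
Proof. now intros ->. Qed.

Lemma lv1 {A B : Grpd C} {F F' : Hom A B} : F = F' -> f1 F = f1 F'.
Proof. now intros ->. Qed.

Lemma grpd_eq {A B : Grpd C} {F F' : Hom A B} : f0 F = f0 F' -> f1 F = f1 F' -> F = F'.
Proof. exact (IFun_eq F F'). Qed.

(** Transfers a graph together with its structure maps, described by [Q], to a groupoid; the
    equation between graphs is eliminated here, where substitution is possible. *)
Lemma groupoid_of_divisible (Q : rgraph C -> Prop) :
  (exists K, divisible K /\ Q K) -> exists G : Grpd C, Q (graph_of G).
Proof.
  intros (K & D & H); destruct (divisible_groupoid D) as (G & <-); now exists G.
Qed.

Lemma grpd_zero : exists Z : Grpd C,
  is_zero_obj Z /\ is_zero_obj (g0 Z) /\ is_zero_obj (g1 Z).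
Proof.
  destruct (zero_obj_ex (C := C)) as [z Hz].
  assert (exists Z : Grpd C, is_zero_obj (r0 (graph_of Z)) /\ is_zero_obj (r1 (graph_of Z)))
    as (Z & Z0 & Z1).
  { apply (groupoid_of_divisible (fun K => is_zero_obj (r0 K) /\ is_zero_obj (r1 K))).
    exists (Build_rgraph (idm z) (idm z) (idm z) (comp_id_l _) (comp_id_l _)).
    split; [|now split].
    exists z, (idm z), (idm z), (idm z); split; simpl.
    - apply pb_intro; [reflexivity| |].
      + intros T x y _ _; apply terminal_eq, Hz.
      + intros T x y _; exists x; split; apply terminal_eq, Hz.
    - intros; apply terminal_eq, Hz.
    - intros; apply terminal_eq, Hz. }
  simpl in *; exists Z; split; [split|now split].
  - intros G; destruct (proj1 Z0 (g0 G)) as [h0 _], (proj1 Z1 (g1 G)) as [h1 _].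
    destruct (@functor_ex C HS Z G h0 h1) as (F & _ & _).
    { split; [|split]; apply initial_eq; [apply Z1|apply Z1|apply Z0]. }
    exists F; intros F'; apply IFun_eq; apply initial_eq; [apply Z0|apply Z1].
  - intros G; destruct (proj2 Z0 (g0 G)) as [h0 _], (proj2 Z1 (g1 G)) as [h1 _].
    destruct (@functor_ex C HS G Z h0 h1) as (F & _ & _).
    { split; [|split]; apply terminal_eq; [apply Z0|apply Z0|apply Z1]. }
    exists F; intros F'; apply IFun_eq; apply terminal_eq; [apply Z0|apply Z1].
Qed.

Lemma level_iso {A B : Grpd C} {F : Hom A B} : iso (f0 F) -> iso (f1 F) -> iso F.
Proof.
  intros (h0 & X0 & Y0) (h1 & X1 & Y1).
  destruct (@functor_ex C HS B A h0 h1) as (H & E0 & E1).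
  - split; [|split]; simpl.
    + rewrite <- (comp_id_l (gd A ∘ h1)), <- X0; rw (eq_sym (f_d F)), Y1; reflexivity.
    + rewrite <- (comp_id_l (gc A ∘ h1)), <- X0; rw (eq_sym (f_c F)), Y1; reflexivity.
    + rewrite <- (comp_id_l (ge A ∘ h0)), <- X1; rw (f_e F), Y0; reflexivity.
  - exists H; split; apply IFun_eq; simpl; congruence.
Qed.

Lemma iso_level {A B : Grpd C} {F : Hom A B} : iso F -> iso (f0 F) /\ iso (f1 F).
Proof.
  intros (H & X & Y); split; [exists (f0 H)|exists (f1 H)]; split.
  - exact (lv0 X).
  - exact (lv0 Y).
  - exact (lv1 X).
  - exact (lv1 Y).
Qed.

Lemma level_pb {A B K P : Grpd C} {F : Hom A K} {G : Hom B K} {p : Hom P A} {q : Hom P B} :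
  is_pullback (f0 F) (f0 G) (f0 p) (f0 q) -> is_pullback (f1 F) (f1 G) (f1 p) (f1 q) ->
  is_pullback F G p q.
Proof.
  intros H0 H1; apply pb_intro.
  - apply IFun_eq; [exact (pb_comm H0) | exact (pb_comm H1)].
  - intros T x y X Y; apply IFun_eq.
    + exact (pullback_ext _ _ H0 (lv0 X) (lv0 Y)).
    + exact (pullback_ext _ _ H1 (lv1 X) (lv1 Y)).
  - intros T x y E.
    destruct (pb_lift (f0 x) (f0 y) H0 (lv0 E)) as (h0 & X0 & Y0).
    destruct (pb_lift (f1 x) (f1 y) H1 (lv1 E)) as (h1 & X1 & Y1).
    destruct (@functor_ex C HS T P h0 h1) as (h & E0 & E1).
    { split; [|split]; simpl.
      - apply (pullback_ext _ _ H0).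
        + rw (eq_sym (f_d p)), X1, X0; apply f_d.
        + rw (eq_sym (f_d q)), Y1, Y0; apply f_d.
      - apply (pullback_ext _ _ H0).
        + rw (eq_sym (f_c p)), X1, X0; apply f_c.
        + rw (eq_sym (f_c q)), Y1, Y0; apply f_c.
      - apply (pullback_ext _ _ H1).
        + rw X1, (f_e p), X0; apply f_e.
        + rw Y1, (f_e q), Y0; apply f_e. }
    exists h; split; apply IFun_eq; simpl; congruence.
Qed.

Lemma level_pb_ex {A B K : Grpd C} (F : Hom A K) (G : Hom B K) :
  exists P (p : Hom P A) (q : Hom P B),
    is_pullback (f0 F) (f0 G) (f0 p) (f0 q) /\ is_pullback (f1 F) (f1 G) (f1 p) (f1 q).
Proof.
  destruct (pb_ex (f0 F) (f0 G)) as (P0 & p0 & q0 & H0).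
  destruct (pb_ex (f1 F) (f1 G)) as (P1 & p1 & q1 & H1).
  assert (exists P : Grpd C, exists p0 p1 q0 q1,
    gmor (graph_of P) (graph_of A) p0 p1 /\ gmor (graph_of P) (graph_of B) q0 q1 /\
    is_pullback (f0 F) (f0 G) p0 q0 /\ is_pullback (f1 F) (f1 G) p1 q1)
    as (P & u0 & u1 & v0 & v1 & U & V & W0 & W1).
  { apply (groupoid_of_divisible (fun L => exists p0 p1 q0 q1,
      gmor L (graph_of A) p0 p1 /\ gmor L (graph_of B) q0 q1 /\
      is_pullback (f0 F) (f0 G) p0 q0 /\ is_pullback (f1 F) (f1 G) p1 q1)).
    destruct (pb_lift (gd A ∘ p1) (gd B ∘ q1) H0) as (d & D1 & D2).
    { rw (eq_sym (f_d F)), (pb_comm H1), (f_d G); reflexivity. }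
    destruct (pb_lift (gc A ∘ p1) (gc B ∘ q1) H0) as (c & C1 & C2).
    { rw (eq_sym (f_c F)), (pb_comm H1), (f_c G); reflexivity. }
    destruct (pb_lift (ge A ∘ p0) (ge B ∘ q0) H1) as (e & E1 & E2).
    { rw (f_e F), (pb_comm H0), (f_e G); reflexivity. }
    assert (DE : d ∘ e = idm _).
    { apply (pullback_ext _ _ H0); [rw D1, E1, (g_de A) | rw D2, E2, (g_de B)]; reflexivity. }
    assert (CE : c ∘ e = idm _).
    { apply (pullback_ext _ _ H0); [rw C1, E1, (g_ce A) | rw C2, E2, (g_ce B)]; reflexivity. }
    exists (Build_rgraph d c e DE CE).
    assert (gmor (Build_rgraph d c e DE CE) (graph_of A) p0 p1) by (split; [|split]; simpl; auto).
    assert (gmor (Build_rgraph d c e DE CE) (graph_of B) q0 q1) by (split; [|split]; simpl; auto).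
    split; [|now exists p0, p1, q0, q1].
    apply (divisible_jointly_monic H H2 (groupoid_divisible A) (groupoid_divisible B)).
    intros T x y; exact (pullback_ext _ _ H1). }
  destruct (functor_ex U) as (p & <- & <-), (functor_ex V) as (q & <- & <-).
  now exists P, p, q.
Qed.

#[export] Instance grpd_complete : @finitely_complete (Grpd C).
Proof.
  split.
  - destruct grpd_zero as (Z & HZ & _); exists Z; apply HZ.
  - intros A B K F G; destruct (level_pb_ex F G) as (P & p & q & H0 & H1).
    exists P, p, q; exact (level_pb H0 H1).
Qed.

(** Some pullback is levelwise, and pullbacks are unique up to isomorphism. *)
Lemma pb_level {A B K P : Grpd C} {F : Hom A K} {G : Hom B K} {p : Hom P A} {q : Hom P B} :
  is_pullback F G p q ->
  is_pullback (f0 F) (f0 G) (f0 p) (f0 q) /\ is_pullback (f1 F) (f1 G) (f1 p) (f1 q).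
Proof.
  intros H; destruct (level_pb_ex F G) as (P' & p' & q' & H0 & H1).
  pose proof (level_pb H0 H1) as H'.
  destruct (pb_lift p q H' (pb_comm H)) as (h & X & Y).
  destruct (iso_level (pb_unique_iso H' H X Y)) as [I0 I1].
  split; [exact (pb_iso H0 (lv0 X) (lv0 Y) I0) | exact (pb_iso H1 (lv1 X) (lv1 Y) I1)].
Qed.

(** The projections of the kernel pair of a mono coincide, and the kernel pair is computed
    levelwise. *)
Lemma mono_level {A B : Grpd C} {F : Hom A B} : mono F -> mono (f0 F) /\ mono (f1 F).
Proof.
  intros M; destruct (level_pb_ex F F) as (P & p & q & H0 & H1).
  pose proof (M _ _ _ (pb_comm (level_pb H0 H1))) as E; subst q; split.
  - intros T x y Exy; destruct (pb_lift x y H0 Exy) as (h & X & Y); congruence.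
  - intros T x y Exy; destruct (pb_lift x y H1 Exy) as (h & X & Y); congruence.
Qed.

Lemma level_mono {A B : Grpd C} {F : Hom A B} : mono (f0 F) -> mono (f1 F) -> mono F.
Proof.
  intros M0 M1 T x y E; apply IFun_eq; [apply M0 | apply M1]; [exact (lv0 E) | exact (lv1 E)].
Qed.

Lemma ker_level {X A B : Grpd C} {F : Hom A B} {k : Hom X A} :
  is_kernel F k -> is_kernel (f0 F) (f0 k) /\ is_kernel (f1 F) (f1 k).
Proof.
  intros K; destruct grpd_zero as (Z & HZ & Z0 & Z1).
  destruct (proj1 HZ B) as [o _], (proj2 HZ X) as [o' _].
  destruct (pb_level (ker_pb o o' HZ K)) as [H0 H1].
  split; [exact (pb_ker Z0 H0) | exact (pb_ker Z1 H1)].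
Qed.

Lemma level_ker {X A B : Grpd C} {F : Hom A B} {k : Hom X A} :
  is_kernel (f0 F) (f0 k) -> is_kernel (f1 F) (f1 k) -> is_kernel F k.
Proof.
  intros K0 K1; destruct grpd_zero as (Z & HZ & Z0 & Z1).
  destruct (proj1 HZ B) as [o _], (proj2 HZ X) as [o' _].
  apply (@pb_ker _ _ _ _ _ F k o o' HZ), level_pb.
  - exact (ker_pb (f0 o) (f0 o') Z0 K0).
  - exact (ker_pb (f1 o) (f1 o') Z1 K1).
Qed.

(** The levelwise cokernels form a quotient graph of A, hence a groupoid. *)
Lemma level_normal_mono {X A : Grpd C} {k : Hom X A} :
  normal_mono (f0 k) -> normal_mono (f1 k) -> normal_mono k.
Proof.
  intros N0 N1.
  destruct (coker_ex N0) as (Q0 & q0 & S0 & K0), (coker_ex N1) as (Q1 & q1 & S1 & K1).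
  assert (exists Q : Grpd C, exists q0 q1, gmor (graph_of A) (graph_of Q) q0 q1 /\
    is_kernel q0 (f0 k) /\ is_kernel q1 (f1 k)) as (Q & u0 & u1 & U & U0 & U1).
  { apply (groupoid_of_divisible (fun L => exists q0 q1,
      gmor (graph_of A) L q0 q1 /\ is_kernel q0 (f0 k) /\ is_kernel q1 (f1 k))).
    destruct (sepi_desc (q0 ∘ gd A) S1 K1) as (d & D).
    { cn; rw (f_d k); rewrite comp_assoc; apply zero_mor_r, (ker_zero K0). }
    destruct (sepi_desc (q0 ∘ gc A) S1 K1) as (c & D').
    { cn; rw (f_c k); rewrite comp_assoc; apply zero_mor_r, (ker_zero K0). }
    destruct (sepi_desc (q1 ∘ ge A) S0 K0) as (e & E).
    { cn; rw (eq_sym (f_e k)); rewrite comp_assoc; apply zero_mor_r, (ker_zero K1). }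
    assert (DE : d ∘ e = idm _).
    { apply (sepi_epi _ _ S0); cn; rw E, D, (g_de A); reflexivity. }
    assert (CE : c ∘ e = idm _).
    { apply (sepi_epi _ _ S0); cn; rw E, D', (g_ce A); reflexivity. }
    assert (gmor (graph_of A) (Build_rgraph d c e DE CE) q0 q1) by (split; [|split]; simpl; auto).
    exists (Build_rgraph d c e DE CE); split; [|now exists q0, q1].
    exact (divisible_quotient H S1 (groupoid_divisible A)). }
  destruct (functor_ex U) as (q & <- & <-); exists Q, q; exact (level_ker U0 U1).
Qed.

Lemma normal_mono_level {X A : Grpd C} {k : Hom X A} :
  normal_mono k -> normal_mono (f0 k) /\ normal_mono (f1 k).
Proof.
  intros (Q & q & K); apply ker_level in K as [K0 K1].
  split; [now exists (g0 Q), (f0 q) | now exists (g1 Q), (f1 q)].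
Qed.

(** The levelwise images form a subgraph of B, hence a groupoid. *)
Lemma level_image {A B : Grpd C} (F : Hom A B) :
  exists I (Q : Hom A I) (M : Hom I B), M ∘ Q = F /\
    sepi (f0 Q) /\ sepi (f1 Q) /\ mono (f0 M) /\ mono (f1 M).
Proof.
  destruct (image_ex (f0 F)) as (I0 & q0 & m0 & S0 & M0 & E0).
  destruct (image_ex (f1 F)) as (I1 & q1 & m1 & S1 & M1 & E1).
  assert (exists I : Grpd C, exists q0 q1 m0 m1,
    gmor (graph_of A) (graph_of I) q0 q1 /\ gmor (graph_of I) (graph_of B) m0 m1 /\
    m0 ∘ q0 = f0 F /\ m1 ∘ q1 = f1 F /\ sepi q0 /\ sepi q1 /\ mono m0 /\ mono m1)
    as (I & u0 & u1 & v0 & v1 & U & V & W0 & W1 & H).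
  { apply (groupoid_of_divisible (fun L => exists q0 q1 m0 m1,
      gmor (graph_of A) L q0 q1 /\ gmor L (graph_of B) m0 m1 /\
      m0 ∘ q0 = f0 F /\ m1 ∘ q1 = f1 F /\ sepi q0 /\ sepi q1 /\ mono m0 /\ mono m1)).
    destruct (@sepi_lift _ _ _ _ _ _ q1 m0 (gd B ∘ m1) (q0 ∘ gd A) S1 M0) as (d & D1 & D2).
    { rw E0, E1; symmetry; apply f_d. }
    destruct (@sepi_lift _ _ _ _ _ _ q1 m0 (gc B ∘ m1) (q0 ∘ gc A) S1 M0) as (c & C1 & C2).
    { rw E0, E1; symmetry; apply f_c. }
    destruct (@sepi_lift _ _ _ _ _ _ q0 m1 (ge B ∘ m0) (q1 ∘ ge A) S0 M1) as (e & X1 & X2).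
    { rw E0, E1; apply f_e. }
    assert (DE : d ∘ e = idm _).
    { apply M0; rw D1, X1, (g_de B); reflexivity. }
    assert (CE : c ∘ e = idm _).
    { apply M0; rw C1, X1, (g_ce B); reflexivity. }
    assert (gmor (Build_rgraph d c e DE CE) (graph_of B) m0 m1) by (split; [|split]; simpl; auto).
    exists (Build_rgraph d c e DE CE); split.
    - exact (divisible_mono H (groupoid_divisible B) M1).
    - exists q0, q1, m0, m1; split; [split; [|split]; simpl; auto|].
      repeat (split; [assumption|]); assumption. }
  destruct (functor_ex U) as (Q & <- & <-), (functor_ex V) as (M & <- & <-).
  exists I, Q, M; split; [apply IFun_eq; assumption | exact H].
Qed.

Lemma sepi_level {A B : Grpd C} {F : Hom A B} : sepi F -> sepi (f0 F) /\ sepi (f1 F).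
Proof.
  intros H; destruct (level_image F) as (I & Q & M & E & S0 & S1 & M0 & M1).
  destruct (iso_level (H I M Q (level_mono M0 M1) E)) as [I0 I1].
  rewrite <- E; split; simpl; apply sepi_compose; auto; now apply iso_sepi.
Qed.

Lemma level_sepi_coeq {A B R : Grpd C} {F : Hom A B} {r s : Hom R A} :
  sepi (f0 F) -> sepi (f1 F) -> is_kernel_pair F r s -> is_coequalizer r s F.
Proof.
  intros S0 S1 K; destruct (pb_level K) as [K0 K1]; split; [exact (pb_comm K)|].
  intros T x E.
  destruct (proj2 (sepi_coeq S0 K0) _ _ (lv0 E)) as (h0 & X0 & _).
  destruct (proj2 (sepi_coeq S1 K1) _ _ (lv1 E)) as (h1 & X1 & _).
  destruct (@functor_ex C HS B T h0 h1) as (h & E0 & E1).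
  { split; [|split]; simpl.
    - apply (sepi_epi _ _ S1); cn; rw X1, (f_d F), X0; apply f_d.
    - apply (sepi_epi _ _ S1); cn; rw X1, (f_c F), X0; apply f_c.
    - apply (sepi_epi _ _ S0); cn; rw X0, (eq_sym (f_e F)), X1; apply f_e. }
  exists h; split.
  - apply IFun_eq; simpl; congruence.
  - intros h' E'; apply IFun_eq.
    + apply (sepi_epi _ _ S0); rewrite E0, X0; exact (lv0 E').
    + apply (sepi_epi _ _ S1); rewrite E1, X1; exact (lv1 E').
Qed.

Lemma level_sepi_regular {A B : Grpd C} {F : Hom A B} :
  sepi (f0 F) -> sepi (f1 F) -> regular_epi F.
Proof.
  intros S0 S1; destruct (pb_ex F F) as (R & r & s & K).
  exists R, r, s; exact (level_sepi_coeq S0 S1 K).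
Qed.

Lemma grpd_regular : @regular (Grpd C).
Proof.
  split; [apply grpd_complete|split].
  - intros A B R F r s K; destruct (level_image F) as (I & Q & M & E & S0 & S1 & M0 & M1).
    exists I, Q; apply (level_sepi_coeq S0 S1); subst F.
    pose proof (level_mono M0 M1) as HM; apply pb_intro.
    + apply HM; pose proof (pb_comm K) as H; cn_in H; exact H.
    + intros T x y; exact (pullback_ext _ _ K).
    + intros T x y Exy; apply (pb_lift x y K); now rw Exy.
  - intros A B K P F G p q PB H.
    destruct (sepi_level (regular_epi_sepi H)) as [S0 S1], (pb_level PB) as [H0 H1].
    exact (level_sepi_regular (sepi_pb H0 S0) (sepi_pb H1 S1)).
Qed.

Lemma grpd_exact : @Barr_exact (Grpd C).
Proof.
  split; [exact grpd_regular|]; intros A R r s (J & (t & T1 & T2) & _).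
  (* Joint monicity passes to each level through the product, which is levelwise as a pullback over
     the zero object. *)
  destruct (prod_ex A A) as (P & p & q & JP & UP).
  destruct (UP R r s) as (m & M1 & M2).
  assert (Mm : mono m).
  { intros T x y E; apply J; [rewrite <- M1 | rewrite <- M2]; now rw E. }
  destruct (mono_level Mm) as [N0 N1].
  destruct grpd_zero as (Z & HZ & Z0 & Z1); destruct (proj2 HZ A) as [o _].
  assert (PBP : is_pullback o o p q).
  { apply pb_intro; [apply terminal_eq, HZ | exact JP | intros T x y _; apply UP]. }
  destruct (pb_level PBP) as [P0 P1].
  assert (J0 : forall T (x y : Hom T (g0 R)), f0 r ∘ x = f0 r ∘ y -> f0 s ∘ x = f0 s ∘ y -> x = y).
  { intros T x y; rewrite <- M1, <- M2; simpl; intros X Y; apply N0.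
    cn_in X; cn_in Y; exact (pullback_ext _ _ P0 X Y). }
  assert (J1 : forall T (x y : Hom T (g1 R)), f1 r ∘ x = f1 r ∘ y -> f1 s ∘ x = f1 s ∘ y -> x = y).
  { intros T x y; rewrite <- M1, <- M2; simpl; intros X Y; apply N1.
    cn_in X; cn_in Y; exact (pullback_ext _ _ P1 X Y). }
  destruct (reflexive_effective J0 (lv0 T1) (lv0 T2)) as (Q0 & q0 & S0 & K0).
  destruct (reflexive_effective J1 (lv1 T1) (lv1 T2)) as (Q1 & q1 & S1 & K1).
  assert (exists Q : Grpd C, exists q0 q1, gmor (graph_of A) (graph_of Q) q0 q1 /\
    is_kernel_pair q0 (f0 r) (f0 s) /\ is_kernel_pair q1 (f1 r) (f1 s))
    as (Q & u0 & u1 & U & U0 & U1).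
  { apply (groupoid_of_divisible (fun L => exists q0 q1, gmor (graph_of A) L q0 q1 /\
      is_kernel_pair q0 (f0 r) (f0 s) /\ is_kernel_pair q1 (f1 r) (f1 s))).
    destruct (proj2 (sepi_coeq S1 K1) _ (q0 ∘ gd A)) as (d & D & _).
    { cn; rw (f_d r), (f_d s), (pb_comm K0); reflexivity. }
    destruct (proj2 (sepi_coeq S1 K1) _ (q0 ∘ gc A)) as (c & D' & _).
    { cn; rw (f_c r), (f_c s), (pb_comm K0); reflexivity. }
    destruct (proj2 (sepi_coeq S0 K0) _ (q1 ∘ ge A)) as (e & E & _).
    { cn; rw (eq_sym (f_e r)), (eq_sym (f_e s)), (pb_comm K1); reflexivity. }
    assert (DE : d ∘ e = idm _).
    { apply (sepi_epi _ _ S0); cn; rw E, D, (g_de A); reflexivity. }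
    assert (CE : c ∘ e = idm _).
    { apply (sepi_epi _ _ S0); cn; rw E, D', (g_ce A); reflexivity. }
    assert (gmor (graph_of A) (Build_rgraph d c e DE CE) q0 q1) by (split; [|split]; simpl; auto).
    exists (Build_rgraph d c e DE CE); split; [|now exists q0, q1].
    exact (divisible_quotient H S1 (groupoid_divisible A)). }
  destruct (functor_ex U) as (q' & <- & <-); exists Q, q'; exact (level_pb U0 U1).
Qed.

Lemma grpd_protomodular : @protomodular (Grpd C).
Proof.
  intros E B A A' P P' f p s p' s' h q1 q2 q1' q2' k H1 H2 H3 H4 PB PB' H5 H6 I.
  destruct (pb_level PB) as [X0 X1], (pb_level PB') as [Y0 Y1], (iso_level I) as [I0 I1].
  destruct HS as (_ & _ & _ & _ & HP); apply level_iso.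
  - exact (HP _ _ _ _ _ _ _ _ _ _ _ _ _ _ _ _ _ (lv0 H1) (lv0 H2) (lv0 H3) (lv0 H4)
             X0 Y0 (lv0 H5) (lv0 H6) I0).
  - exact (HP _ _ _ _ _ _ _ _ _ _ _ _ _ _ _ _ _ (lv1 H1) (lv1 H2) (lv1 H3) (lv1 H4)
             X1 Y1 (lv1 H5) (lv1 H6) I1).
Qed.

Lemma po_ex {a b c : C} (f : Hom c a) (g : Hom c b) :
  exists Q (p : Hom a Q) (q : Hom b Q), p ∘ f = q ∘ g /\
    (forall T (x y : Hom Q T), x ∘ p = y ∘ p -> x ∘ q = y ∘ q -> x = y) /\
    (forall T (x : Hom a T) (y : Hom b T), x ∘ f = y ∘ g -> exists h, h ∘ p = x /\ h ∘ q = y).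
Proof.
  destruct HS as (_ & _ & (_ & PO) & _); destruct (PO _ _ _ f g) as (Q & p & q & E & U).
  exists Q, p, q; split; [exact E|split].
  - intros T x y X Y; destruct (U T (x ∘ p) (x ∘ q)) as (h & _ & V); [now rw E|].
    now rewrite (V x), (V y).
  - intros T x y X; destruct (U T x y X) as (h & H & _); now exists h.
Qed.

(** The levelwise pushout W is only a reflexive graph; its groupoid reflection is the pushout. *)
Lemma grpd_cocomplete : @finitely_cocomplete (Grpd C).
Proof.
  split; [destruct grpd_zero as (Z & HZ & _); exists Z; apply HZ|].
  intros A B K F G.
  destruct (po_ex (f0 F) (f0 G)) as (Q0 & p0 & q0 & X0 & J0 & U0).
  destruct (po_ex (f1 F) (f1 G)) as (Q1 & p1 & q1 & X1 & J1 & U1).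
  destruct (U1 _ (p0 ∘ gd A) (q0 ∘ gd B)) as (d & D1 & D2).
  { cn; rw (f_d F), X0, (f_d G); reflexivity. }
  destruct (U1 _ (p0 ∘ gc A) (q0 ∘ gc B)) as (c & C1 & C2).
  { cn; rw (f_c F), X0, (f_c G); reflexivity. }
  destruct (U0 _ (p1 ∘ ge A) (q1 ∘ ge B)) as (e & E1 & E2).
  { cn; rw (eq_sym (f_e F)), X1, (f_e G); reflexivity. }
  assert (DE : d ∘ e = idm _).
  { apply J0; cn; [rw E1, D1, (g_de A) | rw E2, D2, (g_de B)]; reflexivity. }
  assert (CE : c ∘ e = idm _).
  { apply J0; cn; [rw E1, C1, (g_ce A) | rw E2, C2, (g_ce B)]; reflexivity. }
  pose (W := Build_rgraph d c e DE CE).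
  assert (Hp : gmor (graph_of A) W p0 p1) by (split; [|split]; simpl; auto).
  assert (Hq : gmor (graph_of B) W q0 q1) by (split; [|split]; simpl; auto).
  destruct (groupoid_reflection W) as (V & t0 & t1 & DV & Ht & Univ & Ep0 & Ep1).
  destruct (divisible_groupoid DV) as (Q & <-).
  destruct (functor_ex (gmor_comp Hp Ht)) as (p & P0 & P1).
  destruct (functor_ex (gmor_comp Hq Ht)) as (q & R0 & R1).
  unfold W in *; simpl in *; clear W.
  exists Q, p, q; split.
  - apply IFun_eq; simpl.
    + rewrite P0, R0; cn; exact (comp_l t0 X0).
    + rewrite P1, R1; cn; exact (comp_l t1 X1).
  - intros T x y Exy.
    destruct (U0 _ (f0 x) (f0 y) (lv0 Exy)) as (w0 & W01 & W02).
    destruct (U1 _ (f1 x) (f1 y) (lv1 Exy)) as (w1 & W11 & W12).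
    destruct (Univ (graph_of T) w0 w1 (groupoid_divisible T)) as (k0 & k1 & Hk & K0 & K1).
    { split; [|split]; simpl.
      - apply J1; cn; [rw W11, D1, W01 | rw W12, D2, W02]; apply f_d.
      - apply J1; cn; [rw W11, C1, W01 | rw W12, C2, W02]; apply f_c.
      - apply J0; cn; [rw W01, E1, W11 | rw W02, E2, W12]; apply f_e. }
    destruct (functor_ex Hk) as (k & L0 & L1); simpl in *; exists k; split; [split|].
    + apply IFun_eq; simpl; [rewrite L0, P0, comp_assoc, K0 | rewrite L1, P1, comp_assoc, K1]; assumption.
    + apply IFun_eq; simpl; [rewrite L0, R0, comp_assoc, K0 | rewrite L1, R1, comp_assoc, K1]; assumption.
    + intros k' A1 A2; apply IFun_eq.
      * apply Ep0; rewrite L0; transitivity w0; [apply J0 | exact (eq_sym K0)].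
        -- rewrite W01, <- (lv0 A1); simpl; rewrite P0; now cn.
        -- rewrite W02, <- (lv0 A2); simpl; rewrite R0; now cn.
      * apply Ep1; rewrite L1; transitivity w1; [apply J1 | exact (eq_sym K1)].
        -- rewrite W11, <- (lv1 A1); simpl; rewrite P1; now cn.
        -- rewrite W12, <- (lv1 A2); simpl; rewrite R1; now cn.
Qed.

#[export] Instance grpd_semi_abelian : @semi_abelian (Grpd C).
Proof.
  split; [|split; [|split; [|split]]].
  - destruct grpd_zero as (Z & HZ & _); now exists Z.
  - exact grpd_complete.
  - exact grpd_cocomplete.
  - exact grpd_exact.
  - exact grpd_protomodular.
Qed.

End GroupoidLevels.

(** * Coherence and normalizers *)

Arguments Build_SplitExt {C X B se_A} se_k se_a se_b se_ab se_ker.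

Section SplitExtensionMonos.
Context {C : Category} {HS : @semi_abelian C}.

(** The free point T + B over B turns maps out of an arbitrary T into morphisms of split extensions,
    to which the cancellation in [se_mono] applies. *)
Lemma se_mono_mono {X B X' : C} {E : SplitExt X B} {E' : SplitExt X' B} {x : Hom X X'}
  {u : Hom (se_A E) (se_A E')} : se_mono E E' x u (idm B) -> mono u.
Proof.
  intros [(M1 & M2 & M3) U] T g h Egh; cn_in M2; cn_in M3.
  destruct (coprod_ex T B) as (P & i & j & Cij & Uij).
  destruct (Uij B (se_a E ∘ g) (idm B)) as (al & A1 & A2).
  destruct (Uij _ g (se_b E)) as (v & V1 & V2), (Uij _ h (se_b E)) as (w & W1 & W2).
  assert (Eg : se_a E ∘ g = se_a E ∘ h) by (rewrite <- M2; now rw Egh).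
  assert (Av : se_a E ∘ v = al).
  { apply (cover_epi _ _ Cij); cn; [rw V1, A1; reflexivity | rw V2, A2; apply se_ab]. }
  assert (Aw : se_a E ∘ w = al).
  { apply (cover_epi _ _ Cij); cn; [rw W1, A1; auto | rw W2, A2; apply se_ab]. }
  assert (Uvw : u ∘ v = u ∘ w).
  { apply (cover_epi _ _ Cij); cn; [rw V1, W1; auto | rw V2, W2; reflexivity]. }
  destruct (ker_ex al) as (X0 & k & K).
  destruct (ker_lift (v ∘ k) (se_ker E)) as (x1 & X1); [rw Av; exact (ker_zero K)|].
  destruct (ker_lift (w ∘ k) (se_ker E)) as (x2 & X2); [rw Aw; exact (ker_zero K)|].
  destruct (U X0 B (Build_SplitExt k al j A2 K) x1 v (idm B) x2 w (idm B)) as (_ & Evw & _); cn; auto.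
  - split; [|split]; simpl; cn; auto.
  - split; [|split]; simpl; cn; auto.
  - apply (ker_mono (se_ker E')); rw (eq_sym M1), (eq_sym M1), X1, X2, Uvw; reflexivity.
  - rewrite <- V1, <- W1; now rw Evw.
Qed.

Lemma mono_se_mono {X B X' B' : C} {E : SplitExt X B} {E' : SplitExt X' B'} {x : Hom X X'}
  {u : Hom (se_A E) (se_A E')} {v : Hom B B'} :
  se_mor E E' x u v -> mono u -> mono v -> se_mono E E' x u v.
Proof.
  intros M Mu Mv; split; [exact M|].
  intros X0 B0 E0 x1 u1 v1 x2 u2 v2 (P1 & _) (Q1 & _) _ Eu Ev.
  apply Mu in Eu; apply Mv in Ev; subst; split; [|now split].
  apply (ker_mono (se_ker E)); congruence.
Qed.

End SplitExtensionMonos.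

Section GroupoidCoherence.
Context {C : Category} {HS : @semi_abelian C}.

Definition level0 {X B : Grpd C} (E : SplitExt X B) : SplitExt (g0 X) (g0 B) :=
  @Build_SplitExt C (g0 X) (g0 B) (g0 (se_A E)) (f0 (se_k E)) (f0 (se_a E)) (f0 (se_b E))
    (lv0 (se_ab E)) (proj1 (ker_level (se_ker E))).

Definition level1 {X B : Grpd C} (E : SplitExt X B) : SplitExt (g1 X) (g1 B) :=
  @Build_SplitExt C (g1 X) (g1 B) (g1 (se_A E)) (f1 (se_k E)) (f1 (se_a E)) (f1 (se_b E))
    (lv1 (se_ab E)) (proj2 (ker_level (se_ker E))).

(** The images of A1 + A2 in A, formed separately on objects and on arrows, give a subgraph of A,
    hence a groupoid J through which both functors factor; so J is all of A. *)
Lemma cover_level {A1 A2 A : Grpd C} {F1 : Hom A1 A} {F2 : Hom A2 A} :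
  cover F1 F2 -> cover (f0 F1) (f0 F2) /\ cover (f1 F1) (f1 F2).
Proof.
  intros H.
  destruct (coprod_ex (g0 A1) (g0 A2)) as (S0 & i0 & j0 & Cv0 & U0).
  destruct (coprod_ex (g1 A1) (g1 A2)) as (S1 & i1 & j1 & Cv1 & U1).
  destruct (U0 _ (f0 F1) (f0 F2)) as (s0 & X0 & Y0), (U1 _ (f1 F1) (f1 F2)) as (s1 & X1 & Y1).
  destruct (image_ex s0) as (J0 & e0 & m0 & H0 & M0 & E0).
  destruct (image_ex s1) as (J1 & e1 & m1 & H1 & M1 & E1).
  destruct (U1 _ (e0 ∘ (i0 ∘ gd A1)) (e0 ∘ (j0 ∘ gd A2))) as (hd & Hd1 & Hd2).
  destruct (U1 _ (e0 ∘ (i0 ∘ gc A1)) (e0 ∘ (j0 ∘ gc A2))) as (hc & Hc1 & Hc2).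
  destruct (U0 _ (e1 ∘ (i1 ∘ ge A1)) (e1 ∘ (j1 ∘ ge A2))) as (he & He1 & He2).
  destruct (@sepi_lift _ _ _ _ _ _ e1 m0 (gd A ∘ m1) hd H1 M0) as (d & D1 & D2).
  { apply (cover_epi _ _ Cv1); cn; rw E1.
    - rw Hd1, E0, X0, X1; symmetry; apply f_d.
    - rw Hd2, E0, Y0, Y1; symmetry; apply f_d. }
  destruct (@sepi_lift _ _ _ _ _ _ e1 m0 (gc A ∘ m1) hc H1 M0) as (c & C1 & C2).
  { apply (cover_epi _ _ Cv1); cn; rw E1.
    - rw Hc1, E0, X0, X1; symmetry; apply f_c.
    - rw Hc2, E0, Y0, Y1; symmetry; apply f_c. }
  destruct (@sepi_lift _ _ _ _ _ _ e0 m1 (ge A ∘ m0) he H0 M1) as (e & Q1 & Q2).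
  { apply (cover_epi _ _ Cv0); cn; rw E0.
    - rw He1, E1, X0, X1; apply f_e.
    - rw He2, E1, Y0, Y1; apply f_e. }
  assert (DE : d ∘ e = idm _) by (apply M0; rw D1, Q1, (g_de A); reflexivity).
  assert (CE : c ∘ e = idm _) by (apply M0; rw C1, Q1, (g_ce A); reflexivity).
  assert (Hm : gmor (Build_rgraph d c e DE CE) (graph_of A) m0 m1) by (split; [|split]; simpl; auto).
  assert (Z10 : m0 ∘ (e0 ∘ i0) = f0 F1) by (rw E0; exact X0).
  assert (Z20 : m0 ∘ (e0 ∘ j0) = f0 F2) by (rw E0; exact Y0).
  assert (Z11 : m1 ∘ (e1 ∘ i1) = f1 F1) by (rw E1; exact X1).
  assert (Z21 : m1 ∘ (e1 ∘ j1) = f1 F2) by (rw E1; exact Y1).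
  assert (exists J : Grpd C, exists m0 m1 a0 a1 b0 b1,
    gmor (graph_of J) (graph_of A) m0 m1 /\ mono m0 /\ mono m1 /\
    m0 ∘ a0 = f0 F1 /\ m1 ∘ a1 = f1 F1 /\ m0 ∘ b0 = f0 F2 /\ m1 ∘ b1 = f1 F2 /\
    (iso m0 -> iso m1 -> cover (f0 F1) (f0 F2) /\ cover (f1 F1) (f1 F2)))
    as (J & n0 & n1 & a0 & a1 & b0 & b1 & Hn & N0 & N1 & V1 & V2 & V3 & V4 & Fin).
  { apply (groupoid_of_divisible (fun L => exists m0 m1 a0 a1 b0 b1,
      gmor L (graph_of A) m0 m1 /\ mono m0 /\ mono m1 /\
      m0 ∘ a0 = f0 F1 /\ m1 ∘ a1 = f1 F1 /\ m0 ∘ b0 = f0 F2 /\ m1 ∘ b1 = f1 F2 /\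
      (iso m0 -> iso m1 -> cover (f0 F1) (f0 F2) /\ cover (f1 F1) (f1 F2)))).
    exists (Build_rgraph d c e DE CE); split; [exact (divisible_mono Hm (groupoid_divisible A) M1)|].
    exists m0, m1, (e0 ∘ i0), (e1 ∘ i1), (e0 ∘ j0), (e1 ∘ j1); repeat (split; [assumption|]).
    simpl; intros I0 I1.
    pose proof (sepi_compose (iso_sepi I0) H0) as T0; rewrite E0 in T0.
    pose proof (sepi_compose (iso_sepi I1) H1) as T1; rewrite E1 in T1.
    split; intros M m h1 h2 Hm' L1 L2.
    - destruct (U0 M h1 h2) as (h & W1 & W2); apply (T0 M m h Hm').
      apply (cover_epi _ _ Cv0); cn; [rw W1, X0 | rw W2, Y0]; assumption.
    - destruct (U1 M h1 h2) as (h & W1 & W2); apply (T1 M m h Hm').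
      apply (cover_epi _ _ Cv1); cn; [rw W1, X1 | rw W2, Y1]; assumption. }
  assert (Ha : gmor (graph_of A1) (graph_of J) a0 a1).
  { destruct Hn as (Nd & Nc & Ne); simpl in *; split; [|split]; simpl.
    - apply N0; rw (eq_sym Nd), V2, V1; apply f_d.
    - apply N0; rw (eq_sym Nc), V2, V1; apply f_c.
    - apply N1; rw Ne, V2, V1; apply f_e. }
  assert (Hb : gmor (graph_of A2) (graph_of J) b0 b1).
  { destruct Hn as (Nd & Nc & Ne); simpl in *; split; [|split]; simpl.
    - apply N0; rw (eq_sym Nd), V4, V3; apply f_d.
    - apply N0; rw (eq_sym Nc), V4, V3; apply f_c.
    - apply N1; rw Ne, V4, V3; apply f_e. }
  destruct (functor_ex Hn) as (n & <- & <-), (functor_ex Ha) as (a & <- & <-).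
  destruct (functor_ex Hb) as (b & <- & <-).
  assert (Ea : n ∘ a = F1) by (apply grpd_eq; [exact V1 | exact V2]).
  assert (Eb : n ∘ b = F2) by (apply grpd_eq; [exact V3 | exact V4]).
  destruct (iso_level (H J n a b (level_mono N0 N1) Ea Eb)).
  auto.
Qed.

Lemma level_cover {A1 A2 A : Grpd C} {F1 : Hom A1 A} {F2 : Hom A2 A} :
  cover (f0 F1) (f0 F2) -> cover (f1 F1) (f1 F2) -> cover F1 F2.
Proof.
  intros H0 H1 M m h1 h2 Hm E1 E2; destruct (mono_level Hm) as [M0 M1]; apply level_iso.
  - exact (H0 _ _ _ _ M0 (lv0 E1) (lv0 E2)).
  - exact (H1 _ _ _ _ M1 (lv1 E1) (lv1 E2)).
Qed.

Lemma grpd_algebraically_coherent :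
  @algebraically_coherent C -> @algebraically_coherent (Grpd C).
Proof.
  intros AC X1 X2 X B E1 E2 E u1 v1 u2 v2 S1 S2 J.
  destruct (mono_level (se_mono_mono S1)) as [N10 N11], (mono_level (se_mono_mono S2)) as [N20 N21].
  destruct (cover_level (jse_cover J)) as [J0 J1].
  destruct S1 as [(P1 & P2 & P3) _], S2 as [(Q1 & Q2 & Q3) _].
  apply cover_jse, level_cover; apply jse_cover.
  - apply (AC _ _ _ _ (level0 E1) (level0 E2) (level0 E) (f0 u1) (f0 v1) (f0 u2) (f0 v2)).
    + apply mono_se_mono; [|exact N10|exact (iso_mono (iso_id _))].
      split; [exact (lv0 P1)|split; [exact (lv0 P2)|exact (lv0 P3)]].
    + apply mono_se_mono; [|exact N20|exact (iso_mono (iso_id _))].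
      split; [exact (lv0 Q1)|split; [exact (lv0 Q2)|exact (lv0 Q3)]].
    + exact (cover_jse J0).
  - apply (AC _ _ _ _ (level1 E1) (level1 E2) (level1 E) (f1 u1) (f1 v1) (f1 u2) (f1 v2)).
    + apply mono_se_mono; [|exact N11|exact (iso_mono (iso_id _))].
      split; [exact (lv1 P1)|split; [exact (lv1 P2)|exact (lv1 P3)]].
    + apply mono_se_mono; [|exact N21|exact (iso_mono (iso_id _))].
      split; [exact (lv1 Q1)|split; [exact (lv1 Q2)|exact (lv1 Q3)]].
    + exact (cover_jse J1).
Qed.

(* The arrows of the normalizer of [A] in [B] are the arrows of [B] that normalize
   [g1 A] together with the identities on their source and target. *)
Lemma grpd_has_normalizers : @has_normalizers C -> @has_normalizers (Grpd C).
Proof.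
  intros HN A B F MF; destruct (mono_level MF) as [MF0 MF1].
  destruct (HN _ _ (f1 F) MF1) as (N & n & m & (Nn & Mm & Emn) & Univ).
  destruct (pb_ex (ge B) m) as (N0 & m0 & ep & PB0).
  pose proof (pb_mono (pb_sym PB0) Mm) as Mm0.
  destruct (pb_ex (gd B ∘ m) m0) as (N' & i' & d' & PBd).
  pose proof (pb_mono (pb_sym PBd) Mm0) as Mi'.
  destruct (pb_ex (gc B ∘ (m ∘ i')) m0) as (N1 & i'' & c' & PBc).
  pose proof (pb_mono (pb_sym PBc) Mm0) as Mi''.
  pose (i := i' ∘ i''); pose (m1 := m ∘ i); pose (d := d' ∘ i'').
  assert (Mi : mono i) by (apply mono_comp; assumption).
  assert (Mm1 : mono m1) by (apply mono_comp; assumption).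
  assert (Ed : gd B ∘ m1 = m0 ∘ d).
  { unfold m1, i, d; pose proof (pb_comm PBd) as E; cn_in E; cn; now rw E. }
  assert (Ec : gc B ∘ m1 = m0 ∘ c').
  { unfold m1, i; pose proof (pb_comm PBc) as E; cn_in E; cn; now rw E. }
  assert (Lift1 : forall T (x : Hom T N) (y z : Hom T N0),
             gd B ∘ (m ∘ x) = m0 ∘ y -> gc B ∘ (m ∘ x) = m0 ∘ z -> exists h, i ∘ h = x).
  { intros T x y z Y Z; destruct (pb_lift x y PBd) as (h' & H1 & H2); [now cn|].
    destruct (pb_lift h' z PBc) as (h & H3 & H4); [cn; rw H1; exact Z|].
    exists h; unfold i; rw H3; exact H1. }
  destruct (Lift1 _ ep (idm _) (idm _)) as (e & Ee).
  { rw (eq_sym (pb_comm PB0)), (g_de B); reflexivity. }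
  { rw (eq_sym (pb_comm PB0)), (g_ce B); reflexivity. }
  assert (Ee1 : m1 ∘ e = ge B ∘ m0) by (unfold m1; rw Ee; symmetry; exact (pb_comm PB0)).
  assert (DE : d ∘ e = idm _) by (apply Mm0; rw (eq_sym Ed), Ee1, (g_de B); reflexivity).
  assert (CE : c' ∘ e = idm _) by (apply Mm0; rw (eq_sym Ec), Ee1, (g_ce B); reflexivity).
  pose (L := Build_rgraph d c' e DE CE).
  assert (Hm : gmor L (graph_of B) m0 m1) by (split; [|split]; simpl; auto).
  destruct (pb_lift (f0 F) (n ∘ ge A) PB0) as (n0 & A1 & A2).
  { rw (eq_sym (f_e F)), Emn; reflexivity. }
  destruct (Lift1 _ n (n0 ∘ gd A) (n0 ∘ gc A)) as (n1 & En1).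
  { rw Emn, (f_d F), A1; reflexivity. }
  { rw Emn, (f_c F), A1; reflexivity. }
  assert (Em1 : m1 ∘ n1 = f1 F) by (unfold m1; rw En1; exact Emn).
  assert (Hn : gmor (graph_of A) L n0 n1).
  { split; [|split]; simpl.
    - apply Mm0; rw (eq_sym Ed), Em1, A1; apply f_d.
    - apply Mm0; rw (eq_sym Ec), Em1, A1; apply f_c.
    - apply Mm1; rw Ee1, Em1, A1; apply f_e. }
  assert (Nn1 : normal_mono n1) by (exact (normal_mono_through Mi Nn En1)).
  (* The objects of A are those objects in N0 whose identity lies in [g1 A], so [n0] is a pullback
     of the normal mono [n]. *)
  assert (Nn0 : normal_mono n0).
  { apply (@normal_mono_pb _ _ _ _ _ ep n n0 (ge A) Nn); apply pb_intro; [exact A2| |].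
    - intros T x y _ E; exact (split_mono (g_de A) _ _ _ E).
    - intros T x y E.
      assert (E' : ge B ∘ (m0 ∘ x) = f1 F ∘ y) by (rw (pb_comm PB0), E, Emn; reflexivity).
      assert (E'' : f0 F ∘ (gd A ∘ y) = m0 ∘ x).
      { rw (eq_sym (f_d F)), (eq_sym E'), (g_de B); reflexivity. }
      exists (gd A ∘ y); split.
      + apply Mm0; rw A1; exact E''.
      + apply MF1; rw (f_e F), E''; exact E'. }
  assert (U : forall (N2 : Grpd C) (n2 : Hom A N2) (m2 : Hom N2 B),
             normal_mono n2 -> mono m2 -> m2 ∘ n2 = F ->
             exists t0 t1, m0 ∘ t0 = f0 m2 /\ m1 ∘ t1 = f1 m2).
  { intros N2 n2 m2 H1 H2 H3.
    destruct (Univ _ _ _ (proj2 (normal_mono_level H1)) (proj2 (mono_level H2)) (lv1 H3))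
      as (t & [_ Et] & _).
    destruct (pb_lift (f0 m2) (t ∘ ge N2) PB0) as (t0 & B1 & B2).
    { rw Et; symmetry; apply f_e. }
    destruct (Lift1 _ t (t0 ∘ gd N2) (t0 ∘ gc N2)) as (t1 & E1).
    { rw Et, B1; apply f_d. }
    { rw Et, B1; apply f_c. }
    exists t0, t1; split; [exact B1 | unfold m1; rw E1; exact Et]. }
  destruct (divisible_groupoid (divisible_mono Hm (groupoid_divisible B) Mm1)) as (G & EG).
  assert (exists m0 m1 n0 n1, gmor (graph_of G) (graph_of B) m0 m1 /\
    gmor (graph_of A) (graph_of G) n0 n1 /\ mono m0 /\ mono m1 /\
    normal_mono n0 /\ normal_mono n1 /\ m0 ∘ n0 = f0 F /\ m1 ∘ n1 = f1 F /\
    (forall (N2 : Grpd C) (n2 : Hom A N2) (m2 : Hom N2 B),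
       normal_mono n2 -> mono m2 -> m2 ∘ n2 = F ->
       exists t0 t1, m0 ∘ t0 = f0 m2 /\ m1 ∘ t1 = f1 m2)) as R.
  { rewrite EG; exists m0, m1, n0, n1; repeat (split; [assumption|]); assumption. }
  clear - R HS; destruct R as (m0 & m1 & n0 & n1 & Hm & Hn & M0 & M1 & N0 & N1 & E0 & E1 & U).
  destruct (functor_ex Hm) as (m & <- & <-), (functor_ex Hn) as (n & <- & <-).
  exists G, n, m; split; [split; [exact (level_normal_mono N0 N1)|split; [exact (level_mono M0 M1)|]]|].
  - apply IFun_eq; assumption.
  - intros N2 n2 m2 H1 H2 H3; destruct (U N2 n2 m2 H1 H2 H3) as (t0 & t1 & T0 & T1).
    destruct (@functor_ex C HS N2 G t0 t1) as (t & X0 & X1).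
    { split; [|split]; simpl in *.
      - apply M0; rw (eq_sym (f_d m)), T1, T0; apply f_d.
      - apply M0; rw (eq_sym (f_c m)), T1, T0; apply f_c.
      - apply M1; rw (f_e m), T1, T0; apply f_e. }
    assert (Mt : m ∘ t = m2) by (apply IFun_eq; simpl; [rewrite X0 | rewrite X1]; assumption).
    exists t; split; [split|].
    + apply (level_mono M0 M1); rewrite comp_assoc, Mt, H3; apply eq_sym, IFun_eq; assumption.
    + exact Mt.
    + intros t' _ H; apply (level_mono M0 M1); congruence.
Qed.

End GroupoidCoherence.

(** * Actions *)

Section Actions.
Context {C : Category} {HS : @semi_abelian C}.

(** The middle component is unique by [se_mor_unique], so quantifying it away loses nothing. *)
Definition eqv {X B X' B' : C} (E : SplitExt X B) (E' : SplitExt X' B') (f : Hom X X')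
  (t : Hom B B') : Prop := exists u, se_mor E E' f u t.

Lemma se_mor_eqv {X B X' B' : C} {E : SplitExt X B} {E' : SplitExt X' B'} {f : Hom X X'}
  {u : Hom (se_A E) (se_A E')} {t : Hom B B'} : se_mor E E' f u t -> eqv E E' f t.
Proof. now exists u. Qed.

Lemma se_cover {X B : C} (E : SplitExt X B) : cover (se_k E) (se_b E).
Proof. exact (point_cover (se_ab E) (se_ker E)). Qed.

Lemma se_cover_iso {X B M : C} {E : SplitExt X B} {m : Hom M (se_A E)} (h1 : Hom X M)
  (h2 : Hom B M) : mono m -> m ∘ h1 = se_k E -> m ∘ h2 = se_b E -> iso m.
Proof. exact (@se_cover X B E M m h1 h2). Qed.

Lemma se_mor_unique {X B X' B' : C} {E : SplitExt X B} {E' : SplitExt X' B'} {f : Hom X X'}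
  {u u' : Hom (se_A E) (se_A E')} {t : Hom B B'} :
  se_mor E E' f u t -> se_mor E E' f u' t -> u = u'.
Proof.
  intros (H1 & _ & H2) (H1' & _ & H2'); apply (cover_epi _ _ (se_cover E)); congruence.
Qed.

Lemma se_mor_id {X B : C} (E : SplitExt X B) : se_mor E E (idm X) (idm _) (idm B).
Proof. split; [|split]; now cn. Qed.

Lemma se_mor_comp {X B X' B' X'' B'' : C} {E : SplitExt X B} {E' : SplitExt X' B'}
  {E'' : SplitExt X'' B''} {f : Hom X X'} {u : Hom (se_A E) (se_A E')} {t : Hom B B'}
  {f' : Hom X' X''} {u' : Hom (se_A E') (se_A E'')} {t' : Hom B' B''} :
  se_mor E E' f u t -> se_mor E' E'' f' u' t' -> se_mor E E'' (f' ∘ f) (u' ∘ u) (t' ∘ t).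
Proof.
  intros (H1 & H2 & H3) (K1 & K2 & K3); split; [|split]; cn.
  - rw H1, K1; reflexivity.
  - rw K2, H2; reflexivity.
  - rw H3, K3; reflexivity.
Qed.

Lemma eqv_comp {X B X' B' X'' B'' : C} {E : SplitExt X B} {E' : SplitExt X' B'}
  {E'' : SplitExt X'' B''} {f : Hom X X'} {t : Hom B B'} {f' : Hom X' X''} {t' : Hom B' B''} :
  eqv E E' f t -> eqv E' E'' f' t' -> eqv E E'' (f' ∘ f) (t' ∘ t).
Proof. intros (u & H) (u' & H'); exists (u' ∘ u); exact (se_mor_comp H H'). Qed.

Lemma eqv_zero {X B X' B' : C} (E : SplitExt X B) (E' : SplitExt X' B') {f : Hom X X'}
  (t : Hom B B') : is_zero_mor f -> eqv E E' f t.
Proof.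
  intros Z; exists (se_b E' ∘ (t ∘ se_a E)); split; [|split]; cn.
  - apply zero_mor_eq; [apply zero_mor_l, zero_mor_l, (ker_zero (se_ker E)) | now apply zero_mor_l].
  - rw (se_ab E'); reflexivity.
  - rw (se_ab E); reflexivity.
Qed.

Lemma pb_ker_lift {A B D P X : C} {p : Hom A B} {f : Hom D B} {q1 : Hom P A} {q2 : Hom P D}
  {k : Hom X A} {k' : Hom X P} :
  is_pullback p f q1 q2 -> is_kernel p k -> q1 ∘ k' = k -> is_zero_mor (q2 ∘ k') ->
  is_kernel q2 k'.
Proof.
  intros PB K E Z; apply ker_intro; [exact Z| |].
  - apply (mono_cancel q1); rewrite E; exact (ker_mono K).
  - intros T g Zg; destruct (ker_lift (q1 ∘ g) K) as (h & Hh).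
    { rw (pb_comm PB); now apply zero_mor_l. }
    exists h; apply (pullback_ext _ _ PB); [rw E; exact Hh|].
    apply zero_mor_eq; [rewrite comp_assoc; now apply zero_mor_r | exact Zg].
Qed.

(** The comparison with the pullback of E along [t] is the identity on kernels, so [split_five]
    inverts it. *)
Lemma se_pb {X T B : C} {F : SplitExt X T} {E : SplitExt X B} {u : Hom (se_A F) (se_A E)}
  {t : Hom T B} : se_mor F E (idm X) u t -> is_pullback (se_a E) t u (se_a F).
Proof.
  intros (H1 & H2 & H3); cn_in H1.
  destruct (pb_ex (se_a E) t) as (P & p & q & PB).
  destruct (pb_lift u (se_a F) PB H2) as (w & W1 & W2).
  destruct (pb_lift (se_b E ∘ t) (idm T) PB) as (s & S1 & S2); [now rw (se_ab E)|].
  apply (pb_iso PB W1 W2).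
  apply (@split_five _ _ _ _ _ _ _ (se_a F) (se_b F) q s w (se_k F) (w ∘ se_k F) (idm X)).
  - apply se_ab.
  - exact S2.
  - exact W2.
  - apply (pullback_ext _ _ PB); [rw W1, S1; exact H3 | rw W2, S2; apply se_ab].
  - apply se_ker.
  - apply (pb_ker_lift PB (se_ker E)); [rw W1; exact H1|].
    rw W2; apply (ker_zero (se_ker F)).
  - now cn.
  - apply iso_id.
Qed.

Lemma eqv_pb_ex {X T B : C} (E : SplitExt X B) (t : Hom T B) :
  exists F : SplitExt X T, eqv F E (idm X) t.
Proof.
  destruct (pb_ex (se_a E) t) as (P & p & q & PB).
  destruct (pb_lift (se_b E ∘ t) (idm T) PB) as (s & S1 & S2); [now rw (se_ab E)|].
  destruct (zero_mor_ex X T) as [o O].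
  destruct (pb_lift (se_k E) o PB) as (k & K1 & K2).
  { apply zero_mor_eq; [apply (ker_zero (se_ker E)) | now apply zero_mor_l]. }
  assert (K : is_kernel q k) by (apply (pb_ker_lift PB (se_ker E) K1); now rewrite K2).
  exists (Build_SplitExt k q s S2 K), p; split; [|split]; simpl; cn; auto.
  exact (pb_comm PB).
Qed.

Lemma eqv_lift {X T B Y T' : C} {F : SplitExt X T} {E : SplitExt X B} {E' : SplitExt Y T'}
  {t : Hom T B} {f : Hom Y X} {w : Hom T' T} :
  eqv F E (idm X) t -> eqv E' E f (t ∘ w) -> eqv E' F f w.
Proof.
  intros (u & Hu) (v & V1 & V2 & V3); pose proof (se_pb Hu) as PB.
  destruct Hu as (U1 & U2 & U3); cn_in U1.
  destruct (pb_lift v (w ∘ se_a E') PB) as (h & H1 & H2); [rewrite V2; now cn|].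
  exists h; split; [|split; [exact H2|]]; apply (pullback_ext _ _ PB).
  - rw H1, U1; exact V1.
  - rw H2; apply zero_mor_eq.
    + apply zero_mor_l, (ker_zero (se_ker E')).
    + rewrite comp_assoc; apply zero_mor_r, (ker_zero (se_ker F)).
  - rw H1, U3; now cn_in V3.
  - rw H2, (se_ab E'), (se_ab F); reflexivity.
Qed.

(** By [zero_ker_mono] only elements killed by both maps matter; these lie in the kernel X, where
    the hypothesis applies. *)
Lemma se_mor_jointly_monic {X Y1 Y2 T B1 B2 : C} {E : SplitExt X T} {E1 : SplitExt Y1 B1}
  {E2 : SplitExt Y2 B2} {p1 : Hom X Y1} {p2 : Hom X Y2} {u1 : Hom (se_A E) (se_A E1)}
  {u2 : Hom (se_A E) (se_A E2)} {t1 : Hom T B1} {t2 : Hom T B2} :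
  se_mor E E1 p1 u1 t1 -> se_mor E E2 p2 u2 t2 -> mono t1 ->
  (forall S (x y : Hom S X), p1 ∘ x = p1 ∘ y -> p2 ∘ x = p2 ∘ y -> x = y) ->
  forall S (x y : Hom S (se_A E)), u1 ∘ x = u1 ∘ y -> u2 ∘ x = u2 ∘ y -> x = y.
Proof.
  intros (H1 & H2 & H3) (K1 & K2 & K3) Mt J.
  destruct (mono_pair u1 u2) as (V & v1 & v2 & u & V1 & V2 & JV & _).
  assert (M : mono u).
  { apply zero_ker_mono; intros S x Z.
    assert (Z1 : is_zero_mor (u1 ∘ x)) by (rewrite <- V1; cn; now apply zero_mor_l).
    assert (Z2 : is_zero_mor (u2 ∘ x)) by (rewrite <- V2; cn; now apply zero_mor_l).
    destruct (ker_lift x (se_ker E)) as (y & Y).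
    { apply (zero_mor_mono Mt); rw (eq_sym H2); now apply zero_mor_l. }
    destruct (zero_mor_ex S X) as [o O].
    assert (y = o) as ->; [|rewrite <- Y; now apply zero_mor_l].
    apply J; apply zero_mor_eq; try (now apply zero_mor_l).
    - apply (zero_mor_mono (ker_mono (se_ker E1))); rw (eq_sym H1), Y; exact Z1.
    - apply (zero_mor_mono (ker_mono (se_ker E2))); rw (eq_sym K1), Y; exact Z2. }
  intros S x y X1 X2; apply M, JV; [rw V1, V1; exact X1 | rw V2, V2; exact X2].
Qed.

Lemma se_pb_ex {Y1 Y2 Y0 B1 B2 B0 P Q : C} {E1 : SplitExt Y1 B1} {E2 : SplitExt Y2 B2}
  {E0 : SplitExt Y0 B0} {f : Hom Y1 Y0} {u : Hom (se_A E1) (se_A E0)} {v : Hom B1 B0}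
  {g : Hom Y2 Y0} {u' : Hom (se_A E2) (se_A E0)} {v' : Hom B2 B0}
  {p1 : Hom P Y1} {p2 : Hom P Y2} {q1 : Hom Q B1} {q2 : Hom Q B2} :
  se_mor E1 E0 f u v -> se_mor E2 E0 g u' v' ->
  is_pullback f g p1 p2 -> is_pullback v v' q1 q2 ->
  exists (E : SplitExt P Q) (w1 : Hom (se_A E) (se_A E1)) (w2 : Hom (se_A E) (se_A E2)),
    is_pullback u u' w1 w2 /\ se_mor E E1 p1 w1 q1 /\ se_mor E E2 p2 w2 q2.
Proof.
  intros (F1 & F2 & F3) (G1 & G2 & G3) PP PQ.
  destruct (pb_ex u u') as (A & w1 & w2 & PA).
  destruct (pb_lift (se_a E1 ∘ w1) (se_a E2 ∘ w2) PQ) as (a & A1 & A2).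
  { rw (eq_sym F2), (pb_comm PA), G2; reflexivity. }
  destruct (pb_lift (se_b E1 ∘ q1) (se_b E2 ∘ q2) PA) as (b & B1' & B2').
  { rw F3, (pb_comm PQ), G3; reflexivity. }
  destruct (pb_lift (se_k E1 ∘ p1) (se_k E2 ∘ p2) PA) as (k & K1 & K2).
  { rw F1, (pb_comm PP), G1; reflexivity. }
  assert (AB : a ∘ b = idm Q).
  { apply (pullback_ext _ _ PQ); [rw A1, B1', (se_ab E1) | rw A2, B2', (se_ab E2)]; reflexivity. }
  assert (K : is_kernel a k).
  { apply ker_intro.
    - destruct (zero_mor_ex P Q) as [o O]; replace (a ∘ k) with o; [exact O|].
      apply (pullback_ext _ _ PQ); [rw A1, K1 | rw A2, K2]; apply zero_mor_eq;
        try (now apply zero_mor_l); rewrite comp_assoc; apply zero_mor_r, ker_zero, se_ker.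
    - intros T x y E; apply (pullback_ext _ _ PP).
      + apply (ker_mono (se_ker E1)); rw (eq_sym K1), E, K1; reflexivity.
      + apply (ker_mono (se_ker E2)); rw (eq_sym K2), E, K2; reflexivity.
    - intros T x Z.
      destruct (ker_lift (w1 ∘ x) (se_ker E1)) as (y1 & Y1').
      { rw (eq_sym A1); now apply zero_mor_l. }
      destruct (ker_lift (w2 ∘ x) (se_ker E2)) as (y2 & Y2').
      { rw (eq_sym A2); now apply zero_mor_l. }
      destruct (pb_lift y1 y2 PP) as (y & Z1 & Z2).
      { apply (ker_mono (se_ker E0)); rw (eq_sym F1), (eq_sym G1), Y1', Y2', (pb_comm PA).
        reflexivity. }
      exists y; apply (pullback_ext _ _ PA); [rw K1, Z1; exact Y1' | rw K2, Z2; exact Y2']. }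
  exists (Build_SplitExt k a b AB K), w1, w2; split; [exact PA|].
  split; split; simpl; auto.
Qed.

(** * Generic extensions and equivariant maps *)

Definition generic {X B : C} (G : SplitExt X B) : Prop :=
  forall B' (E : SplitExt X B'), exists v,
    eqv E G (idm X) v /\ forall v', eqv E G (idm X) v' -> v' = v.

Lemma generic_ex (AR : @action_representable C) (X : C) :
  exists B (G : SplitExt X B), generic G.
Proof.
  destruct (AR X) as (B & G & H); exists B, G; intros B' E.
  destruct (H B' E) as (u & v & M & U); exists v; split; [now exists u|].
  intros v' (u' & M'); exact (proj2 (U u' v' M')).
Qed.

(* When [GY] and [GZ] are generic, [a] and [b] are actions of [T] on [Y] and [Z],
   and [cmp GY GZ f a b] says that [f] is equivariant. *)
Definition cmp {Y BY Z BZ T : C} (GY : SplitExt Y BY) (GZ : SplitExt Z BZ) (f : Hom Y Z)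
  (a : Hom T BY) (b : Hom T BZ) : Prop :=
  exists F : SplitExt Y T, eqv F GY (idm Y) a /\ eqv F GZ f b.

Section Equivariance.
Context {Y BY Z BZ T : C} {GY : SplitExt Y BY} {GZ : SplitExt Z BZ}.

(** All extensions classified by [a] are pullbacks of GY along it, so the choice of the witness is
    immaterial. *)
Lemma cmp_all {f : Hom Y Z} {a : Hom T BY} {b : Hom T BZ} {F : SplitExt Y T} :
  cmp GY GZ f a b -> eqv F GY (idm Y) a -> eqv F GZ f b.
Proof.
  intros (F' & H1 & H2) H.
  assert (K : eqv F F' (idm Y) (idm T)) by (apply (eqv_lift H1); now cn).
  pose proof (eqv_comp K H2) as R; now rewrite !comp_id_r in R.
Qed.

Lemma cmp_pre {S : C} {f : Hom Y Z} {a : Hom T BY} {b : Hom T BZ} (t : Hom S T) :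
  cmp GY GZ f a b -> cmp GY GZ f (a ∘ t) (b ∘ t).
Proof.
  intros (F & H1 & H2); destruct (eqv_pb_ex F t) as (F' & H'); exists F'; split.
  - pose proof (eqv_comp H' H1) as R; now rewrite comp_id_r in R.
  - pose proof (eqv_comp H' H2) as R; now rewrite comp_id_r in R.
Qed.

Lemma cmp_eqv {T' : C} {f : Hom Y Z} {a : Hom T BY} {b : Hom T' BZ} {t : Hom T T'}
  {E : SplitExt Y T} {F : SplitExt Z T'} :
  cmp GY GZ f a (b ∘ t) -> eqv E GY (idm Y) a -> eqv F GZ (idm Z) b -> eqv E F f t.
Proof. intros H HE HF; exact (eqv_lift HF (cmp_all H HE)). Qed.

Lemma eqv_cmp {T' : C} {f : Hom Y Z} {a : Hom T BY} {b : Hom T' BZ} {t : Hom T T'}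
  {E : SplitExt Y T} {F : SplitExt Z T'} :
  eqv E F f t -> eqv E GY (idm Y) a -> eqv F GZ (idm Z) b -> cmp GY GZ f a (b ∘ t).
Proof.
  intros H HE HF; exists E; split; [exact HE|].
  pose proof (eqv_comp H HF) as R; now rewrite comp_id_l in R.
Qed.

Lemma cmp_zero (f : Hom Y Z) (a : Hom T BY) (b : Hom T BZ) :
  is_zero_mor f -> cmp GY GZ f a b.
Proof.
  intros O; destruct (eqv_pb_ex GY a) as (F & H); exists F; split; [exact H|].
  now apply eqv_zero.
Qed.

End Equivariance.

Lemma cmp_id {Y BY T : C} (GY : SplitExt Y BY) (a : Hom T BY) : cmp GY GY (idm Y) a a.
Proof. destruct (eqv_pb_ex GY a) as (F & H); now exists F. Qed.

Lemma cmp_id_eq {Y BY T : C} {GY : SplitExt Y BY} {a b : Hom T BY} :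
  generic GY -> cmp GY GY (idm Y) a b -> a = b.
Proof.
  intros G (F & H1 & H2); destruct (G T F) as (v & _ & U); now rewrite (U a H1), (U b H2).
Qed.

Lemma cmp_comp {Y BY Z BZ W BW T : C} {GY : SplitExt Y BY} {GZ : SplitExt Z BZ}
  {GW : SplitExt W BW} {f : Hom Y Z} {g : Hom Z W} {a : Hom T BY} {b : Hom T BZ}
  {c : Hom T BW} : cmp GY GZ f a b -> cmp GZ GW g b c -> cmp GY GW (g ∘ f) a c.
Proof.
  intros (F & H1 & H2) (F' & K1 & K2); exists F; split; [exact H1|].
  assert (K : eqv F F' f (idm T)) by (apply (eqv_lift K1); now cn).
  pose proof (eqv_comp K K2) as R; now rewrite comp_id_r in R.
Qed.

(** The map of semidirect products is lifted through a jointly monic pair; the lift is known on the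
    kernel and on the section, which cover the source. *)
Lemma cmp_jointly_monic {W BW P BP Y1 B1 Y2 B2 T : C} {GW : SplitExt W BW}
  {GP : SplitExt P BP} {G1 : SplitExt Y1 B1} {G2 : SplitExt Y2 B2} {h : Hom W P}
  {p1 : Hom P Y1} {p2 : Hom P Y2} {w : Hom T BW} {r : Hom T BP} {a1 : Hom T B1}
  {a2 : Hom T B2} :
  (forall S (x y : Hom S P), p1 ∘ x = p1 ∘ y -> p2 ∘ x = p2 ∘ y -> x = y) ->
  cmp GP G1 p1 r a1 -> cmp GP G2 p2 r a2 ->
  cmp GW G1 (p1 ∘ h) w a1 -> cmp GW G2 (p2 ∘ h) w a2 -> cmp GW GP h w r.
Proof.
  intros J H1 H2 K1 K2.
  destruct (eqv_pb_ex GW w) as (F & HF), (eqv_pb_ex GP r) as (Fr & HFr).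
  destruct (eqv_pb_ex G1 a1) as (F1 & HF1), (eqv_pb_ex G2 a2) as (F2 & HF2).
  rewrite <- (comp_id_r a1) in H1, K1; rewrite <- (comp_id_r a2) in H2, K2.
  destruct (cmp_eqv H1 HFr HF1) as (u1 & U1), (cmp_eqv H2 HFr HF2) as (u2 & U2).
  destruct (cmp_eqv K1 HF HF1) as (v1 & V1), (cmp_eqv K2 HF HF2) as (v2 & V2).
  pose proof (se_mor_jointly_monic U1 U2 (iso_mono (iso_id T)) J) as JA.
  destruct U1 as (A1 & A2 & A3), U2 as (B1' & B2' & B3'), V1 as (X1 & X2 & X3),
    V2 as (Y1' & Y2' & Y3').
  cn_in A2; cn_in A3; cn_in B2'; cn_in B3'; cn_in X1; cn_in X2; cn_in X3; cn_in Y1';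
    cn_in Y2'; cn_in Y3'.
  destruct (cover_lift_pair (r1 := u1) (r2 := u2) v1 v2 (se_k Fr ∘ h) (se_b Fr) (se_cover F) JA)
    as (d & D1 & D2); try congruence.
  - rw A1, X1; reflexivity.
  - rw B1', Y1'; reflexivity.
  - exists F; split; [exact HF|].
    assert (eqv F Fr h (idm T)) as K.
    { exists d; split; [|split]; cn.
      - apply JA; [rw D1, A1, X1 | rw D2, B1', Y1']; reflexivity.
      - rewrite <- A2; rw D1; exact X2.
      - apply JA; [rw D1; congruence | rw D2; congruence]. }
    pose proof (eqv_comp K HFr) as R; now rewrite comp_id_l, comp_id_r in R.
Qed.

Lemma cmp_mono {W BW P BP Y1 B1 T : C} {GW : SplitExt W BW} {GP : SplitExt P BP}
  {G1 : SplitExt Y1 B1} {h : Hom W P} {m : Hom P Y1} {w : Hom T BW} {r : Hom T BP}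
  {a1 : Hom T B1} :
  mono m -> cmp GP G1 m r a1 -> cmp GW G1 (m ∘ h) w a1 -> cmp GW GP h w r.
Proof.
  intros M H K; apply (cmp_jointly_monic (p1 := m) (p2 := m)) with (2 := H) (3 := H); auto.
Qed.

Lemma cmp_mono_eq {P BP Y1 B1 T : C} {GP : SplitExt P BP} {G1 : SplitExt Y1 B1}
  {m : Hom P Y1} {r r' : Hom T BP} {a1 : Hom T B1} :
  generic GP -> mono m -> cmp GP G1 m r a1 -> cmp GP G1 m r' a1 -> r = r'.
Proof.
  intros G M H K; apply (cmp_id_eq G), (cmp_mono M K); now rewrite comp_id_r.
Qed.

(** The map [u] of semidirect products induced by [q] is a strong epimorphism whose kernel lies in Y
    and is killed by [q], so the map [v] induced by [f ∘ q] descends along it. *)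
Lemma cmp_epi {Y BY Z BZ W BW T : C} {GY : SplitExt Y BY} {GZ : SplitExt Z BZ}
  {GW : SplitExt W BW} {q : Hom Y Z} {f : Hom Z W} {r : Hom T BY} {s : Hom T BZ}
  {a : Hom T BW} :
  sepi q -> cmp GY GZ q r s -> cmp GY GW (f ∘ q) r a -> cmp GZ GW f s a.
Proof.
  intros Sq H K.
  destruct (eqv_pb_ex GY r) as (F & HF), (eqv_pb_ex GZ s) as (F' & HF').
  rewrite <- (comp_id_r s) in H.
  destruct (cmp_eqv H HF HF') as (u & U1 & U2 & U3), (cmp_all K HF) as (v & V1 & V2 & V3).
  cn_in U2; cn_in U3; cn_in V1.
  assert (Su : sepi u).
  { intros M m h Hm E; destruct (@sepi_lift _ _ _ _ _ _ q m (se_k F') (h ∘ se_k F) Sq Hm) as (d & D & _).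
    { rw E; exact U1. }
    apply (se_cover_iso d (h ∘ se_b F) Hm D); rw E; exact U3. }
  destruct (ker_ex u) as (X & k & Ku).
  destruct (ker_lift k (se_ker F)) as (y & Hy).
  { rewrite <- U2; cn; apply zero_mor_l, (ker_zero Ku). }
  assert (Zq : is_zero_mor (q ∘ y)).
  { apply (zero_mor_mono (ker_mono (se_ker F'))); rw (eq_sym U1), Hy; exact (ker_zero Ku). }
  destruct (sepi_desc v Su Ku) as (w & Ww).
  { rewrite <- Hy; rw V1; now apply zero_mor_l, zero_mor_l. }
  exists F'; split; [exact HF'|]; exists w; split; [|split].
  - apply (sepi_epi _ _ Sq); cn; rw (eq_sym U1), Ww; exact V1.
  - apply (sepi_epi _ _ Su); cn; rw Ww, U2; exact V2.
  - rewrite <- U3; rw Ww; exact V3.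
Qed.

(** The pullback of two semidirect products over the third is a split extension with kernel P, and
    genericity reads off its action. *)
Lemma cmp_pb {P BP Y1 B1 Y2 B2 Y0 B0 T : C} {GP : SplitExt P BP} {G1 : SplitExt Y1 B1}
  {G2 : SplitExt Y2 B2} {G0 : SplitExt Y0 B0} {f : Hom Y1 Y0} {g : Hom Y2 Y0}
  {p1 : Hom P Y1} {p2 : Hom P Y2} {a1 : Hom T B1} {a2 : Hom T B2} {a0 : Hom T B0} :
  generic GP -> is_pullback f g p1 p2 -> cmp G1 G0 f a1 a0 -> cmp G2 G0 g a2 a0 ->
  exists r : Hom T BP, cmp GP G1 p1 r a1 /\ cmp GP G2 p2 r a2.
Proof.
  intros G PB H1 H2.
  destruct (eqv_pb_ex G1 a1) as (F1 & HF1), (eqv_pb_ex G2 a2) as (F2 & HF2).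
  destruct (eqv_pb_ex G0 a0) as (F0 & HF0).
  rewrite <- (comp_id_r a0) in H1, H2.
  destruct (cmp_eqv H1 HF1 HF0) as (u1 & U1), (cmp_eqv H2 HF2 HF0) as (u2 & U2).
  assert (PT : is_pullback (idm T) (idm T) (idm T) (idm T)).
  { apply pb_intro; [reflexivity| |].
    - intros S x y E _; now rewrite !comp_id_l in E.
    - intros S x y E; rewrite !comp_id_l in E; exists x; now cn. }
  destruct (se_pb_ex U1 U2 PB PT) as (E & w1 & w2 & _ & W1 & W2).
  destruct (G T E) as (r & Hr & _); exists r; split.
  - rewrite <- (comp_id_r a1); apply (eqv_cmp (se_mor_eqv W1) Hr HF1).
  - rewrite <- (comp_id_r a2); apply (eqv_cmp (se_mor_eqv W2) Hr HF2).
Qed.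

(** A kernel is a pullback along 0 -> Y0, and the zero map is always equivariant. *)
Lemma cmp_ker {L BL Y1 B1 Y0 B0 T : C} {GL : SplitExt L BL} {G1 : SplitExt Y1 B1}
  {G0 : SplitExt Y0 B0} {f : Hom Y1 Y0} {l : Hom L Y1} {a1 : Hom T B1} {a0 : Hom T B0} :
  generic GL -> is_kernel f l -> cmp G1 G0 f a1 a0 -> exists r : Hom T BL, cmp GL G1 l r a1.
Proof.
  intros G K H; destruct (zero_obj_ex (C := C)) as [z Hz].
  destruct (proj1 Hz Y0) as [o _], (proj2 Hz L) as [o' _].
  assert (Kz : is_kernel (idm z) (idm z)).
  { apply ker_intro; [exists z, (idm z), (idm z); now cn | exact (iso_mono (iso_id z)) |].
    intros T' g _; exists g; now cn. }
  destruct (zero_mor_ex T z) as [t _].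
  pose (Gz := Build_SplitExt (idm z) (idm z) (idm z) (comp_id_l _) Kz).
  destruct (@cmp_pb _ _ _ _ _ _ _ _ _ GL G1 Gz G0 f o l o' a1 t a0 G (ker_pb o o' Hz K) H)
    as (r & R & _); [|now exists r].
  apply cmp_zero; exists z, (idm z), o; now cn.
Qed.

(* Actions agreeing on jointly covering subobjects agree: algebraic coherence shows that
   the points generated by the two restrictions have the whole object as kernel. *)
Lemma cmp_cover_eq {K BK Z BZ X BX T : C} {GK : SplitExt K BK} {GZ : SplitExt Z BZ}
  {GX : SplitExt X BX} {k : Hom K X} {e : Hom Z X} {x : Hom T BK} {z : Hom T BZ}
  {y y' : Hom T BX} :
  @algebraically_coherent C -> generic GX -> mono k -> mono e -> cover k e ->
  cmp GK GX k x y -> cmp GZ GX e z y -> cmp GK GX k x y' -> cmp GZ GX e z y' -> y = y'.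
Proof.
  intros AC G Mk Me Cv H1 H2 H3 H4.
  destruct (eqv_pb_ex GX y) as (F & HF), (eqv_pb_ex GX y') as (F' & HF').
  destruct (eqv_pb_ex GK x) as (Fk & HFk), (eqv_pb_ex GZ z) as (Fe & HFe).
  rewrite <- (comp_id_r y) in H1, H2; rewrite <- (comp_id_r y') in H3, H4.
  destruct (cmp_eqv H1 HFk HF) as (u & U), (cmp_eqv H2 HFe HF) as (v & V).
  destruct (cmp_eqv H3 HFk HF') as (u' & U'), (cmp_eqv H4 HFe HF') as (v' & V').
  pose proof (se_mor_jointly_monic U U (iso_mono (iso_id T)) (fun S a b E _ => Mk S a b E)) as Mu.
  pose proof (se_mor_jointly_monic V V (iso_mono (iso_id T)) (fun S a b E _ => Me S a b E)) as Mv.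
  destruct U as (U1 & U2 & U3), V as (V1 & V2 & V3), U' as (U1' & U2' & U3'), V' as (V1' & V2' & V3').
  cn_in U2; cn_in U3; cn_in V2; cn_in V3; cn_in U2'; cn_in U3'; cn_in V2'; cn_in V3'.
  (* J is the part of the product of the two semidirect products that is generated by the common
     restrictions to K and Z. *)
  destruct (prod_ex (se_A F) (se_A F')) as (P & p & p' & JP & UP).
  destruct (UP _ u u') as (uu & P1 & P2), (UP _ v v') as (vv & Q1 & Q2).
  destruct (coprod_ex (se_A Fk) (se_A Fe)) as (S & i & j & Cij & Uij).
  destruct (Uij _ uu vv) as (s & S1 & S2).
  destruct (image_ex s) as (J & q & m & Sq & Mm & Em).
  pose (w := p ∘ m); pose (w' := p' ∘ m); pose (i' := q ∘ i); pose (j' := q ∘ j).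
  assert (W1 : w ∘ i' = u) by (unfold w, i'; cn; rw Em, S1; exact P1).
  assert (W2 : w' ∘ i' = u') by (unfold w', i'; cn; rw Em, S1; exact P2).
  assert (W3 : w ∘ j' = v) by (unfold w, j'; cn; rw Em, S2; exact Q1).
  assert (W4 : w' ∘ j' = v') by (unfold w', j'; cn; rw Em, S2; exact Q2).
  assert (JJ : forall A (a b : Hom A J), w ∘ a = w ∘ b -> w' ∘ a = w' ∘ b -> a = b).
  { intros A a b; unfold w, w'; cn; intros A1 A2; apply Mm, JP; assumption. }
  assert (Cv' : cover i' j').
  { intros M n h1 h2 Hn E1 E2; destruct (Uij M h1 h2) as (h & A1 & A2).
    apply (Sq M n h Hn), (cover_epi _ _ Cij); cn; [rw A1 | rw A2]; assumption. }
  clearbody w w' i' j'; clear m q Em Sq Mm s S1 S2 S i j Cij Uij P p p' JP UP uu vv P1 P2 Q1 Q2.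
  (* J is a point over T: its map to T may be computed through either factor, and the sections
     coming from Fk and Fe agree. *)
  pose (a := se_a F ∘ w); pose (b := i' ∘ se_b Fk).
  assert (Ea : a ∘ i' = se_a Fk) by (unfold a; cn; rw W1; exact U2).
  assert (Ea' : a ∘ j' = se_a Fe) by (unfold a; cn; rw W3; exact V2).
  assert (Ea2 : a = se_a F' ∘ w').
  { apply (cover_epi _ _ Cv'); cn; [rewrite Ea; rw W2 | rewrite Ea'; rw W4]; auto. }
  assert (Eb : b = j' ∘ se_b Fe).
  { unfold b; apply JJ; [rw W1, W3 | rw W2, W4]; congruence. }
  assert (AB : a ∘ b = idm T) by (unfold b; rw Ea; apply se_ab).
  assert (Wb : w ∘ b = se_b F) by (unfold b; rw W1; exact U3).
  assert (Wb' : w' ∘ b = se_b F') by (unfold b; rw W2; exact U3').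
  destruct (ker_ex a) as (XJ & kJ & KJ).
  pose (FJ := Build_SplitExt kJ a b AB KJ).
  destruct (ker_lift (i' ∘ se_k Fk) KJ) as (k' & Hk').
  { rw Ea; apply (ker_zero (se_ker Fk)). }
  destruct (ker_lift (j' ∘ se_k Fe) KJ) as (e' & He').
  { rw Ea'; apply (ker_zero (se_ker Fe)). }
  destruct (ker_lift (w ∘ kJ) (se_ker F)) as (pi & Hpi).
  { rewrite comp_assoc; exact (ker_zero KJ). }
  destruct (ker_lift (w' ∘ kJ) (se_ker F')) as (pi' & Hpi').
  { rewrite comp_assoc, <- Ea2; exact (ker_zero KJ). }
  assert (Cke : cover k' e').
  { apply jse_cover.
    apply (AC _ _ _ _ Fk Fe FJ k' i' e' j').
    - apply mono_se_mono; [| |exact (iso_mono (iso_id T))].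
      + split; [|split]; simpl; cn; auto.
      + intros A c d E; simpl in E; apply Mu; rewrite <- W1; now rw E.
    - apply mono_se_mono; [| |exact (iso_mono (iso_id T))].
      + split; [|split]; simpl; cn; auto.
      + intros A c d E; simpl in E; apply Mv; rewrite <- W3; now rw E.
    - exact (cover_jse Cv'). }
  assert (Pk : pi ∘ k' = k).
  { apply (ker_mono (se_ker F)); rw Hpi, Hk', W1; exact U1. }
  assert (Pe : pi ∘ e' = e).
  { apply (ker_mono (se_ker F)); rw Hpi, He', W3; exact V1. }
  assert (Pk' : pi' ∘ k' = k).
  { apply (ker_mono (se_ker F')); rw Hpi', Hk', W2; exact U1'. }
  assert (Pe' : pi' ∘ e' = e).
  { apply (ker_mono (se_ker F')); rw Hpi', He', W4; exact V1'. }
  assert (Epi : pi = pi') by (apply (cover_epi _ _ Cke); congruence).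
  subst pi'.
  (* Both projections from the kernel of J to X coincide on the cover, so their common value is
     monic; it contains [k] and [e]. *)
  assert (Ipi : iso pi).
  { apply (Cv _ pi k' e'); auto; intros A c d E; apply (ker_mono KJ), JJ.
    - rw (eq_sym Hpi), E, Hpi; reflexivity.
    - rw (eq_sym Hpi'), E, Hpi'; reflexivity. }
  (* So J is the graph of a morphism from the first semidirect product to the second. *)
  assert (Iw : iso w).
  { apply (@split_five _ _ _ _ _ _ _ a b (se_a F) (se_b F) w kJ (se_k F) pi); auto;
      [apply se_ab | apply se_ker]. }
  destruct Iw as (w0 & I1 & I2).
  assert (R : eqv F F' (idm X) (idm T)).
  { destruct Ipi as (pi0 & J1 & J2); exists (w' ∘ w0); split; [|split]; cn.
    - assert (E : se_k F = w ∘ (kJ ∘ pi0)) by (rw (eq_sym Hpi), J2; reflexivity).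
      rewrite E; rw I1, (eq_sym Hpi'), J2; reflexivity.
    - rewrite comp_assoc, <- Ea2; unfold a; cn; rw I2; reflexivity.
    - rewrite <- Wb; rw I1; exact Wb'. }
  pose proof (eqv_comp R HF') as R'; rewrite !comp_id_r in R'.
  destruct (G T F) as (t & _ & Ut); now rewrite (Ut y HF), (Ut y' R').
Qed.

(* With normalizers, a normal subobject stable under an action is normal in the
   semidirect product, so the action passes to the quotient. *)
Lemma cmp_quotient {L BL Y BY Z BZ T : C} {GL : SplitExt L BL} {GY : SplitExt Y BY}
  {GZ : SplitExt Z BZ} {l : Hom L Y} {q : Hom Y Z} {lam : Hom T BL} {r : Hom T BY} :
  @has_normalizers C -> generic GZ -> sepi q -> is_kernel q l ->
  cmp GL GY l lam r -> exists s : Hom T BZ, cmp GY GZ q r s.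
Proof.
  intros HN G Sq Kl H.
  destruct (eqv_pb_ex GY r) as (F & HF), (eqv_pb_ex GL lam) as (FL & HFL).
  rewrite <- (comp_id_r r) in H.
  destruct (cmp_eqv H HFL HF) as (u & U).
  pose proof (ker_mono Kl) as Ml; pose proof (ker_mono (se_ker F)) as MkF.
  pose proof (se_mor_jointly_monic U U (iso_mono (iso_id T)) (fun S a b E _ => Ml S a b E)) as Mu.
  destruct U as (U1 & U2 & U3); cn_in U2; cn_in U3.
  (* The normalizer of L contains Y, in which L is normal, and the section of T, since L is also
     normal in its own semidirect product; these generate everything. *)
  assert (Nkl : normal_mono (se_k F ∘ l)).
  { destruct (HN _ _ (se_k F ∘ l)) as (N & n & m & (Nn & Mm & Emn) & Univ).
    { apply mono_comp; assumption. }
    destruct (Univ _ l (se_k F)) as (t1 & [_ T1] & _); auto.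
    { now exists Z, q. }
    destruct (Univ _ (se_k FL) u) as (t2 & [_ T2] & _); auto.
    { exists T, (se_a FL); apply se_ker. }
    { intros S a b E; exact (Mu S a b E E). }
    rewrite <- Emn; apply normal_mono_iso; [exact Nn|].
    apply (se_cover_iso t1 (t2 ∘ se_b FL) Mm T1); rw T2; exact U3. }
  destruct (coker_ex Nkl) as (Q & rho & Sr & Kr).
  assert (Zal : is_zero_mor (se_a F ∘ (se_k F ∘ l))).
  { rewrite comp_assoc; apply zero_mor_r, (ker_zero (se_ker F)). }
  destruct (sepi_desc (se_a F) Sr Kr Zal) as (al & Eal).
  destruct (sepi_desc (rho ∘ se_k F) Sq Kl) as (k & Ek).
  { pose proof (ker_zero Kr) as O; now cn; cn_in O. }
  assert (AB : al ∘ (rho ∘ se_b F) = idm T) by (rw Eal; apply se_ab).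
  assert (Mk : mono k).
  { apply zero_ker_mono; intros S x Zx.
    destruct (sepi_local x Sq) as (S' & e & y & Se & Ey).
    destruct (ker_lift (se_k F ∘ y) Kr) as (y' & Hy').
    { rw (eq_sym Ek), Ey; rewrite comp_assoc; now apply zero_mor_r. }
    cn_in Hy'; apply MkF in Hy'.
    apply (zero_mor_sepi Se); rewrite <- Ey, <- Hy', comp_assoc; apply zero_mor_r, (ker_zero Kl). }
  assert (K : is_kernel al k).
  { apply ker_intro; [|exact Mk|].
    - apply (zero_mor_sepi Sq); cn; rw Ek, Eal; apply (ker_zero (se_ker F)).
    - intros S g Zg; destruct (sepi_local g Sr) as (S' & e & y & Se & Ey).
      destruct (ker_lift y (se_ker F)) as (y' & Hy').
      { rewrite <- Eal; rw Ey; rewrite comp_assoc; now apply zero_mor_r. }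
      destruct (@sepi_lift _ _ _ _ _ _ e k g (q ∘ y') Se Mk) as (d & D & _).
      { rw Ek, Hy'; exact Ey. }
      now exists d. }
  pose (FZ := Build_SplitExt k al (rho ∘ se_b F) AB K).
  destruct (G T FZ) as (s & Hs & _); exists s, F; split; [exact HF|].
  assert (R : eqv F FZ q (idm T)).
  { exists rho; split; [|split]; simpl; cn; auto. }
  pose proof (eqv_comp R Hs) as R'; now rewrite comp_id_l, comp_id_r in R'.
Qed.

(** The condition is membership of generalized elements in a subobject of W. Such conditions can be
    intersected, which is how universal objects are obtained. *)
Definition representable {W : C} (Q : forall T, Hom T W -> Prop) : Prop :=
  exists W' (j : Hom W' W), mono j /\ forall T (t : Hom T W), (exists t', j ∘ t' = t) <-> Q T t.

Lemma representable_and {W : C} {Q Q' : forall T, Hom T W -> Prop} :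
  representable Q -> representable Q' -> representable (fun T t => Q T t /\ Q' T t).
Proof.
  intros (V & j & Mj & H) (V' & j' & Mj' & H').
  destruct (pb_ex j j') as (P & p & p' & PB).
  exists P, (j ∘ p); split.
  - apply mono_comp; [exact Mj | exact (pb_mono (pb_sym PB) Mj')].
  - intros T t; split.
    + intros (w & <-); split; [apply H; exists (p ∘ w); now cn|].
      apply H'; exists (p' ∘ w); cn; rw (pb_comm PB); reflexivity.
    + intros [A B]; apply H in A as (a & <-); apply H' in B as (b & B).
      destruct (pb_lift a b PB (eq_sym B)) as (w & W1 & _); exists w; cn; now rewrite W1.
Qed.

(* The stabilizer of the graph of [f], obtained from the normalizer of
   [<1, f>] : Y -> A_Y x_W A_Z. *)
Lemma cmp_representable {Y BY Z BZ W : C} (GY : SplitExt Y BY) (GZ : SplitExt Z BZ)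
  (f : Hom Y Z) (a : Hom W BY) (b : Hom W BZ) :
  @has_normalizers C ->
  representable (fun T (t : Hom T W) => cmp GY GZ f (a ∘ t) (b ∘ t)).
Proof.
  intros HN.
  destruct (eqv_pb_ex GY a) as (EY & HY), (eqv_pb_ex GZ b) as (EZ & HZ).
  destruct (pb_ex (se_a EY) (se_a EZ)) as (P & p & q & PB).
  destruct (pb_lift (se_b EY) (se_b EZ) PB) as (s & S1 & S2); [now rewrite !se_ab|].
  destruct (pb_lift (se_k EY) (se_k EZ ∘ f) PB) as (g & G1 & G2).
  { apply zero_mor_eq; [apply (ker_zero (se_ker EY))|].
    rewrite comp_assoc; apply zero_mor_r, (ker_zero (se_ker EZ)). }
  assert (Mg : mono g).
  { apply (mono_cancel p); rewrite G1; exact (ker_mono (se_ker EY)). }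
  destruct (HN _ _ g Mg) as (N & n & m & (Nn & Mm & Emn) & Univ).
  (* W' is the part of W that normalizes Y when placed in P by the section [s]. *)
  destruct (pb_ex s m) as (W' & j & v & PW).
  exists W', j; split; [exact (pb_mono (pb_sym PW) Mm)|].
  (* Conjugation: pulling N -> N/Y back along W' -> N -> N/Y gives a split extension of W' by Y,
     which maps to both semidirect products through P. *)
  assert (Base : cmp GY GZ f (a ∘ j) (b ∘ j)).
  { destruct (coker_ex Nn) as (Q & c & Sc & Kc).
    destruct (sepi_desc (se_a EY ∘ (p ∘ m)) Sc Kc) as (h & Hh).
    { cn; rw Emn, G1; apply (ker_zero (se_ker EY)). }
    destruct (pb_ex c (c ∘ v)) as (M & x & y & PM).
    destruct (pb_lift v (idm W') PM) as (sM & T1 & T2); [now cn|].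
    destruct (zero_mor_ex Y W') as [o O].
    destruct (pb_lift n o PM) as (kM & K1 & K2).
    { apply zero_mor_eq; [exact (ker_zero Kc) | now apply zero_mor_l]. }
    assert (KM : is_kernel y kM).
    { apply (pb_ker_lift PM Kc K1); now rewrite K2. }
    pose (F := Build_SplitExt kM y sM T2 KM).
    assert (Ea : se_a EY ∘ (p ∘ (m ∘ x)) = j ∘ y).
    { pose proof (comp_r x Hh) as Hx; cn_in Hx; rewrite <- Hx; rw (pb_comm PM).
      pose proof (comp_r v Hh) as Hv; cn_in Hv; rw Hv, (eq_sym (pb_comm PW)), S1, (se_ab EY).
      reflexivity. }
    assert (RY : eqv F EY (idm Y) j).
    { exists (p ∘ (m ∘ x)); split; [|split]; simpl; cn; auto.
      - rw K1, Emn; exact G1.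
      - rw T1, (eq_sym (pb_comm PW)), S1; reflexivity. }
    assert (RZ : eqv F EZ f j).
    { exists (q ∘ (m ∘ x)); split; [|split]; simpl; cn; auto.
      - rw K1, Emn; exact G2.
      - rw (eq_sym (pb_comm PB)); exact Ea.
      - rw T1, (eq_sym (pb_comm PW)), S2; reflexivity. }
    exists F; split.
    - pose proof (eqv_comp RY HY) as R; now rewrite comp_id_l in R.
    - pose proof (eqv_comp RZ HZ) as R; now rewrite comp_id_l in R. }
  intros T t; split.
  - intros (t' & <-); rewrite !comp_assoc; exact (cmp_pre t' Base).
  - intros (F & H1 & H2).
    destruct (eqv_lift HY H1) as (u & U1 & U2 & U3), (eqv_lift HZ H2) as (w & W1 & W2 & W3).
    destruct (pb_lift u w PB) as (h & A1 & A2); [congruence|].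
    assert (Hk : h ∘ se_k F = g).
    { apply (pullback_ext _ _ PB); [rw A1, U1, G1 | rw A2, W1, G2]; reflexivity. }
    assert (Hb : h ∘ se_b F = s ∘ t).
    { apply (pullback_ext _ _ PB); [rw A1, U3, S1 | rw A2, W3, S2]; reflexivity. }
    (* Conversely, Y is normal in the image of the semidirect product F in P, so that image, and
       with it the section of T, lies in N. *)
    destruct (image_ex h) as (I & e & i & Se & Mi & Ei).
    assert (Ek : i ∘ (e ∘ se_k F) = g) by (rw Ei; exact Hk).
    destruct (Univ I (e ∘ se_k F) i) as (t0 & [_ T0] & _); auto.
    { apply normal_mono_image; [exists T, (se_a F); apply se_ker | exact Se |].
      apply (mono_cancel i); rewrite Ek; exact Mg. }
    destruct (pb_lift t (t0 ∘ (e ∘ se_b F)) PW) as (t' & T' & _).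
    { rw T0, Ei; auto. }
    now exists t'.
Qed.

End Actions.

(** * The actor of a groupoid *)

Section DivisionKernel.
Context {C : Category} {HS : @semi_abelian C} {A : rgraph C} {R : C}
  {p1 p2 dv : Hom R (r1 A)} (D : division A p1 p2 dv).

Lemma division_sepi : sepi dv.
Proof.
  destruct (division_cover D) as (a & s & _ & _ & _ & _ & Da & _); exact (split_sepi Da).
Qed.

(** x = (x y^-1)(1 y^-1)^-1 is recovered from [z] and [y]. *)
Lemma dvd_left_inj {T} (x x' y z : Hom T (r1 A)) :
  divides p1 p2 dv x y z -> divides p1 p2 dv x' y z -> x = x'.
Proof.
  intros H H'; destruct (dvd_total D (re A ∘ (rd A ∘ y)) y) as (v & Hv).
  { rw (r_de A); reflexivity. }
  assert (E : forall w, divides p1 p2 dv w y z -> divides p1 p2 dv z v w).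
  { intros w Hw; apply (dvd_cancel D Hw Hv).
    assert (Ed : rd A ∘ y = rd A ∘ w).
    { destruct Hw as (r & E1 & E2 & _); rewrite <- E1, <- E2; rw (pb_comm (div_pb D)); reflexivity. }
    rewrite Ed; apply (dvd_unit D). }
  exact (dvd_fun D (E x H) (E x' H')).
Qed.

(** If x y^-1 is zero, then so are its codomain c x and its domain c y; hence x y^-1 = 1 = y y^-1
    and x = y. *)
Lemma division_kernel {L : C} {l : Hom L (r1 A)} {ll : Hom L R} :
  is_kernel (rc A) l -> p1 ∘ ll = l -> p2 ∘ ll = l -> is_kernel dv ll.
Proof.
  intros K E1 E2; pose proof (ker_zero K) as Z; apply ker_intro.
  - rewrite (div_self D) by congruence; rewrite E1; now apply zero_mor_l.
  - apply (mono_cancel p1); rewrite E1; exact (ker_mono K).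
  - intros T x Zx.
    assert (Z1 : is_zero_mor (rc A ∘ (p1 ∘ x))).
    { rw (eq_sym (div_cod D)); now apply zero_mor_l. }
    assert (Z2 : is_zero_mor (rc A ∘ (p2 ∘ x))).
    { rw (eq_sym (div_dom D)); now apply zero_mor_l. }
    destruct (ker_lift (p1 ∘ x) K Z1) as (h & Hh).
    assert (E : p1 ∘ x = p2 ∘ x).
    { apply (@dvd_left_inj _ _ _ (p2 ∘ x) (dv ∘ x)); [now exists x|].
      assert (Eq : dv ∘ x = re A ∘ (rc A ∘ (p2 ∘ x))).
      { apply zero_mor_eq; [exact Zx | now apply zero_mor_l]. }
      rewrite Eq; apply (dvd_self D). }
    exists h; apply (pullback_ext _ _ (div_pb D)); [rw E1 | rw E2]; congruence.
Qed.

(** Inversion carries ker c into ker d, as [h], and [zk] writes an arrow of ker c as 0 divided by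
    its inverse. This reduces statements about L to statements about K. *)
Lemma division_inverse {L K : C} {l : Hom L (r1 A)} {k : Hom K (r1 A)} :
  is_kernel (rc A) l -> is_kernel (rd A) k ->
  exists (io : Hom (r1 A) R) (h : Hom L K) (zk : Hom L R),
    p1 ∘ io = re A ∘ rd A /\ p2 ∘ io = idm _ /\ k ∘ h = dv ∘ (io ∘ l) /\
    is_zero_mor (p1 ∘ zk) /\ p2 ∘ zk = k ∘ h /\ dv ∘ zk = l.
Proof.
  intros KL KK.
  destruct (pb_lift (re A ∘ rd A) (idm _) (div_pb D)) as (io & I1 & I2); [now rw (r_de A)|].
  destruct (ker_lift (dv ∘ (io ∘ l)) KK) as (h & Hh).
  { rw (div_dom D), I2; exact (ker_zero KL). }
  destruct (@dvd_cancel C HS A R p1 p2 dv D _ l (re A ∘ (rd A ∘ l)) l (re A ∘ (rc A ∘ l))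
              (dv ∘ (io ∘ l)) l (dvd_self D l)) as (zk & Z1 & Z2 & Z3).
  { exists (io ∘ l); split; [rw I1; reflexivity|split; [rw I2|]; reflexivity]. }
  { apply (dvd_unit D). }
  exists io, h, zk; repeat (split; [congruence|]); split; [|split; congruence].
  rewrite Z1; apply zero_mor_l, (ker_zero KL).
Qed.

End DivisionKernel.

(** * Objects and arrows of the actor *)

Section Actor.
Context {C : Category} {HS : @semi_abelian C} (AC : @algebraically_coherent C)
  (HN : @has_normalizers C).
Context (X : Grpd C) {R : C} {p1 p2 dv : Hom R (g1 X)} (D : division (graph_of X) p1 p2 dv)
  {L K : C} {l : Hom L (g1 X)} {k : Hom K (g1 X)}
  (KL : is_kernel (gc X) l) (KK : is_kernel (gd X) k).
Context {B0 B1 BR BL BK : C} {H0 : SplitExt (g0 X) B0} {H1 : SplitExt (g1 X) B1}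
  {HR : SplitExt R BR} {HL : SplitExt L BL} {HK : SplitExt K BK}
  (Gen0 : generic H0) (Gen1 : generic H1) (GenR : generic HR) (GenL : generic HL)
  (GenK : generic HK).

(* Objects of the actor of [X]: actions on [X] itself, recorded by the induced actions on
   objects, arrows, pairs with a common domain, [L = ker c] and [K = ker d]. *)
Definition act0 {T : C} (a0 : Hom T B0) (a1 : Hom T B1) (aR : Hom T BR) (aL : Hom T BL)
  (aK : Hom T BK) : Prop :=
  cmp H1 H0 (gd X) a1 a0 /\ cmp H1 H0 (gc X) a1 a0 /\ cmp H0 H1 (ge X) a0 a1 /\
  cmp HR H1 p1 aR a1 /\ cmp HR H1 p2 aR a1 /\ cmp HR H1 dv aR a1 /\
  cmp HL H1 l aL a1 /\ cmp HK H1 k aK a1.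

Lemma act0_pre {S T : C} {a0 : Hom T B0} {a1 : Hom T B1} {aR : Hom T BR} {aL : Hom T BL}
  {aK : Hom T BK} (t : Hom S T) :
  act0 a0 a1 aR aL aK -> act0 (a0 ∘ t) (a1 ∘ t) (aR ∘ t) (aL ∘ t) (aK ∘ t).
Proof.
  intros (Q1 & Q2 & Q3 & Q4 & Q5 & Q6 & Q7 & Q8); repeat split; now apply cmp_pre.
Qed.

(** A subobject of the product of the five classifying objects. The components in BR, BL and BK are
    determined by the one in B1, because R, L and K map jointly monically to [g1 X]. *)
Lemma act0_universal : exists G0 (a0 : Hom G0 B0) (a1 : Hom G0 B1) (aR : Hom G0 BR)
    (aL : Hom G0 BL) (aK : Hom G0 BK),
  act0 a0 a1 aR aL aK /\
  (forall T (x y : Hom T G0), a0 ∘ x = a0 ∘ y -> a1 ∘ x = a1 ∘ y -> x = y) /\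
  (forall T (b0 : Hom T B0) b1 bR bL bK, act0 b0 b1 bR bL bK ->
     exists t, a0 ∘ t = b0 /\ a1 ∘ t = b1 /\ aR ∘ t = bR /\ aL ∘ t = bL /\ aK ∘ t = bK).
Proof.
  destruct (prod_ex B0 B1) as (W1 & x0 & x1 & J1 & U1).
  destruct (prod_ex BR BL) as (W2 & xR & xL & J2 & U2).
  destruct (prod_ex W1 W2) as (W3 & y1 & y2 & J3 & U3).
  destruct (prod_ex W3 BK) as (W & z3 & zK & J4 & U4).
  pose (w0 := x0 ∘ (y1 ∘ z3)); pose (w1 := x1 ∘ (y1 ∘ z3)).
  pose (wR := xR ∘ (y2 ∘ z3)); pose (wL := xL ∘ (y2 ∘ z3)).
  assert (J : forall T (x y : Hom T W), w0 ∘ x = w0 ∘ y -> w1 ∘ x = w1 ∘ y ->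
            wR ∘ x = wR ∘ y -> wL ∘ x = wL ∘ y -> zK ∘ x = zK ∘ y -> x = y).
  { unfold w0, w1, wR, wL; intros T x y E1 E2 E3 E4 E5.
    cn_in E1; cn_in E2; cn_in E3; cn_in E4; auto. }
  assert (U : forall T (b0 : Hom T B0) b1 bR bL bK, exists t,
            w0 ∘ t = b0 /\ w1 ∘ t = b1 /\ wR ∘ t = bR /\ wL ∘ t = bL /\ zK ∘ t = bK).
  { unfold w0, w1, wR, wL; intros T b0 b1 bR bL bK.
    destruct (U1 T b0 b1) as (t1 & E1 & E2), (U2 T bR bL) as (t2 & E3 & E4).
    destruct (U3 T t1 t2) as (t3 & E5 & E6), (U4 T t3 bK) as (t & E7 & E8).
    exists t; cn; rewrite E7, E5, E6; auto. }
  clearbody w0 w1 wR wL.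
  destruct (representable_and (cmp_representable H1 H0 (gd X) w1 w0 HN)
    (representable_and (cmp_representable H1 H0 (gc X) w1 w0 HN)
    (representable_and (cmp_representable H0 H1 (ge X) w0 w1 HN)
    (representable_and (cmp_representable HR H1 p1 wR w1 HN)
    (representable_and (cmp_representable HR H1 p2 wR w1 HN)
    (representable_and (cmp_representable HR H1 dv wR w1 HN)
    (representable_and (cmp_representable HL H1 l wL w1 HN)
      (cmp_representable HK H1 k zK w1 HN)))))))) as (G0 & j & Mj & Hj).
  assert (HA : act0 (w0 ∘ j) (w1 ∘ j) (wR ∘ j) (wL ∘ j) (zK ∘ j)).
  { apply Hj; exists (idm G0); now cn. }
  exists G0, (w0 ∘ j), (w1 ∘ j), (wR ∘ j), (wL ∘ j), (zK ∘ j); split; [exact HA|split].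
  - intros T x y E0 E1.
    pose proof (act0_pre x HA) as (_ & _ & _ & X4 & X5 & _ & X7 & X8).
    pose proof (act0_pre y HA) as (_ & _ & _ & Y4 & Y5 & _ & Y7 & Y8).
    rewrite <- E1 in Y4, Y5, Y7, Y8.
    pose proof (cmp_mono_eq GenL (ker_mono KL) X7 Y7) as EL.
    pose proof (cmp_mono_eq GenK (ker_mono KK) X8 Y8) as EK.
    assert (ER : wR ∘ j ∘ x = wR ∘ j ∘ y).
    { apply (cmp_id_eq GenR).
      apply (cmp_jointly_monic (p1 := p1) (p2 := p2)) with (2 := Y4) (3 := Y5);
        try (now rewrite comp_id_r); intros S u v; apply pullback_ext with (1 := div_pb D). }
    apply Mj, J; cn; cn_in E0; cn_in E1; cn_in EL; cn_in EK; cn_in ER; assumption.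
  - intros T b0 b1 bR bL bK HB; destruct (U T b0 b1 bR bL bK) as (t & <- & <- & <- & <- & <-).
    apply Hj in HB as (t' & <-); exists t'; now cn.
Qed.

(** Inversion is assembled from [l], units and division, all equivariant by assumption. *)
Lemma act0_inverse {T : C} {a0 : Hom T B0} {a1 aR aL aK} {io : Hom (g1 X) R} {h : Hom L K} :
  act0 a0 a1 aR aL aK -> p1 ∘ io = ge X ∘ gd X -> p2 ∘ io = idm _ -> k ∘ h = dv ∘ (io ∘ l) ->
  cmp HL HK h aL aK.
Proof.
  intros (Q1 & Q2 & Q3 & Q4 & Q5 & Q6 & Q7 & Q8) I1 I2 E.
  apply (cmp_mono (ker_mono KK) Q8); rewrite E.
  apply (@cmp_comp _ _ _ _ _ _ _ _ _ _ HR _ _ _ _ aR _); [|exact Q6].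
  apply (@cmp_comp _ _ _ _ _ _ _ _ _ _ H1 _ _ _ _ a1 _); [exact Q7|].
  apply (cmp_jointly_monic (p1 := p1) (p2 := p2)) with (2 := Q4) (3 := Q5).
  - intros S u v; apply pullback_ext with (1 := div_pb D).
  - rewrite I1; exact (cmp_comp Q1 Q3).
  - rewrite I2; apply cmp_id.
Qed.

Lemma level_dom {B : Grpd C} (E : SplitExt X B) :
  se_mor (level1 E) (level0 E) (gd X) (gd (se_A E)) (gd B).
Proof.
  split; [|split]; simpl; [apply f_d | symmetry; apply f_d | apply f_d].
Qed.

Lemma level_cod {B : Grpd C} (E : SplitExt X B) :
  se_mor (level1 E) (level0 E) (gc X) (gc (se_A E)) (gc B).
Proof.
  split; [|split]; simpl; [apply f_c | symmetry; apply f_c | apply f_c].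
Qed.

Lemma level_unit {B : Grpd C} (E : SplitExt X B) :
  se_mor (level0 E) (level1 E) (ge X) (ge (se_A E)) (ge B).
Proof.
  split; [|split]; simpl; [symmetry; apply f_e | apply f_e | symmetry; apply f_e].
Qed.

(** The division of the groupoid [se_A E] gives (b.x)(b'.y)^-1 = (b b'^-1).(x y^-1). With b' an
    identity, x = 0 and y^-1 in ker c, this says that b acts on ker c through its source; with b' =
    b, x in ker d and y = 0, that b acts on ker d through its target. *)
Lemma classify {B : Grpd C} (E : SplitExt X B) {al : Hom (g0 B) B0} {be : Hom (g1 B) B1} :
  eqv (level0 E) H0 (idm _) al -> eqv (level1 E) H1 (idm _) be ->
  exists aR aL aK, act0 al (be ∘ ge B) aR aL aK /\
    cmp H1 H0 (gd X) be (al ∘ gd B) /\ cmp H1 H0 (gc X) be (al ∘ gc B) /\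
    cmp HL H1 l (aL ∘ gd B) be /\ cmp HK H1 k (aK ∘ gc B) be.
Proof.
  intros Hal Hbe.
  pose proof (eqv_cmp (se_mor_eqv (level_dom E)) Hbe Hal) as Qd.
  pose proof (eqv_cmp (se_mor_eqv (level_cod E)) Hbe Hal) as Qc.
  pose proof (eqv_cmp (se_mor_eqv (level_unit E)) Hal Hbe) as Qe.
  pose proof (cmp_pre (ge B) Qd) as Qd0; pose proof (cmp_pre (ge B) Qc) as Qc0.
  rewrite <- comp_assoc, (g_de B), comp_id_r in Qd0.
  rewrite <- comp_assoc, (g_ce B), comp_id_r in Qc0.
  assert (JR : forall S (u v : Hom S R), p1 ∘ u = p1 ∘ v -> p2 ∘ u = p2 ∘ v -> u = v).
  { intros S u v; apply pullback_ext with (1 := div_pb D). }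
  destruct (pb_ex (gd B) (gd B)) as (RB & q1 & q2 & PB).
  destruct (groupoid_division B PB) as (dB & DB); simpl in dB.
  destruct (se_pb_ex (level_dom E) (level_dom E) (div_pb D) PB)
    as (ER & w1 & w2 & PA & W1 & W2).
  destruct (groupoid_division (se_A E) PA) as (dA & DA); simpl in dA.
  assert (Wd : se_mor ER (level1 E) dv dA dB).
  { destruct W1 as (X1 & X2 & X3), W2 as (Y1 & Y2 & Y3); split; [|split].
    - exact (gmor_division (functor_gmor (se_k E)) D DA X1 Y1).
    - exact (eq_sym (gmor_division (functor_gmor (se_a E)) DA DB (eq_sym X2) (eq_sym Y2))).
    - exact (gmor_division (functor_gmor (se_b E)) DB DA X3 Y3). }
  destruct (GenR ER) as (rho & Hrho & _).
  pose proof (eqv_cmp (se_mor_eqv W1) Hrho Hbe) as Q1.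
  pose proof (eqv_cmp (se_mor_eqv W2) Hrho Hbe) as Q2.
  pose proof (eqv_cmp (se_mor_eqv Wd) Hrho Hbe) as Q3.
  (* An object acts as its identity arrow does, and on pairs as the pair of identities does. *)
  destruct (pb_lift (ge B) (ge B) PB eq_refl) as (ee & E1 & E2).
  assert (E3 : dB ∘ ee = ge B).
  { rewrite (div_self DB); [simpl; rewrite E1; rw (g_ce B); reflexivity|].
    exact (eq_trans E1 (eq_sym E2)). }
  destruct (cmp_ker GenL KL Qc0) as (aL & QL), (cmp_ker GenK KK Qd0) as (aK & QK).
  assert (A0 : act0 al (be ∘ ge B) (rho ∘ ee) aL aK).
  { pose proof (cmp_pre ee Q1) as R1; pose proof (cmp_pre ee Q2) as R2.
    pose proof (cmp_pre ee Q3) as R3.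
    rewrite <- comp_assoc, E1 in R1; rewrite <- comp_assoc, E2 in R2.
    rewrite <- comp_assoc, E3 in R3.
    repeat (split; [assumption|]); assumption. }
  exists (rho ∘ ee), aL, aK; repeat (split; [assumption|]); split.
  - destruct (division_inverse D KL KK) as (io & h & zk & I1 & I2 & I3 & Z1 & Z2 & Z3).
    simpl in *.
    destruct (division_cover DB) as (a & s & A1 & A2 & _ & _ & Da & _); simpl in *.
    pose proof (cmp_pre a Q1) as R1; pose proof (cmp_pre a Q2) as R2.
    pose proof (cmp_pre a Q3) as R3.
    rewrite <- comp_assoc, A1, comp_id_r in R1; rewrite <- comp_assoc, A2 in R2.
    rewrite <- comp_assoc, Da, comp_id_r in R3.
    rewrite <- Z3; apply (@cmp_comp _ _ _ _ _ _ _ _ _ _ HR _ _ _ _ (rho ∘ a) _); [|exact R3].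
    apply (cmp_jointly_monic JR R1 R2); [now apply cmp_zero|]; rewrite Z2, comp_assoc.
    apply cmp_pre, (@cmp_comp _ _ _ _ _ _ _ _ _ _ HK _ _ _ _ aK _); [|exact QK].
    exact (act0_inverse A0 I1 I2 I3).
  - destruct (cmp_ker GenK KK Qd) as (ka & Hka).
    destruct (division_cover DB) as (a & s & _ & _ & S1 & S2 & _ & Ds & _); simpl in *.
    pose proof (cmp_pre s Q1) as R1; pose proof (cmp_pre s Q2) as R2.
    pose proof (cmp_pre s Q3) as R3.
    rewrite <- comp_assoc, S1, comp_id_r in R1; rewrite <- comp_assoc, S2, comp_id_r in R2.
    rewrite <- comp_assoc, Ds in R3.
    destruct (zero_mor_ex K (g1 X)) as [o O].
    destruct (pb_lift k o (div_pb D)) as (k0 & K1 & K2).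
    { apply zero_mor_eq; [exact (ker_zero KK) | now apply zero_mor_l]. }
    simpl in *.
    assert (Ek : dv ∘ k0 = k).
    { rewrite (div_unit D); [exact K1|]; simpl in *; rewrite K1, K2; apply zero_mor_eq; [exact O|].
      apply zero_mor_l, (ker_zero KK). }
    assert (Q : cmp HK H1 k ka (be ∘ (ge B ∘ gc B))).
    { rewrite <- Ek; apply (@cmp_comp _ _ _ _ _ _ _ _ _ _ HR _ _ _ _ (rho ∘ s) _); [|exact R3].
      apply (cmp_jointly_monic JR R1 R2); [now rewrite K1 | rewrite K2; now apply cmp_zero]. }
    pose proof (cmp_pre (gc B) QK) as QK'; rewrite <- comp_assoc in QK'.
    now rewrite <- (cmp_mono_eq GenK (ker_mono KK) Q QK').
Qed.

Context {G0 : C} {a0 : Hom G0 B0} {a1 : Hom G0 B1} {aR : Hom G0 BR} {aL : Hom G0 BL}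
  {aK : Hom G0 BK} (HA : act0 a0 a1 aR aL aK).

(* Arrows [g -> g'] of the actor: in a split extension of groupoids an arrow acts on
   [L = ker c] through its source and on [K = ker d] through its target. *)
Definition act1 {T : C} (b : Hom T B1) (g g' : Hom T G0) : Prop :=
  cmp H1 H0 (gd X) b (a0 ∘ g) /\ cmp H1 H0 (gc X) b (a0 ∘ g') /\
  cmp HL H1 l (aL ∘ g) b /\ cmp HK H1 k (aK ∘ g') b.

Lemma act1_pre {S T : C} {b : Hom T B1} {g g' : Hom T G0} (t : Hom S T) :
  act1 b g g' -> act1 (b ∘ t) (g ∘ t) (g' ∘ t).
Proof.
  intros (Q1 & Q2 & Q3 & Q4); repeat split; rewrite comp_assoc; now apply cmp_pre.
Qed.

Lemma act1_universal : exists G1 (b : Hom G1 B1) (d c : Hom G1 G0),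
  act1 b d c /\
  (forall T (x y : Hom T G1), b ∘ x = b ∘ y -> d ∘ x = d ∘ y -> c ∘ x = c ∘ y -> x = y) /\
  (forall T (x : Hom T B1) g g', act1 x g g' ->
     exists t, b ∘ t = x /\ d ∘ t = g /\ c ∘ t = g').
Proof.
  destruct (prod_ex G0 G0) as (W1 & x0 & x1 & J1 & U1).
  destruct (prod_ex B1 W1) as (W & w & y & J2 & U2).
  pose (d := x0 ∘ y); pose (c := x1 ∘ y).
  destruct (representable_and (cmp_representable H1 H0 (gd X) w (a0 ∘ d) HN)
    (representable_and (cmp_representable H1 H0 (gc X) w (a0 ∘ c) HN)
    (representable_and (cmp_representable HL H1 l (aL ∘ d) w HN)
      (cmp_representable HK H1 k (aK ∘ c) w HN)))) as (G1 & j & Mj & Hj).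
  exists G1, (w ∘ j), (d ∘ j), (c ∘ j); split; [|split].
  - unfold act1; rewrite !(comp_assoc j); apply Hj; exists (idm G1); now cn.
  - unfold d, c; intros T u v E1 E2 E3; cn_in E1; cn_in E2; cn_in E3; apply Mj, J2; auto.
  - intros T x g g' HB; destruct (U1 T g g') as (t1 & <- & <-), (U2 T x t1) as (t & <- & <-).
    destruct (proj2 (Hj T t)) as (t' & <-).
    { unfold act1 in HB; cn_in HB; unfold d, c; cn; exact HB. }
    exists t'; unfold d, c; now cn.
Qed.

(** Arrows with the same source agree on L, so the action [r] of the pair preserves the diagonal of
    L, which is the kernel of [dv], and descends along [dv]. *)
Lemma act1_divide {T : C} {b b' : Hom T B1} {g g1' g2' : Hom T G0} :
  act1 b g g1' -> act1 b' g g2' ->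
  exists (r : Hom T BR) (b'' : Hom T B1),
    cmp HR H1 p1 r b /\ cmp HR H1 p2 r b' /\ cmp HR H1 dv r b'' /\ act1 b'' g2' g1'.
Proof.
  intros (P1 & P2 & P3 & P4) (Q1 & Q2 & Q3 & Q4).
  assert (JR : forall S (u v : Hom S R), p1 ∘ u = p1 ∘ v -> p2 ∘ u = p2 ∘ v -> u = v).
  { intros S u v; apply pullback_ext with (1 := div_pb D). }
  (* Through [gd X] both arrows induce on objects the action of their common source. *)
  destruct (cmp_pb GenR (div_pb D) P1 Q1) as (r & R1 & R2).
  destruct (pb_lift l l (div_pb D) eq_refl) as (ll & L1 & L2).
  assert (Rll : cmp HL HR ll (aL ∘ g) r).
  { apply (cmp_jointly_monic JR R1 R2); [rewrite L1 | rewrite L2]; assumption. }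
  assert (Sd : sepi dv) by exact (division_sepi D).
  assert (Kd : is_kernel dv ll) by exact (division_kernel D KL L1 L2).
  destruct (cmp_quotient HN Gen1 Sd Kd Rll) as (b'' & Rd).
  exists r, b''; repeat (split; [assumption|]); split; [|split; [|split]].
  - apply (cmp_epi Sd Rd).
    pose proof (div_dom D) as E; simpl in E; rewrite E; exact (cmp_comp R2 Q2).
  - apply (cmp_epi Sd Rd).
    pose proof (div_cod D) as E; simpl in E; rewrite E; exact (cmp_comp R1 P2).
  (* An element of L is 0 divided by an element of K, on which the second arrow acts through its
     target, the source of the quotient. *)
  - destruct (division_inverse D KL KK) as (io & h & zk & I1 & I2 & I3 & Z1 & Z2 & Z3).
    simpl in *; rewrite <- Z3.
    apply (@cmp_comp _ _ _ _ _ _ _ _ _ _ HR _ _ _ _ r _); [|exact Rd].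
    apply (cmp_jointly_monic JR R1 R2); [now apply cmp_zero|].
    rewrite Z2; apply (@cmp_comp _ _ _ _ _ _ _ _ _ _ HK _ _ _ _ (aK ∘ g2') _); [|exact Q4].
    exact (act0_inverse (act0_pre g2' HA) I1 I2 I3).
  (* An element of K is itself divided by 0, and the first arrow acts on it through the target of
     the quotient. *)
  - destruct (zero_mor_ex K (g1 X)) as [o O].
    destruct (pb_lift k o (div_pb D)) as (k0 & K1 & K2).
    { apply zero_mor_eq; [exact (ker_zero KK) | now apply zero_mor_l]. }
    assert (E : dv ∘ k0 = k).
    { rewrite (div_unit D); [exact K1|]; simpl in *; rewrite K1, K2; apply zero_mor_eq; [exact O|].
      apply zero_mor_l, (ker_zero KK). }
    rewrite <- E; apply (@cmp_comp _ _ _ _ _ _ _ _ _ _ HR _ _ _ _ r _); [|exact Rd].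
    apply (cmp_jointly_monic JR R1 R2); [now rewrite K1 | rewrite K2; now apply cmp_zero].
Qed.

(** In X one has x = x 1^-1, and x |-> (x, 1) is equivariant from [b] to [r]. *)
Lemma act1_unit {T : C} {b b'' : Hom T B1} {g : Hom T G0} {r : Hom T BR} :
  cmp H1 H0 (gd X) b (a0 ∘ g) -> cmp HR H1 p1 r b -> cmp HR H1 p2 r (a1 ∘ g) ->
  cmp HR H1 dv r b'' -> b'' = b.
Proof.
  intros P R1 R2 Rd.
  destruct (division_cover D) as (a & s & A1 & A2 & _ & _ & Da & _); simpl in *.
  symmetry; apply (cmp_id_eq Gen1); rewrite <- Da.
  apply (@cmp_comp _ _ _ _ _ _ _ _ _ _ HR _ _ _ _ r _); [|exact Rd].
  apply (cmp_jointly_monic (p1 := p1) (p2 := p2)) with (2 := R1) (3 := R2).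
  - intros S u v; apply pullback_ext with (1 := div_pb D).
  - rewrite A1; apply cmp_id.
  - rewrite A2; pose proof (act0_pre g HA) as (_ & _ & Q & _); exact (cmp_comp P Q).
Qed.

Lemma act1_self {T : C} {b b'' : Hom T B1} {g g' : Hom T G0} {r : Hom T BR} :
  act1 b g g' -> act1 b'' g' g' ->
  cmp HR H1 p1 r b -> cmp HR H1 p2 r b -> cmp HR H1 dv r b'' -> b'' = a1 ∘ g'.
Proof.
  intros (_ & P & _) (_ & _ & _ & Q) R1 R2 Rd.
  destruct (division_cover D) as (a & s & _ & _ & S1 & S2 & _ & Ds & _); simpl in *.
  assert (Rs : cmp H1 HR s b r).
  { apply (cmp_jointly_monic (p1 := p1) (p2 := p2)) with (2 := R1) (3 := R2).
    - intros S u v; apply pullback_ext with (1 := div_pb D).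
    - rewrite S1; apply cmp_id.
    - rewrite S2; apply cmp_id. }
  (* From x x^-1 = 1 and the surjectivity of [gc X] one reads off the action of [b''] on
     identities. *)
  assert (Re : cmp H0 H1 (ge X) (a0 ∘ g') b'').
  { apply (cmp_epi (split_sepi (g_ce X)) P); rewrite <- Ds; exact (cmp_comp Rs Rd). }
  pose proof (act0_pre g' HA) as (_ & _ & Q3 & _ & _ & _ & _ & Q8).
  exact (cmp_cover_eq AC Gen1 (ker_mono KK) (split_mono (g_de X))
           (point_cover (g_de X) KK) Q Re Q8 Q3).
Qed.

End Actor.

(** * Assembly of the generic split extension *)

Section GroupoidActor.
Context {C : Category} {HS : @semi_abelian C}.

Lemma se_mor_pb {Y Y1 Y2 P B B1 B2 Q : C} {E : SplitExt Y B} {E1 : SplitExt Y1 B1}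
  {E2 : SplitExt Y2 B2} {ER : SplitExt P Q} {p1 : Hom P Y1} {w1 : Hom (se_A ER) (se_A E1)}
  {q1 : Hom Q B1} {p2 : Hom P Y2} {w2 : Hom (se_A ER) (se_A E2)} {q2 : Hom Q B2}
  {h : Hom Y P} {u : Hom (se_A E) (se_A ER)} {t : Hom B Q} :
  (forall T (x y : Hom T (se_A ER)), w1 ∘ x = w1 ∘ y -> w2 ∘ x = w2 ∘ y -> x = y) ->
  (forall T (x y : Hom T Q), q1 ∘ x = q1 ∘ y -> q2 ∘ x = q2 ∘ y -> x = y) ->
  se_mor ER E1 p1 w1 q1 -> se_mor ER E2 p2 w2 q2 ->
  se_mor E E1 (p1 ∘ h) (w1 ∘ u) (q1 ∘ t) -> se_mor E E2 (p2 ∘ h) (w2 ∘ u) (q2 ∘ t) ->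
  se_mor E ER h u t.
Proof.
  intros JW JQ (X1 & X2 & X3) (Y1' & Y2' & Y3) (U1 & U2 & U3) (V1 & V2 & V3).
  cn_in U1; cn_in U2; cn_in U3; cn_in V1; cn_in V2; cn_in V3.
  split; [|split].
  - apply JW; [rw X1 | rw Y1']; assumption.
  - apply JQ; [rw (eq_sym X2); exact U2 | rw (eq_sym Y2'); exact V2].
  - apply JW; [rw X3 | rw Y3]; assumption.
Qed.

(** The generic split extension expressed through graphs and components, so that divisible graphs
    can afterwards be replaced by groupoids. *)
Definition generic_levels (X : Grpd C) (GB GA : rgraph C) : Prop :=
  exists k0 k1 a0 a1 b0 b1,
    gmor (graph_of X) GA k0 k1 /\ gmor GA GB a0 a1 /\ gmor GB GA b0 b1 /\
    a0 ∘ b0 = idm _ /\ a1 ∘ b1 = idm _ /\ is_kernel a0 k0 /\ is_kernel a1 k1 /\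
    forall (B : Grpd C) (E : SplitExt X B), exists u0 u1 v0 v1,
      gmor (graph_of (se_A E)) GA u0 u1 /\ gmor (graph_of B) GB v0 v1 /\
      (u0 ∘ f0 (se_k E) = k0 /\ a0 ∘ u0 = v0 ∘ f0 (se_a E) /\ u0 ∘ f0 (se_b E) = b0 ∘ v0) /\
      (u1 ∘ f1 (se_k E) = k1 /\ a1 ∘ u1 = v1 ∘ f1 (se_a E) /\ u1 ∘ f1 (se_b E) = b1 ∘ v1) /\
      forall u0' u1' v0' v1', gmor (graph_of B) GB v0' v1' ->
        (u0' ∘ f0 (se_k E) = k0 /\ a0 ∘ u0' = v0' ∘ f0 (se_a E) /\
         u0' ∘ f0 (se_b E) = b0 ∘ v0') ->
        (u1' ∘ f1 (se_k E) = k1 /\ a1 ∘ u1' = v1' ∘ f1 (se_a E) /\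
         u1' ∘ f1 (se_b E) = b1 ∘ v1') ->
        u0' = u0 /\ u1' = u1 /\ v0' = v0 /\ v1' = v1.

Lemma generic_levels_ex (X : Grpd C) :
  @action_representable C -> @algebraically_coherent C -> @has_normalizers C ->
  exists GB GA, divisible GB /\ divisible GA /\ generic_levels X GB GA.
Proof.
  intros AR AC HN.
  destruct (pb_ex (gd X) (gd X)) as (R & p1 & p2 & PX).
  destruct (groupoid_division X PX) as (dv & D); simpl in dv.
  destruct (ker_ex (gc X)) as (L & l & KL), (ker_ex (gd X)) as (K & k & KK).
  destruct (generic_ex AR (g0 X)) as (B0 & H0 & Gen0), (generic_ex AR (g1 X)) as (B1 & H1 & Gen1).
  destruct (generic_ex AR R) as (BR & HR & GenR), (generic_ex AR L) as (BL & HL & GenL).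
  destruct (generic_ex AR K) as (BK & HK & GenK).
  destruct (act0_universal HN D KL KK (H0 := H0) (H1 := H1) GenR GenL GenK)
    as (G0 & a0 & a1 & aR & aL & aK & HA & JG0 & UG0).
  destruct (act1_universal (l := l) (k := k) (H0 := H0) (H1 := H1) (HL := HL) (HK := HK)
              (a0 := a0) (aL := aL) (aK := aK) HN X) as (G1 & b & d & c & HB & JG1 & UG1).
  (* The identity on an action of the groupoid X is the action it induces on arrows. *)
  destruct (UG1 G0 a1 (idm _) (idm _)) as (e & Eb & DE & CE).
  { destruct HA as (Q1 & Q2 & Q3 & Q4 & Q5 & Q6 & Q7 & Q8); split; [|split; [|split]]; now cn. }
  pose (GB := Build_rgraph d c e DE CE).
  destruct (pb_ex d d) as (RG & q1 & q2 & PG).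
  pose proof (act1_pre q1 HB) as HB1; pose proof (act1_pre q2 HB) as HB2.
  rewrite <- (pb_comm PG) in HB2.
  destruct (act1_divide HN D KL KK Gen1 GenR HA HB1 HB2) as (r & b'' & R1 & R2 & R3 & HB'').
  destruct (UG1 _ _ _ _ HB'') as (dG & DG1 & DG2 & DG3).
  destruct (cospan_cover GB PG) as (aG & sG & AG1 & AG2 & SG1 & SG2 & _); simpl in *.
  assert (LawA : dG ∘ aG = idm G1).
  { apply JG1; cn.
    - rw DG1; pose proof (cmp_pre aG R1) as Q1; pose proof (cmp_pre aG R2) as Q2.
      pose proof (cmp_pre aG R3) as Q3.
      rewrite <- comp_assoc, AG1, comp_id_r in Q1.
      rewrite <- comp_assoc, AG2, comp_assoc, Eb in Q2.
      exact (act1_unit D Gen1 HA (proj1 HB) Q1 Q2 Q3).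
    - rw DG2, AG2, CE; reflexivity.
    - rw DG3, AG1; reflexivity. }
  assert (LawS : dG ∘ sG = e ∘ c).
  { apply JG1; cn.
    - rw DG1; pose proof (cmp_pre sG R1) as Q1; pose proof (cmp_pre sG R2) as Q2.
      pose proof (cmp_pre sG R3) as Q3; pose proof (act1_pre sG HB'') as Q4.
      rewrite <- comp_assoc, SG1, comp_id_r in Q1; rewrite <- comp_assoc, SG2, comp_id_r in Q2.
      rewrite <- !comp_assoc, SG1, SG2, !comp_id_r in Q4.
      rw Eb; exact (act1_self AC D KK Gen1 HA HB Q4 Q1 Q2 Q3).
    - rw DG2, SG2, DE; reflexivity.
    - rw DG3, SG1, CE; reflexivity. }
  assert (DivB : divisible GB).
  { exists RG, q1, q2, dG; exact (division_intro GB PG AG1 AG2 SG1 SG2 LawA LawS). }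
  (* The total graph has as levels the semidirect products for [a0] and [b]; equivariance of the
     structure maps of X induces its own. *)
  destruct (eqv_pb_ex H0 a0) as (E0 & HE0), (eqv_pb_ex H1 b) as (E1 & HE1).
  destruct HB as (Bd & Bc & Bl & Bk).
  destruct (cmp_eqv Bd HE1 HE0) as (dA & Sd), (cmp_eqv Bc HE1 HE0) as (cA & Sc).
  assert (Be : cmp H0 H1 (ge X) a0 (b ∘ e)) by (rewrite Eb; apply HA).
  destruct (cmp_eqv Be HE0 HE1) as (eA & Se).
  assert (DEA : dA ∘ eA = idm _).
  { pose proof (se_mor_comp Se Sd) as Q; rewrite DE, (g_de X) in Q.
    exact (se_mor_unique Q (se_mor_id E0)). }
  assert (CEA : cA ∘ eA = idm _).
  { pose proof (se_mor_comp Se Sc) as Q; rewrite CE, (g_ce X) in Q.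
    exact (se_mor_unique Q (se_mor_id E0)). }
  pose (GA := Build_rgraph dA cA eA DEA CEA).
  destruct (se_pb_ex Sd Sd PX PG) as (ER & w1 & w2 & PA & W1 & W2).
  destruct (GenR _ ER) as (rho & Hrho & _).
  (* The object of pairs of the total graph is the semidirect product of R for [r], since an action
     on R is determined by its two projections. *)
  assert (rho = r) as ->.
  { apply (cmp_id_eq GenR).
    apply (cmp_jointly_monic (p1 := p1) (p2 := p2)) with (2 := R1) (3 := R2).
    - intros S u v; apply pullback_ext with (1 := PX).
    - rewrite comp_id_r; exact (eqv_cmp (se_mor_eqv W1) Hrho HE1).
    - rewrite comp_id_r; exact (eqv_cmp (se_mor_eqv W2) Hrho HE1). }
  rewrite <- DG1 in R3; destruct (cmp_eqv R3 Hrho HE1) as (dvA & Sdv).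
  destruct (cospan_cover GA PA) as (aA & sA & AA1 & AA2 & SA1 & SA2 & _); simpl in *.
  destruct (division_cover D) as (aX & sX & AX1 & AX2 & SX1 & SX2 & DaX & DsX & _); simpl in *.
  assert (JW : forall T (x y : Hom T (se_A ER)), w1 ∘ x = w1 ∘ y -> w2 ∘ x = w2 ∘ y -> x = y).
  { intros T x y; exact (pullback_ext _ _ PA). }
  assert (JQ : forall T (x y : Hom T RG), q1 ∘ x = q1 ∘ y -> q2 ∘ x = q2 ∘ y -> x = y).
  { intros T x y; exact (pullback_ext _ _ PG). }
  assert (SaA : se_mor E1 ER aX aA aG).
  { apply (se_mor_pb JW JQ W1 W2).
    - rewrite AX1, AA1, AG1; apply se_mor_id.
    - rewrite AX2, AA2, AG2; exact (se_mor_comp Sd Se). }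
  assert (SsA : se_mor E1 ER sX sA sG).
  { apply (se_mor_pb JW JQ W1 W2).
    - rewrite SX1, SA1, SG1; apply se_mor_id.
    - rewrite SX2, SA2, SG2; apply se_mor_id. }
  (* The laws hold for the total graph because a morphism of split extensions is determined by its
     kernel and base components. *)
  assert (LawAA : dvA ∘ aA = idm _).
  { pose proof (se_mor_comp SaA Sdv) as Q; rewrite DaX, LawA in Q.
    exact (se_mor_unique Q (se_mor_id E1)). }
  assert (LawSA : dvA ∘ sA = eA ∘ cA).
  { pose proof (se_mor_comp SsA Sdv) as Q; rewrite DsX, LawS in Q.
    exact (se_mor_unique Q (se_mor_comp Sc Se)). }
  assert (DivA : divisible GA).
  { exists (se_A ER), w1, w2, dvA; exact (division_intro GA PA AA1 AA2 SA1 SA2 LawAA LawSA). }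
  exists GB, GA; split; [exact DivB|split; [exact DivA|]].
  exists (se_k E0), (se_k E1), (se_a E0), (se_a E1), (se_b E0), (se_b E1).
  pose proof Sd as (Sd1 & Sd2 & Sd3); pose proof Sc as (Sc1 & Sc2 & Sc3).
  pose proof Se as (Se1 & Se2 & Se3).
  split; [split; [|split]; simpl; auto|]; split; [split; [|split]; simpl; auto|].
  split; [split; [|split]; simpl; auto|].
  split; [apply se_ab|]; split; [apply se_ab|]; split; [apply se_ker|]; split; [apply se_ker|].
  intros B E.
  destruct (Gen0 _ (level0 E)) as (al & Hal & Ual), (Gen1 _ (level1 E)) as (be & Hbe & Ube).
  destruct (classify D KL KK GenR GenL GenK Hal Hbe)
    as (bR & bL & bK & Act0 & Cd & Cc & Cl & Ck).
  destruct (UG0 _ _ _ _ _ _ Act0) as (v0 & V0 & V1 & VR & VL & VK).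
  destruct (UG1 _ be (v0 ∘ gd B) (v0 ∘ gc B)) as (v1 & Vb & Vd & Vc).
  { split; [|split; [|split]]; rewrite comp_assoc.
    - now rewrite V0.
    - now rewrite V0.
    - now rewrite VL.
    - now rewrite VK. }
  assert (Ve : v1 ∘ ge B = e ∘ v0).
  { apply JG1.
    - rw Vb, Eb, V1; reflexivity.
    - rw Vd, DE, (g_de B); reflexivity.
    - rw Vc, CE, (g_ce B); reflexivity. }
  rewrite <- V0 in Hal; rewrite <- Vb in Hbe.
  destruct (eqv_lift HE0 Hal) as (u0 & U0), (eqv_lift HE1 Hbe) as (u1 & U1).
  exists u0, u1, v0, v1; split; [|split; [|split; [|split]]].
  - split; [|split]; simpl.
    + pose proof (se_mor_comp U1 Sd) as Q1; pose proof (se_mor_comp (level_dom E) U0) as Q2.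
      rewrite Vd, comp_id_r in Q1; rewrite comp_id_l in Q2; exact (se_mor_unique Q1 Q2).
    + pose proof (se_mor_comp U1 Sc) as Q1; pose proof (se_mor_comp (level_cod E) U0) as Q2.
      rewrite Vc, comp_id_r in Q1; rewrite comp_id_l in Q2; exact (se_mor_unique Q1 Q2).
    + pose proof (se_mor_comp U0 Se) as Q1; pose proof (se_mor_comp (level_unit E) U1) as Q2.
      rewrite Ve, comp_id_l in Q2; rewrite comp_id_r in Q1; exact (se_mor_unique Q2 Q1).
  - split; [|split]; simpl; auto.
  - destruct U0 as (X1 & X2 & X3); simpl in *; cn_in X1; auto.
  - destruct U1 as (X1 & X2 & X3); simpl in *; cn_in X1; auto.
  - intros u0' u1' v0' v1' (Md & Mc & Me) M0 M1; simpl in *.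
    assert (T0 : se_mor (level0 E) E0 (idm _) u0' v0').
    { destruct M0 as (X1 & X2 & X3); split; [|split]; simpl; cn; auto. }
    assert (T1 : se_mor (level1 E) E1 (idm _) u1' v1').
    { destruct M1 as (X1 & X2 & X3); split; [|split]; simpl; cn; auto. }
    pose proof (eqv_comp (se_mor_eqv T0) HE0) as Q0; rewrite comp_id_l in Q0.
    pose proof (eqv_comp (se_mor_eqv T1) HE1) as Q1; rewrite comp_id_l in Q1.
    apply Ual in Q0; apply Ube in Q1.
    (* By [JG0] the action on arrows must agree too; it is that of the identity arrows under
       [v1']. *)
    assert (v0' = v0) as ->.
    { apply JG0; [congruence|]; rewrite V1, <- Eb; rw (eq_sym Me), Q1; reflexivity. }
    assert (v1' = v1) as ->.
    { apply JG1; congruence. }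
    split; [exact (se_mor_unique T0 U0)|split; [exact (se_mor_unique T1 U1)|now split]].
Qed.

Lemma grpd_action_representable :
  @action_representable C -> @algebraically_coherent C -> @has_normalizers C ->
  @action_representable (Grpd C).
Proof.
  intros AR AC HN X.
  destruct (generic_levels_ex X AR AC HN) as (GB & GA & DB & DA & H).
  destruct (divisible_groupoid DB) as (B & <-), (divisible_groupoid DA) as (A & <-).
  destruct H as (k0 & k1 & a0 & a1 & b0 & b1 & Hk & Ha & Hb & AB0 & AB1 & K0 & K1 & U).
  destruct (functor_ex Hk) as (k & <- & <-), (functor_ex Ha) as (a & <- & <-).
  destruct (functor_ex Hb) as (b & <- & <-).
  assert (AB : a ∘ b = @idm (Grpd C) B) by (apply grpd_eq; [exact AB0 | exact AB1]).
  exists (B : Grpd C), (Build_SplitExt k a b AB (level_ker K0 K1)); intros B' E.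
  destruct (U B' E) as (u0 & u1 & v0 & v1 & Hu & Hv & (X1 & X2 & X3) & (Y1 & Y2 & Y3) & V).
  destruct (functor_ex Hu) as (u & <- & <-), (functor_ex Hv) as (v & <- & <-).
  exists u, v; split.
  - split; [|split]; simpl; apply grpd_eq; simpl; cn; assumption.
  - intros u' v' (M1 & M2 & M3); simpl in *.
    pose proof (lv0 M1) as M10; pose proof (lv1 M1) as M11; simpl in M10, M11.
    rewrite comp_id_r in M10; rewrite comp_id_r in M11.
    destruct (V (f0 u') (f1 u') (f0 v') (f1 v') (functor_gmor v')) as (T1 & T2 & T3 & T4).
    + split; [exact M10|split; [exact (lv0 M2) | exact (lv0 M3)]].
    + split; [exact M11|split; [exact (lv1 M2) | exact (lv1 M3)]].
    + split; apply grpd_eq; assumption.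
Qed.

End GroupoidActor.

(** * Discrete groupoids *)

Section Discrete.
Context {C : Category}.

Definition disc (a : C) : Grpd C.
Proof.
  refine (@Build_IGrpd C a a (idm a) (idm a) (idm a) (idm a) a (idm a) (idm a) (idm a)
            _ _ _ _ _ _ _ _ _ _ _ _); try (cn; reflexivity).
  - apply pb_intro; [reflexivity| |].
    + intros T x y E _; now rewrite !comp_id_l in E.
    + intros T x y E; rewrite !comp_id_l in E; exists x; now cn.
  - intros T f x _ E; exact E.
  - intros T f x E _; exact E.
  - intros T x y x' y'; cn; congruence.
  - intros T f x _ E; cn; now cn_in E.
  - intros T f x E _; cn; now cn_in E.
Defined.

(** The transpose under the adjunction between [disc] and the object functor: arrows go to
    identities. *)
Definition tr {a : C} {G : Grpd C} (f : Hom a (g0 G)) : Hom (disc a) G.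
Proof.
  refine (@Build_IFun C (disc a) G f (ge G ∘ f) _ _ _ _); simpl; cn.
  - rw (g_de G); reflexivity.
  - rw (g_ce G); reflexivity.
  - reflexivity.
  - intros h E1 E2; symmetry; apply g_unit_l; [|exact E2].
    rw E1, (g_ce G); reflexivity.
Defined.

Definition dmap {a b : C} (f : Hom a b) : Hom (disc a) (disc b) := @tr a (disc b) f.

Lemma from_disc_eq {a : C} {G : Grpd C} {F F' : Hom (disc a) G} : f0 F = f0 F' -> F = F'.
Proof.
  intros E; apply IFun_eq; [exact E|].
  pose proof (f_e F) as X; pose proof (f_e F') as Y; simpl in *.
  rewrite comp_id_r in X, Y; congruence.
Qed.

Lemma to_disc_level {a : C} {G : Grpd C} (F : Hom G (disc a)) :
  f1 F = f0 F ∘ gd G /\ f0 F ∘ gd G = f0 F ∘ gc G.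
Proof.
  pose proof (f_d F) as X; pose proof (f_c F) as Y; simpl in *.
  rewrite comp_id_l in X, Y; split; congruence.
Qed.

Lemma to_disc_eq {a : C} {G : Grpd C} {F F' : Hom G (disc a)} : f0 F = f0 F' -> F = F'.
Proof.
  intros E; apply IFun_eq; [exact E|].
  now rewrite (proj1 (to_disc_level F)), (proj1 (to_disc_level F')), E.
Qed.

(** A functor to a discrete groupoid sends arrows to identities, so it amounts to a map that is
    constant on connected components. *)
Lemma to_disc {a : C} {G : Grpd C} (f : Hom (g0 G) a) :
  f ∘ gd G = f ∘ gc G -> exists F : Hom G (disc a), f0 F = f.
Proof.
  intros E.
  unshelve eexists (@Build_IFun C G (disc a) f (f ∘ gd G) _ _ _ _); simpl; cn.
  - reflexivity.
  - exact E.
  - rw (g_de G); reflexivity.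
  - intros h _ E2; rw (g_dm G); symmetry; now cn_in E2.
  - reflexivity.
Qed.

Lemma iso_disc {a b : C} {f : Hom a b} : iso f -> iso (dmap f).
Proof. intros (g & X & Y); exists (dmap g); split; apply to_disc_eq; assumption. Qed.

Lemma disc_iso {a b : C} {f : Hom a b} : iso (dmap f) -> iso f.
Proof. intros (g & X & Y); exists (f0 g); split; [exact (lv0 X) | exact (lv0 Y)]. Qed.

Lemma mono_g0 {G H : Grpd C} {F : Hom G H} : mono F -> mono (f0 F).
Proof.
  intros M T x y E; assert (K : tr x = tr y).
  { apply M, from_disc_eq; exact E. }
  exact (lv0 K).
Qed.

Lemma disc_mono {a b : C} {f : Hom a b} : mono f -> mono (dmap f).
Proof. intros M T x y E; apply to_disc_eq, M; exact (lv0 E). Qed.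

(** As a right adjoint, the object functor preserves terminal objects. For initiality, the functor
    from Z to the discrete groupoid on its objects is the identity on objects, because [g0 Z] is
    terminal. *)
Lemma zero_g0 {Z : Grpd C} : is_zero_obj Z -> is_zero_obj (g0 Z).
Proof.
  intros [I T].
  assert (T0 : is_terminal (g0 Z)).
  { intros a; destruct (T (disc a)) as [f Hf]; exists (f0 f); intros g.
    exact (lv0 (Hf (tr g))). }
  split; [|exact T0]; intros a; destruct (I (disc a)) as [f Hf]; exists (f0 f); intros g.
  destruct (I (disc (g0 Z))) as [s _].
  pose proof (lv0 (Hf (dmap g ∘ s))) as E; simpl in E.
  rewrite (terminal_eq (f0 s) (idm _) T0), comp_id_r in E; exact E.
Qed.

Lemma disc_zero {z : C} : is_zero_obj z -> is_zero_obj (disc z).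
Proof.
  intros [I T]; split.
  - intros G; destruct (I (g0 G)) as [f Hf]; exists (tr f); intros g; apply from_disc_eq, Hf.
  - intros G; destruct (T (g0 G)) as [f Hf].
    destruct (@to_disc z G f) as (F & E); [apply (terminal_eq _ _ T)|].
    exists F; intros F'; apply to_disc_eq, (terminal_eq _ _ T).
Qed.

Lemma zero_mor_g0 {G H : Grpd C} {F : Hom G H} : is_zero_mor F -> is_zero_mor (f0 F).
Proof.
  intros (Z & u & v & HZ & ->); exists (g0 Z), (f0 u), (f0 v); split; [exact (zero_g0 HZ)|].
  reflexivity.
Qed.

Lemma zero_mor_tr {a : C} {G : Grpd C} {f : Hom a (g0 G)} : is_zero_mor f -> is_zero_mor (tr f).
Proof.
  intros (z & u & v & Z & ->); exists (disc z), (dmap u), (tr v); split; [exact (disc_zero Z)|].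
  now apply from_disc_eq.
Qed.

Lemma ker_g0 {X A B : Grpd C} {F : Hom A B} {k : Hom X A} :
  is_kernel F k -> is_kernel (f0 F) (f0 k).
Proof.
  intros K; apply ker_intro.
  - exact (zero_mor_g0 (ker_zero K)).
  - exact (mono_g0 (ker_mono K)).
  - intros T g Zg; destruct (ker_lift (tr g) K) as (h & Hh).
    + apply zero_mor_tr in Zg; replace (F ∘ tr g) with (tr (f0 F ∘ g)); [exact Zg|].
      now apply from_disc_eq.
    + exists (f0 h); exact (lv0 Hh).
Qed.

Lemma disc_ker {x a b : C} {f : Hom a b} {k : Hom x a} :
  is_kernel f k -> is_kernel (dmap f) (dmap k).
Proof.
  intros K; pose proof (ker_mono K) as M; apply ker_intro.
  - replace (dmap f ∘ dmap k) with (dmap (f ∘ k)); [|now apply to_disc_eq].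
    apply zero_mor_tr, (ker_zero K).
  - exact (disc_mono M).
  - intros T g Zg; destruct (ker_lift (f0 g) K (zero_mor_g0 Zg)) as (h0 & E0).
    destruct (@to_disc x T h0) as (h & Hh).
    + apply M; simpl in *; rewrite !comp_assoc, E0; exact (proj2 (to_disc_level g)).
    + exists h; apply to_disc_eq; simpl; rewrite Hh; exact E0.
Qed.

Lemma pb_g0 {A B K P : Grpd C} {F : Hom A K} {G : Hom B K} {p : Hom P A} {q : Hom P B} :
  is_pullback F G p q -> is_pullback (f0 F) (f0 G) (f0 p) (f0 q).
Proof.
  intros H; apply pb_intro.
  - exact (lv0 (pb_comm H)).
  - intros T x y X Y; assert (E : tr x = tr y).
    { apply (pullback_ext _ _ H); apply from_disc_eq; assumption. }
    exact (lv0 E).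
  - intros T x y E; destruct (pb_lift (tr x) (tr y) H) as (h & X & Y).
    { now apply from_disc_eq. }
    exists (f0 h); split; [exact (lv0 X) | exact (lv0 Y)].
Qed.

Lemma disc_pb {a b c P : C} {f : Hom a c} {g : Hom b c} {p : Hom P a} {q : Hom P b} :
  is_pullback f g p q -> is_pullback (dmap f) (dmap g) (dmap p) (dmap q).
Proof.
  intros H; apply pb_intro.
  - apply to_disc_eq; exact (pb_comm H).
  - intros T x y X Y; apply to_disc_eq, (pullback_ext _ _ H); [exact (lv0 X) | exact (lv0 Y)].
  - intros T x y E; destruct (pb_lift (f0 x) (f0 y) H (lv0 E)) as (h0 & X & Y).
    destruct (@to_disc P T h0) as (h & Hh).
    + apply (pullback_ext _ _ H); simpl in *; rewrite !comp_assoc, ?X, ?Y; [exact (proj2 (to_disc_level x))|].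
      exact (proj2 (to_disc_level y)).
    + exists h; split; apply to_disc_eq; simpl; rewrite Hh; assumption.
Qed.

(** Right adjoints need not preserve coequalizers, but this one is a quotient of a discrete
    groupoid. The universal property gives a functor [s] from Q to the discrete groupoid on its
    objects that the counit retracts, so [s] is the identity on objects and maps out of [g0 Q] are
    tested on functors out of Q. *)
Lemma coeq_g0 {S Q : Grpd C} {a : C} {u v : Hom S (disc a)} {q : Hom (disc a) Q} :
  is_coequalizer u v q -> is_coequalizer (f0 u) (f0 v) (f0 q).
Proof.
  intros [E U]; split; [exact (lv0 E)|]; intros T x X.
  destruct (U (disc T) (dmap x)) as (h & Hh & V); [now apply to_disc_eq|].
  exists (f0 h); split; [exact (lv0 Hh)|]; intros h' Hh'.
  destruct (U (disc (g0 Q)) (dmap (f0 q))) as (s & Hs & _).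
  { apply to_disc_eq; exact (lv0 E). }
  destruct (U Q q E) as (w & _ & W).
  assert (K : @tr (g0 Q) Q (idm _) ∘ s = idm Q).
  { rewrite (W (idm Q)), (W (tr (idm _) ∘ s)); auto; [|now cn].
    rewrite <- comp_assoc, Hs; apply from_disc_eq; simpl; now cn. }
  apply lv0 in K; simpl in K; rewrite comp_id_l in K.
  assert (R : dmap h' ∘ s = h).
  { apply V; rewrite <- comp_assoc, Hs; now apply to_disc_eq. }
  apply lv0 in R; simpl in R; now rewrite K, comp_id_r in R.
Qed.

Lemma disc_coeq {r a Q : C} {u v : Hom r a} {q : Hom a Q} :
  is_coequalizer u v q -> is_coequalizer (dmap u) (dmap v) (dmap q).
Proof.
  intros [E U]; split; [now apply to_disc_eq|]; intros T x X.
  destruct (U (g0 T) (f0 x) (lv0 X)) as (h & Hh & V); exists (tr h); split.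
  - apply from_disc_eq; exact Hh.
  - intros h' Hh'; apply from_disc_eq, V; exact (lv0 Hh').
Qed.

(** * Transfer of the properties to C *)

Lemma discrete_complete : @finitely_complete (Grpd C) -> @finitely_complete C.
Proof.
  intros [[T HT] PB]; split.
  - exists (g0 T); intros a; destruct (HT (disc a)) as [f Hf]; exists (f0 f); intros g.
    exact (lv0 (Hf (tr g))).
  - intros a b c f g; destruct (PB _ _ _ (dmap f) (dmap g)) as (P & p & q & H).
    exists (g0 P), (f0 p), (f0 q); exact (pb_g0 H).
Qed.

(** The initial object comes from the zero object; pushouts are treated as the coequalizers in
    [coeq_g0]. *)
Lemma discrete_cocomplete : @pointed (Grpd C) ->
  @finitely_cocomplete (Grpd C) -> @finitely_cocomplete C.
Proof.
  intros [Z HZ] [_ PO]; split; [exists (g0 Z); apply (zero_g0 HZ)|].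
  intros a b c f g; destruct (PO _ _ _ (dmap f) (dmap g)) as (Q & p & q & E & U).
  exists (g0 Q), (f0 p), (f0 q); split; [exact (lv0 E)|]; intros T x y X.
  destruct (U (disc T) (dmap x) (dmap y)) as (h & [H1 H2] & V); [now apply to_disc_eq|].
  exists (f0 h); split; [split; [exact (lv0 H1) | exact (lv0 H2)]|]; intros h' K1 K2.
  destruct (U (disc (g0 Q)) (dmap (f0 p)) (dmap (f0 q))) as (s & [S1 S2] & _).
  { apply to_disc_eq; exact (lv0 E). }
  destruct (U Q p q E) as (w & _ & W).
  assert (K : @tr (g0 Q) Q (idm _) ∘ s = idm Q).
  { rewrite (W (idm Q)), (W (tr (idm _) ∘ s)); auto; try (now cn);
      rewrite <- comp_assoc, ?S1, ?S2; apply from_disc_eq; simpl; now cn. }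
  apply lv0 in K; simpl in K; rewrite comp_id_l in K.
  assert (R : dmap h' ∘ s = h).
  { apply V; rewrite <- comp_assoc, ?S1, ?S2; now apply to_disc_eq. }
  apply lv0 in R; simpl in R; now rewrite K, comp_id_r in R.
Qed.

Lemma discrete_exact : @Barr_exact (Grpd C) -> @Barr_exact C.
Proof.
  intros [(FC & CO & ST) EF]; split; [split; [exact (discrete_complete FC)|split]|].
  - intros a b R f u v K.
    destruct (CO _ _ _ _ _ _ (disc_pb K)) as (Q & q & H).
    exists (g0 Q), (f0 q); exact (coeq_g0 H).
  - intros a b c P f g p q PB (r & u & v & H).
    destruct (ST _ _ _ _ _ _ _ _ (disc_pb PB)) as (S & u' & v' & H').
    { exists (disc r), (dmap u), (dmap v); exact (disc_coeq H). }
    exists (g0 S), (f0 u'), (f0 v'); exact (coeq_g0 H').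
  - intros a R u v (J & (s & S1 & S2) & (t & T1 & T2) & Tr).
    destruct (EF (disc a) (disc R) (dmap u) (dmap v)) as (B & f & K).
    { split; [|split; [|split]].
      - intros T x y X Y; apply to_disc_eq, J; [exact (lv0 X) | exact (lv0 Y)].
      - exists (dmap s); split; apply to_disc_eq; assumption.
      - exists (dmap t); split; apply to_disc_eq; assumption.
      (* Transitivity in C is applied to the objects of P; the result is constant on connected
         components because [p] and [q] are. *)
      - intros P p q PB; destruct (Tr _ _ _ (pb_g0 PB)) as (m0 & M1 & M2).
        destruct (@to_disc R P m0) as (m & Hm).
        + pose proof (proj2 (to_disc_level p)) as Ep; pose proof (proj2 (to_disc_level q)) as Eq.
          apply J; simpl in *; rewrite !comp_assoc, ?M1, ?M2, <- !comp_assoc.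
          * now rewrite Ep.
          * now rewrite Eq.
        + exists m; split; apply to_disc_eq; simpl; rewrite Hm; assumption. }
    exists (g0 B), (f0 f); exact (pb_g0 K).
Qed.

Lemma discrete_protomodular : @protomodular (Grpd C) -> @protomodular C.
Proof.
  intros HP E B A A' P P' f p s p' s' h q1 q2 q1' q2' k H1 H2 H3 H4 PB PB' H5 H6 I.
  apply disc_iso.
  apply (HP _ _ _ _ _ _ (dmap f) (dmap p) (dmap s) (dmap p') (dmap s') (dmap h) (dmap q1)
            (dmap q2) (dmap q1') (dmap q2') (dmap k)); try (apply to_disc_eq; assumption).
  - exact (disc_pb PB).
  - exact (disc_pb PB').
  - exact (iso_disc I).
Qed.

Lemma discrete_semi_abelian : @semi_abelian (Grpd C) -> @semi_abelian C.
Proof.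
  intros (PT & FC & FCC & EX & PM); split; [|split; [|split; [|split]]].
  - destruct PT as [Z HZ]; exists (g0 Z); exact (zero_g0 HZ).
  - exact (discrete_complete FC).
  - exact (discrete_cocomplete PT FCC).
  - exact (discrete_exact EX).
  - exact (discrete_protomodular PM).
Qed.

Definition disc_ext {X B : C} (E : SplitExt X B) : SplitExt (disc X) (disc B) :=
  @Build_SplitExt (Grpd C) (disc X) (disc B) (disc (se_A E)) (dmap (se_k E)) (dmap (se_a E))
    (dmap (se_b E)) (@to_disc_eq _ _ (dmap (se_a E) ∘ dmap (se_b E)) (idm _) (se_ab E))
    (disc_ker (se_ker E)).

Definition ext_g0 {X B : Grpd C} (E : SplitExt X B) : SplitExt (g0 X) (g0 B) :=
  @Build_SplitExt C (g0 X) (g0 B) (g0 (se_A E)) (f0 (se_k E)) (f0 (se_a E)) (f0 (se_b E))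
    (lv0 (se_ab E)) (ker_g0 (se_ker E)).

Lemma discrete_action_representable :
  @action_representable (Grpd C) -> @action_representable C.
Proof.
  intros AR X; destruct (AR (disc X)) as (B & G & U).
  exists (g0 B), (ext_g0 G); intros B' E.
  destruct (U _ (disc_ext E)) as (u & v & (M1 & M2 & M3) & V).
  exists (f0 u), (f0 v); split.
  - split; [exact (lv0 M1)|split; [exact (lv0 M2) | exact (lv0 M3)]].
  - intros u' v' (N1 & N2 & N3).
    destruct (V (@tr _ (se_A G) u') (tr v')) as [E1 E2].
    + split; [|split]; apply from_disc_eq; assumption.
    + split; [exact (lv0 E1) | exact (lv0 E2)].
Qed.

Lemma disc_se_mono {X B X' B' : C} {E : SplitExt X B} {E' : SplitExt X' B'} {x : Hom X X'}
  {u : Hom (se_A E) (se_A E')} {v : Hom B B'} :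
  se_mono E E' x u v ->
  se_mono (disc_ext E) (disc_ext E') (dmap x) (@dmap (se_A E) (se_A E') u) (dmap v).
Proof.
  intros [(M1 & M2 & M3) U]; split.
  - split; [|split]; apply to_disc_eq; assumption.
  - intros X0 B0 E0 x1 u1 v1 x2 u2 v2 (P1 & P2 & P3) (Q1 & Q2 & Q3) Ex Eu Ev.
    destruct (U _ _ (ext_g0 E0) (f0 x1) (f0 u1) (f0 v1) (f0 x2) (f0 u2) (f0 v2))
      as (R1 & R2 & R3).
    + split; [exact (lv0 P1)|split; [exact (lv0 P2) | exact (lv0 P3)]].
    + split; [exact (lv0 Q1)|split; [exact (lv0 Q2) | exact (lv0 Q3)]].
    + exact (lv0 Ex).
    + exact (lv0 Eu).
    + exact (lv0 Ev).
    + split; [|split]; apply to_disc_eq; assumption.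
Qed.

Lemma disc_jse {a1 a2 a : C} {h1 : Hom a1 a} {h2 : Hom a2 a} :
  jointly_strongly_epic h1 h2 <-> jointly_strongly_epic (dmap h1) (dmap h2).
Proof.
  split; intros [J L]; split.
  - intros T g h X Y; apply from_disc_eq, J; [exact (lv0 X) | exact (lv0 Y)].
  - intros M N m g k1 k2 Mm X Y.
    destruct (L _ _ (f0 m) (f0 g) (f0 k1) (f0 k2) (mono_g0 Mm) (lv0 X) (lv0 Y))
      as (d & D1 & D2 & D3).
    exists (tr d); split; [|split]; apply from_disc_eq; assumption.
  - intros T g h X Y; assert (E : dmap g = dmap h).
    { apply J; apply to_disc_eq; assumption. }
    exact (lv0 E).
  - intros M N m g k1 k2 Mm X Y.
    destruct (L _ _ (dmap m) (dmap g) (dmap k1) (dmap k2) (disc_mono Mm)) as (d & D1 & D2 & D3).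
    { now apply to_disc_eq. }
    { now apply to_disc_eq. }
    exists (f0 d); split; [exact (lv0 D1)|split; [exact (lv0 D2) | exact (lv0 D3)]].
Qed.

Lemma discrete_algebraically_coherent :
  @algebraically_coherent (Grpd C) -> @algebraically_coherent C.
Proof.
  intros AC X1 X2 X B E1 E2 E u1 v1 u2 v2 S1 S2 J.
  assert (Ei : dmap (idm B) = idm (disc B)) by (now apply to_disc_eq).
  apply disc_se_mono in S1, S2; rewrite Ei in S1, S2; apply disc_jse.
  apply (AC _ _ _ _ (disc_ext E1) (disc_ext E2) (disc_ext E) (dmap u1)
           (@dmap (se_A E1) (se_A E) v1) (dmap u2) (@dmap (se_A E2) (se_A E) v2)).
  - exact S1.
  - exact S2.
  - now apply disc_jse in J.
Qed.

Lemma discrete_has_normalizers : @has_normalizers (Grpd C) -> @has_normalizers C.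
Proof.
  intros HN a b f M.
  destruct (HN _ _ (dmap f) (disc_mono M)) as (N & n & m & ((Q & q & K) & Mm & E) & U).
  exists (g0 N), (f0 n), (f0 m); split; [split; [|split]|].
  - exists (g0 Q), (f0 q); exact (ker_g0 K).
  - exact (mono_g0 Mm).
  - exact (lv0 E).
  - intros N' n' m' (Q' & q' & K') Mm' E'.
    destruct (U _ (dmap n') (dmap m')) as (t & [T1 T2] & V).
    + exists (disc Q'), (dmap q'); exact (disc_ker K').
    + exact (disc_mono Mm').
    + now apply to_disc_eq.
    + exists (f0 t); split; [split; [exact (lv0 T1) | exact (lv0 T2)]|].
      intros t' X Y; refine (lv0 (V (tr t') _ _)); apply from_disc_eq; assumption.
Qed.

End Discrete.

Theorem theorem2p10 (C : Category) :
  (@semi_abelian C /\ @action_representable C /\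
   @algebraically_coherent C /\ @has_normalizers C) <->
  (@semi_abelian (Grpd C) /\ @action_representable (Grpd C) /\
   @algebraically_coherent (Grpd C) /\ @has_normalizers (Grpd C)).
Proof.
  split; intros (SA & AR & AC & HN); split; [|split; [|split]| |split; [|split]].
  - exact grpd_semi_abelian.
  - exact (grpd_action_representable AR AC HN).
  - exact (grpd_algebraically_coherent AC).
  - exact (grpd_has_normalizers HN).
  - exact (discrete_semi_abelian SA).
  - exact (discrete_action_representable AR).
  - exact (discrete_algebraically_coherent AC).
  - exact (discrete_has_normalizers HN).
Qed.
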